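(* Let $\alpha,\beta\in\{0,1\}$. There is a constant $C\ge1$, independent of $N\ge1$, such that for all $u_h\in V_{h,N}^{(0,0)}$, $$C^{-1}\|\partial_xu_h\|_{(\alpha,\beta)}\le\|\partial_xI_N^{(0,0)}u_h\|_{(\alpha,\beta)}\le C\,\|\partial_xu_h\|_{(\alpha,\beta)} .$$
   Context: $\|v\|_{(\alpha,\beta)}^2=\int_{-1}^1v(x)^2(1-x)^\alpha(1+x)^\beta\,dx$. $-1=\xi_0<\dots<\xi_N=1$ are the $N+1$ Gauss--Lobatto points (roots of $(1-x^2)P_N'(x)$, $P_N$ the Legendre polynomial). $V_{h,N}^{(0,0)}$ is the space of continuous functions on $[-1,1]$ that are piecewise linear with respect to the points $\xi_i$. $I_N^{(0,0)}u$ is the polynomial of degree at most $N$ with $(I_N^{(0,0)}u)(\xi_i)=u(\xi_i)$, $0\le i\le N$. *)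

(* Defs.v *)
From mathcomp Require Import all_boot all_order all_algebra.
From mathcomp Require Import all_classical all_reals all_analysis.
From mathcomp Require Import polyrcf.

Set Implicit Arguments.
Unset Strict Implicit.
Unset Printing Implicit Defensive.

Import Order.TTheory GRing.Theory Num.Theory.
Import numFieldNormedType.Exports.

Local Open Scope classical_set_scope.
Local Open Scope ring_scope.

(* Rodrigues' formula: P_N = (1 / (2^N N!)) (d/dX)^N (X^2 - 1)^N. *)
Definition legendre (R : realType) (N : nat) : {poly R} :=
  (2 ^+ N * N`!%:R)^-1 *: (('X^2 - 1) ^+ N)^`(N).

(* [rootsR] lists the distinct real roots in increasing order; for N >= 1 all
   N + 1 roots of this polynomial are real and simple, so the list is
   [:: xi_0; ...; xi_N] with xi_0 = -1 and xi_N = 1. *)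
Definition gauss_lobatto (R : realType) (N : nat) : seq R :=
  rootsR ((1 - 'X^2) * (legendre R N)^`()).

Definition gl_point (R : realType) (N i : nat) : R := (gauss_lobatto R N)`_i.

(* Only the values of u on [-1, 1] matter. *)
Definition gl_piecewise_linear (R : realType) (N : nat) (u : R -> R) : Prop :=
  {within `[-1, 1], continuous u} /\
  forall i, (i < N)%N ->
    exists a b : R, forall x : R,
      x \in `[gl_point R N i, gl_point R N i.+1] -> u x = a * x + b.

Definition gl_interpolant (R : realType) (N : nat) (u : R -> R)
    (p : {poly R}) : Prop :=
  (size p <= N.+1)%N /\
  forall i, (i <= N)%N -> p.[gl_point R N i] = u (gl_point R N i).

Definition jacobi_norm (R : realType) (alpha beta : nat) (v : R -> R) : R :=
  Num.sqrt (\int[lebesgue_measure]_(x in `[-1, 1])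
    (v x ^+ 2 * (1 - x) ^+ alpha * (1 + x) ^+ beta)).

(* Main.v *)
(** All energies involved are integrals of polynomials over cells between
    consecutive nodes.  With [w] the Jacobi weight and [w*] the complementary one,
    [w w* = 1 - x^2], the operators [v |-> w* v'] and [f |-> - (w f)'] turn
    statements on derivatives in [L^2(w)] into statements on functions in [L^2(w* )],
    and the Jacobi Sturm-Liouville operator [- (w* (w f)')'] gives the inverse
    inequality for polynomials of degree at most [N] as well as the gain of a factor
    [1 / N] for functions orthogonal to the lower degrees.

    Bounding [u'] by [p' = (I_N u)'] is Cauchy-Schwarz on each cell, except in a
    cell touching an endpoint where [w] vanishes; there [p] is expanded in
    Legendre polynomials. Conversely, let [r] be the projection of [u'] on the
    polynomials of degree [< N] in [L^2(w)], [V] its primitive and [z = p - V = w*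
    zh]. Integrating by parts, applying Gauss-Lobatto quadrature and the inverse
    inequality give [|z'|_w^2 <= N (N + 1) \sum_i om_i w*(x_i) zh(x_i)^2] with
    quadrature weights [om_i], and [z = u - V] at the nodes. At interior nodes
    this sum is tested against quadratic bumps supported on a fraction of the cell
    to the left of the node: since [u' - r] is orthogonal to low degrees, [u - V]
    is small in the dual norm. The geometry of the nodes (gaps and weights are
    comparable to [sqrt (1 - x^2) / N]) follows from Legendre's equation, through
    the energy [P^2 + (1 - x^2) P'^2 / (N (N + 1))] and the Sonin function. *)

From HB Require Import structures.
Require Import Defs.
From mathcomp Require Import all_boot all_order all_algebra.
From mathcomp Require Import all_classical all_reals all_analysis.
From mathcomp Require Import measurable_realfun.
From mathcomp Require cauchyreals.
From mathcomp Require Import polyorder polyrcf ring lra zify.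
Set Implicit Arguments.
Unset Strict Implicit.
Unset Printing Implicit Defensive.
Import Order.TTheory GRing.Theory Num.Theory.
Import numFieldNormedType.Exports.
Local Open Scope ring_scope.

(** * Integrals of polynomials *)

Section PolynomialIntegral.
Variable R : rcfType.
Implicit Types (f g h : {poly R}) (a b c x : R).

(** The inverse inequality costs a factor of order [N], so it can only be applied to something of
    size [1 / N]. Subtracting [r] produces such a quantity: [u' - r] is orthogonal to the degrees
    below [N]. But [u - V] is then small in a dual norm only, while the quadrature sum sees point
    values. Averaging over bumps whose width is comparable to the quadrature weight turns one into
    the other, and the error of this averaging is paid by [u' - r] on the cell itself. Bumps cut off
    outside their support are not polynomials, so the dual bound reaches them by uniform
    approximation.

    The primitive [V] has a free constant. At an endpoint where [w] does not vanish, [w*] does, and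
    [z] has to vanish there to be divisible by [w*]; when [w*] is constant, the freedom is spent on
    giving [u - V] mean zero. The endpoint nodes carry no bump and are reached from the neighbouring
    interior node, so [N = 1] is treated apart.

    Integrals are differences of values of primitives, which keeps the analysis algebraic until the
    norms are identified at the end. *)

Definition primitive f : {poly R} :=
  \poly_(i < (size f).+1) (f`_i.-1 / i%:R).

Lemma coef_primitive f i : (primitive f)`_i = f`_i.-1 / i%:R.
Proof.
(* At [i = 0] the quotient by [0] is [0], so primitives have no constant term. *)
rewrite coef_poly; case: i => [|i] /=; first by rewrite invr0 mulr0.
by case: ltnP => // le; rewrite nth_default ?mul0r.
Qed.

Lemma deriv_primitive f : (primitive f)^`() = f.
Proof.
apply/polyP => i; rewrite coef_deriv coef_primitive /= -(mulr_natr (_ / _)) divfK //.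
Qed.

Fact primitive_is_linear : linear primitive.
Proof.
move=> k f g; apply/polyP => i.
by rewrite coefD coefZ !coef_primitive coefD coefZ mulrDl mulrA.
Qed.
HB.instance Definition _ :=
  GRing.isLinear.Build R {poly R} {poly R} _ primitive primitive_is_linear.

Definition pint a b f : R := (primitive f).[b] - (primitive f).[a].

Fact pint_is_linear a b : scalar (pint a b).
Proof.
move=> k f g; rewrite /pint primitive_is_linear !hornerD !hornerZ /=; ring.
Qed.
HB.instance Definition _ a b :=
  GRing.isLinear.Build R {poly R} R _ (pint a b) (pint_is_linear a b).

Lemma pintZ a b k f : pint a b (k *: f) = k * pint a b f.
Proof. exact: linearZ. Qed.

Lemma pintD a b f g : pint a b (f + g) = pint a b f + pint a b g.
Proof. exact: linearD. Qed.

Lemma pintN a b f : pint a b (- f) = - pint a b f.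
Proof. exact: linearN. Qed.

Lemma pintB a b f g : pint a b (f - g) = pint a b f - pint a b g.
Proof. exact: linearB. Qed.

Lemma pint0 a b : pint a b 0 = 0.
Proof. exact: linear0. Qed.

Lemma pint_deriv a b f : pint a b f^`() = f.[b] - f.[a].
Proof.
have d0 : (primitive f^`() - f)^`() = 0.
  by rewrite derivB deriv_primitive subrr.
have /size1_polyC e : (size (primitive f^`() - f)%R <= 1)%N.
  apply: contra_eqT d0 => /=; rewrite -ltnNge => sz.
  by rewrite -size_poly_eq0 size_deriv -lt0n -ltnS prednK // ltnW.
rewrite /pint -[primitive _](subrK f) e !hornerE; ring.
Qed.

Lemma pint_by_parts a b f g :
  pint a b (f^`() * g) = f.[b] * g.[b] - f.[a] * g.[a] - pint a b (f * g^`()).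
Proof.
by rewrite -!hornerM -pint_deriv derivM linearD /= addrK.
Qed.

Lemma pint_split b a c f : pint a c f = pint a b f + pint b c f.
Proof. rewrite /pint; ring. Qed.

Lemma pint_point a f : pint a a f = 0.
Proof. by rewrite /pint subrr. Qed.

Lemma pint_ge0_oo a b f : a <= b ->
  (forall x, a < x -> x < b -> 0 <= f.[x]) -> 0 <= pint a b f.
Proof.
move=> leab f0; rewrite /pint subr_ge0.
apply: (@ler_hornerW _ a b); rewrite ?in_itv /= ?lexx ?leab //.
by move=> x; rewrite deriv_primitive in_itv /= => /andP[ax xb]; exact: f0.
Qed.

Lemma pint_ge0 a b f : a <= b ->
  (forall x, a <= x -> x <= b -> 0 <= f.[x]) -> 0 <= pint a b f.
Proof. by move=> ab f0; apply: pint_ge0_oo => // x /ltW ax /ltW xb; exact: f0. Qed.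

Lemma ler_pint a b f g : a <= b ->
  (forall x, a <= x -> x <= b -> f.[x] <= g.[x]) -> pint a b f <= pint a b g.
Proof.
move=> leab fg; rewrite -subr_ge0 -linearB; apply: pint_ge0 => // x ax xb.
by rewrite !hornerE subr_ge0 fg.
Qed.

Lemma pint_const a b k : pint a b k%:P = k * (b - a).
Proof.
by rewrite -[k%:P]mulr1 -(derivX R) mul_polyC pintZ pint_deriv !hornerE.
Qed.

Lemma ler_norm_pint a b f m : a <= b ->
  (forall x, a <= x -> x <= b -> `|f.[x]| <= m) ->
  `|pint a b f| <= m * (b - a).
Proof.
move=> leab fm; rewrite -pint_const ler_norml -linearN.
by apply/andP; split; apply: ler_pint => // x ax xb;
  have := fm x ax xb; rewrite ler_norml !hornerE => /andP[].
Qed.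

Lemma poly_eq0_on f a b : a < b ->
  (forall x, a < x -> x < b -> f.[x] = 0) -> f = 0.
Proof.
(* These are [size f] distinct points; the offset in [i.+2] keeps the first one away from [b]. *)
move=> ltab f0; pose rs := [seq a + (b - a) / i.+2%:R | i <- iota 0 (size f)].
apply: (@poly_ltsp_roots _ f rs); first by rewrite size_map size_iota.
  rewrite map_inj_uniq ?iota_uniq // => i j /addrI /mulfI.
  by rewrite subr_eq0 gt_eqF // => /(_ isT) /invr_inj /eqP;
    rewrite eqr_nat => /eqP[].
apply/allP => _ /mapP[i _ ->]; apply/rootP; apply: f0.
  by rewrite ltrDl divr_gt0 // subr_gt0.
rewrite -ltrBrDl ltr_pdivrMr // ltr_pMr ?subr_gt0 //.
by rewrite ltr1n.
Qed.

(** The primitive is nondecreasing with equal values at both ends, hence constant on the interval,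
    and its derivative is the zero polynomial. *)
Lemma pint_ge0_eq0_oo a b f : a < b ->
  (forall x, a < x -> x < b -> 0 <= f.[x]) -> pint a b f = 0 -> f = 0.
Proof.
move=> ltab f0 i0.
have F0 x : a < x -> x < b -> (primitive f - (primitive f).[a]%:P).[x] = 0.
  move=> ax xb; apply/eqP; rewrite eq_le !hornerE.
  have h1 : 0 <= pint a x f.
    apply: pint_ge0_oo => [|y ay yx]; first exact: ltW.
    by apply: f0 => //; apply: lt_trans xb.
  have h2 : 0 <= pint x b f.
    apply: pint_ge0_oo => [|y xy yb]; first exact: ltW.
    by apply: f0 => //; apply: lt_trans xy.
  move: i0 h1 h2; rewrite /pint; lra.
have /(congr1 (@deriv R)) := poly_eq0_on ltab F0.
by rewrite derivB deriv_primitive derivC subr0 raddf0.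
Qed.

Lemma pint_ge0_eq0 a b f : a < b ->
  (forall x, a <= x -> x <= b -> 0 <= f.[x]) -> pint a b f = 0 -> f = 0.
Proof.
move=> ab f0; apply: pint_ge0_eq0_oo => // x /ltW ax /ltW xb; exact: f0.
Qed.

Lemma pint_comp_opp a b f : pint a b (f \Po - 'X) = pint (- b) (- a) f.
Proof.
have -> : f \Po - 'X = (- (primitive f \Po - 'X))^`().
  rewrite derivN deriv_comp deriv_primitive derivN derivX; ring.
rewrite pint_deriv /pint !hornerN !horner_comp !hornerE; ring.
Qed.

End PolynomialIntegral.

(** Common source of the Cauchy-Schwarz inequalities. If [c < 0], adding the values at [t] and [- t]
    gives a contradiction for large [t]; if [c = 0], the linear term must vanish. *)
Lemma discr_le (R : realFieldType) (a b c : R) :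
  (forall t, 0 <= a + 2 * t * b + t ^+ 2 * c) -> b ^+ 2 <= a * c.
Proof.
move=> H.
have [c0|c0|c0] := ltgtP c 0.
- have a0 : 0 <= a by have := H 0; rewrite expr0n /=; lra.
  pose t := 1 + a / - c.
  have nc : 0 < - c by lra.
  have t1 : 1 <= t by rewrite lerDl divr_ge0 // ltW.
  have tc : t * - c = - c + a by rewrite /t; field; lra.
  have : t * - c <= t ^+ 2 * - c by rewrite ler_pM2r // expr2 ler_peMl; lra.
  have := H (- t); have := H t; rewrite sqrrN; lra.
- have := H (- b / c).
  have -> : a + 2 * (- b / c) * b + (- b / c) ^+ 2 * c = a - b ^+ 2 / c.
    by field; rewrite gt_eqF.
  by rewrite subr_ge0 ler_pdivrMr.
- rewrite c0 mulr0; have [->|b0] := eqVneq b 0; first by rewrite expr0n.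
  have := H (- (a + 1) / (2 * b)); rewrite c0.
  have -> : a + 2 * (- (a + 1) / (2 * b)) * b + (- (a + 1) / (2 * b)) ^+ 2 * 0 = -1.
    by field.
  lra.
Qed.

(* Unlike [hornerE], this does not reassociate products. *)
Definition polyE := (hornerD, hornerN, hornerZ, hornerX, hornerC, horner_exp,
  hornerXn, hornerMn, hornerM, horner0).

(** * Jacobi weights and the associated spectral inequalities *)

Section WeightedInnerProduct.
Variables (R : rcfType) (w : {poly R}).
Hypothesis w_neq0 : w != 0.
Hypothesis w_ge0 : forall x : R, -1 <= x -> x <= 1 -> 0 <= w.[x].
Implicit Types (f g h p q r : {poly R}) (c M : R).

Definition ip f g : R := pint (-1) 1 (w * (f * g)).

Lemma ipC f g : ip f g = ip g f.
Proof. by rewrite /ip (mulrC f). Qed.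

Lemma ip_linear f c g h : ip f (c *: g + h) = c * ip f g + ip f h.
Proof. by rewrite /ip mulrDr -scalerAr mulrDr -scalerAr linearP. Qed.

Lemma ipDr f g h : ip f (g + h) = ip f g + ip f h.
Proof. by rewrite -[g]scale1r ip_linear mul1r scale1r. Qed.

Lemma ip0r f : ip f 0 = 0.
Proof. by rewrite /ip !mulr0 raddf0. Qed.

Lemma ipZr f c g : ip f (c *: g) = c * ip f g.
Proof. by rewrite -[c *: g]addr0 ip_linear ip0r addr0. Qed.

Lemma ipBr f g h : ip f (g - h) = ip f g - ip f h.
Proof. by rewrite ipDr -scaleN1r ipZr mulN1r. Qed.

Lemma ipDl f g h : ip (f + g) h = ip f h + ip g h.
Proof. by rewrite ipC ipDr !(ipC h). Qed.

Lemma ipZl c f g : ip (c *: f) g = c * ip f g.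
Proof. by rewrite ipC ipZr ipC. Qed.

Lemma ipBl f g h : ip (f - g) h = ip f h - ip g h.
Proof. by rewrite ipC ipBr !(ipC h). Qed.

Lemma ip_ge0 f : 0 <= ip f f.
Proof.
apply: pint_ge0 => [|x x0 x1]; first lra.
by rewrite !hornerM -expr2 mulr_ge0 ?sqr_ge0 // w_ge0.
Qed.

Lemma ip_eq0 f : ip f f = 0 -> f = 0.
Proof.
have lt11 : (-1 : R) < 1 by lra.
move=> /(pint_ge0_eq0 lt11) H; apply/eqP; have := w_neq0; apply: contraR => f0.
rewrite -(mulIr_eq0 w (mulIf (mulf_neq0 f0 f0))) H // => x x0 x1.
by rewrite !hornerM -expr2 mulr_ge0 ?sqr_ge0 // w_ge0.
Qed.

Lemma ip_gt0 f : f != 0 -> 0 < ip f f.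
Proof.
move=> f0; rewrite lt_neqAle ip_ge0 andbT eq_sym.
by apply: contra f0 => /eqP /ip_eq0 ->.
Qed.

Lemma ip_CS f g : ip f g ^+ 2 <= ip f f * ip g g.
Proof.
apply: discr_le => t; have := ip_ge0 (f + t *: g).
rewrite ipDl !ipDr !ipZl !ipZr (ipC g f); congr (_ <= _); ring.
Qed.

Lemma size_monic_cancel n f p : p`_n = 1 -> (size p <= n.+1)%N ->
  (size f <= n.+1)%N -> (size (f - f`_n *: p)%R <= n)%N.
Proof.
move=> pn sp sf; apply/leq_sizeP => j; rewrite leq_eqVlt => /predU1P[<-|lt].
  by rewrite coefB coefZ pn mulr1 subrr.
by rewrite coefB coefZ (nth_default 0 (leq_trans sf lt))
  (nth_default 0 (leq_trans sp lt)) mulr0 subrr.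
Qed.

(** Gram-Schmidt by induction: the induction hypothesis for [ip 'X^n] yields the monic orthogonal
    polynomial [p] of degree [n], and a multiple of [p] corrects the representer. The functional is
    abstract because it will be the pairing with a piecewise polynomial. *)
Lemma riesz n (l : {poly R} -> R) : scalar l ->
  exists2 r : {poly R}, (size r <= n)%N & forall f, (size f <= n)%N -> ip r f = l f.
Proof.
elim: n l => [|n IHn] l lin_l.
  exists 0; first by rewrite size_poly0.
  move=> f; rewrite leqn0 size_poly_eq0 => /eqP ->.
  by rewrite ip0r; have := lin_l (-1) 0 0; rewrite scaler0 addr0 mulN1r addNr.
have [|t st tP] := IHn (ip 'X^n); first by move=> c g h; exact: ip_linear.
pose p := 'X^n - t.
have pn : p`_n = 1 by rewrite coefB coefXn eqxx nth_default // subr0.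
have sp : (size p <= n.+1)%N.
  rewrite (leq_trans (size_polyD _ _)) // geq_max size_polyXn leqnn size_polyN.
  exact: leqW.
have po f : (size f <= n)%N -> ip p f = 0.
  by move=> sf; rewrite ipBl tP // subrr.
have p0 : p != 0.
  by apply: contra_eq_neq pn => ->; rewrite coef0 eq_sym oner_neq0.
clearbody p.
have [r0 sr0 r0P] := IHn l lin_l.
exists (r0 + (l p / ip p p) *: p).
  rewrite (leq_trans (size_polyD _ _)) // geq_max (leqW sr0) /=.
  exact: leq_trans (size_scale_leq _ _) sp.
move=> f sf; have sf1 := size_monic_cancel pn sp sf.
have fE : f = f`_n *: p + (f - f`_n *: p) by rewrite addrC subrK.
set f1 := f - _ in fE sf1; rewrite fE lin_l ip_linear !ipDl !ipZl.
rewrite (r0P _ sf1) (po _ sf1) mulr0 addr0 (ipC r0) (po _ sr0) add0r.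
by rewrite divfK // gt_eqF // ip_gt0.
Qed.

Lemma orthogonal_poly n : exists p : {poly R}, [/\ p`_n = 1, (size p <= n.+1)%N &
  forall f, (size f <= n)%N -> ip p f = 0].
Proof.
have [|t st tP] := @riesz n (ip 'X^n); first by move=> c g h; exact: ip_linear.
exists ('X^n - t); split.
- by rewrite coefB coefXn eqxx nth_default // subr0.
- rewrite (leq_trans (size_polyD _ _)) // geq_max size_polyXn leqnn size_polyN.
  exact: leqW.
- by move=> f sf; rewrite ipBl tP // subrr.
Qed.

(** * Symmetric operators that are triangular in the degree *)

Section Spectral.
Variables (T : {poly R} -> {poly R}) (mu : nat -> R).
Hypothesis T_lin : linear T.
Hypothesis T_sym : forall f g, ip f (T g) = ip (T f) g.
Hypothesis T_coef : forall n f, (size f <= n.+1)%N -> (T f)`_n = mu n * f`_n.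

(** [T p] and [mu n *: p] have the same coefficient of degree [n], so their difference has lower
    degree; by symmetry it is orthogonal to all lower degrees, hence to itself. *)
Lemma eigen_orthogonal n p : (size p <= n.+1)%N ->
  (forall f, (size f <= n)%N -> ip p f = 0) -> T p = mu n *: p.
Proof.
move=> sp po.
have sT f : (size (T f) <= size f)%N.
  by apply/leq_sizeP => j lj; rewrite T_coef ?nth_default ?mulr0 // leqW.
pose e := T p - mu n *: p.
have se : (size e <= n)%N.
  apply/leq_sizeP => j; rewrite leq_eqVlt => /predU1P[<-|lt].
    by rewrite coefB coefZ T_coef // subrr.
  rewrite coefB coefZ (nth_default 0 (leq_trans sp lt)) mulr0 subr0 nth_default //.
  exact: leq_trans (leq_trans (sT _) sp) lt.
have eo f : (size f <= n)%N -> ip e f = 0.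
  move=> sf; rewrite ipBl ipZl -T_sym !po ?mulr0 ?subrr //.
  exact: leq_trans (sT _) sf.
by apply/eqP; rewrite -subr_eq0; apply/eqP/ip_eq0/eo.
Qed.

(** The orthogonal polynomial of top degree is an eigenvector, so the norm and the quadratic form of
    [T] split without cross terms. Iterating this replaces an eigenbasis. *)
Lemma spectral_step n f : (size f <= n.+1)%N ->
  exists c (p f1 : {poly R}), [/\ f = c *: p + f1, (size f1 <= n)%N,
    forall g : {poly R}, (size g <= n)%N -> ip p g = 0,
    ip f f = c ^+ 2 * ip p p + ip f1 f1 &
    ip f (T f) = mu n * (c ^+ 2 * ip p p) + ip f1 (T f1)].
Proof.
move=> sf; have [p [pn sp po]] := orthogonal_poly n.
have sf1 := size_monic_cancel pn sp sf.
have Tp := eigen_orthogonal sp po.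
exists f`_n, p, (f - f`_n *: p).
have fE : f = f`_n *: p + (f - f`_n *: p) by rewrite addrC subrK.
set f1 := f - _ in fE sf1 *; set c := f`_n in fE *; clearbody f1 c.
have f1p : ip f1 p = 0 by rewrite ipC po.
split=> //.
  rewrite {1 2}fE !ipDl !ipDr !ipZl !ipZr f1p (ipC p f1) f1p; ring.
rewrite {1 2}fE T_lin Tp !ipDl !ipDr !ipZl !ipZr f1p T_sym Tp ipZl (ipC p f1) f1p.
ring.
Qed.

Lemma spectral_le n f M : (size f <= n)%N ->
  (forall k, (k < n)%N -> mu k <= M) -> ip f (T f) <= M * ip f f.
Proof.
elim: n f => [|n IHn] f sf muM.
  move: sf; rewrite leqn0 size_poly_eq0 => /eqP ->.
  by rewrite (ipC 0) !ip0r mulr0.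
have [c [p [f1 [_ sf1 _ -> ->]]]] := spectral_step sf.
have := IHn _ sf1 (fun k lt => muM k (leqW lt)).
have := muM n (leqnn _).
have := mulr_ge0 (sqr_ge0 c) (ip_ge0 p); nra.
Qed.

Lemma spectral_ge n f M : (forall g, (size g <= n)%N -> ip f g = 0) ->
  (forall k, (n <= k)%N -> M <= mu k) -> M * ip f f <= ip f (T f).
Proof.
move=> fo muM; have [m lem] : exists m, (size f <= m)%N by exists (size f).
elim: m f lem fo => [|m IHm] f sf fo.
  move: sf; rewrite leqn0 size_poly_eq0 => /eqP ->.
  by rewrite (ipC 0) !ip0r mulr0.
have [lt|le] := ltnP m n.
  by rewrite (ip_eq0 (fo f (leq_trans sf lt))) (ipC 0) !ip0r mulr0.
have [c [p [f1 [fE sf1 po -> ->]]]] := spectral_step sf.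
have f1o g : (size g <= n)%N -> ip f1 g = 0.
  move=> sg; have := fo g sg; rewrite fE ipDl ipZl po ?mulr0 ?add0r //.
  exact: leq_trans sg le.
have := IHm _ sf1 f1o; have := muM m le.
have := mulr_ge0 (sqr_ge0 c) (ip_ge0 p); nra.
Qed.

End Spectral.
End WeightedInnerProduct.

(** * Jacobi weights and their Sturm-Liouville operator *)

Section JacobiWeight.
Variable R : rcfType.
Implicit Types f g : {poly R}.

(* Sealed, so that rewriting with [hornerM] leaves weights alone. *)
Definition jweight (al be : nat) : {poly R} :=
  locked ((1 - 'X) ^+ al * (1 + 'X) ^+ be).

Lemma jweightE al be : jweight al be = (1 - 'X) ^+ al * (1 + 'X) ^+ be.
Proof. by rewrite /jweight -lock. Qed.

Lemma horner_jweight al be x :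
  (jweight al be).[x] = (1 - x) ^+ al * (1 + x) ^+ be.
Proof. by rewrite jweightE !hornerE. Qed.

Lemma jweight_neq0 al be : jweight al be != 0.
Proof.
have := horner_jweight al be 0; rewrite subr0 addr0 !expr1n mulr1.
by apply: contra_eq_neq => ->; rewrite horner0 eq_sym oner_neq0.
Qed.

Lemma jweight_ge0 al be x : -1 <= x -> x <= 1 -> 0 <= (jweight al be).[x].
Proof.
move=> x0 x1; rewrite horner_jweight mulr_ge0 // exprn_ge0; lra.
Qed.

Lemma jweight_dual al be : (al <= 1)%N -> (be <= 1)%N ->
  jweight al be * jweight (1 - al) (1 - be) = 1 - 'X^2.
Proof.
rewrite !jweightE; case: al => [|[]] //; case: be => [|[]] //= _ _;
  rewrite ?expr0 ?expr1 ?mul1r ?mulr1; ring.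
Qed.

(* The Jacobi Sturm-Liouville operator, in the form that exhibits the duality
   between the weights [jweight al be] and [jweight (1 - al) (1 - be)]. *)
Definition jacobi_op al be f : {poly R} :=
  - (jweight (1 - al) (1 - be) * (jweight al be * f)^`())^`().

Lemma jacobi_op_linear al be : linear (jacobi_op al be).
Proof.
move=> c f g; rewrite /jacobi_op mulrDr -scalerAr derivD derivZ mulrDr -scalerAr.
by rewrite derivD derivZ opprD scalerN.
Qed.

(** Integration by parts; the boundary terms carry the factor [w * ws = 1 - 'X^2], which is zero at
    both ends. *)
Lemma ip_jacobi_op al be f g : (al <= 1)%N -> (be <= 1)%N ->
  ip (jweight al be) f (jacobi_op al be g) =
  ip (jweight (1 - al) (1 - be)) (jweight al be * f)^`() (jweight al be * g)^`().
Proof.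
move=> hal hbe; have := jweight_dual hal hbe; rewrite /ip /jacobi_op.
move: (jweight al be) (jweight (1 - al) (1 - be)) => w ws wws.
set D := (w * g)^`(); clearbody D.
have -> : w * (f * - (ws * D)^`()) = - ((ws * D)^`() * (w * f)) by ring.
rewrite linearN /= pint_by_parts.
have b0 (x : R) : x ^+ 2 = 1 -> (ws * D).[x] * (w * f).[x] = 0.
  move=> x1; rewrite -hornerM (_ : ws * D * (w * f) = (w * ws) * (D * f)); last by ring.
  by rewrite wws hornerM (_ : (1 - 'X^2).[x] = 0) ?mul0r //
    hornerD hornerN hornerXn hornerC x1 subrr.
rewrite !b0 ?sqrrN ?expr1n // subrr sub0r opprK; congr (pint _ _ _); ring.
Qed.

Lemma jacobi_op_sym al be f g : (al <= 1)%N -> (be <= 1)%N ->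
  ip (jweight al be) f (jacobi_op al be g) =
  ip (jweight al be) (jacobi_op al be f) g.
Proof.
by move=> hal hbe; rewrite [RHS]ipC !ip_jacobi_op // ipC.
Qed.

Lemma jacobi_op_coef al be n f : (al <= 1)%N -> (be <= 1)%N ->
  (size f <= n.+1)%N ->
  (jacobi_op al be f)`_n = (n.+1 * (n + (al + be)))%:R * f`_n.
Proof.
move=> hal hbe sf.
have f0 k : (n < k)%N -> f`_k = 0 by move=> lt; rewrite nth_default // (leq_trans sf).
rewrite /jacobi_op !jweightE coefN coef_deriv.
have e1 (g : {poly R}) : (1 - 'X) * g = g - 'X * g by ring.
have e2 (g : {poly R}) : (1 + 'X) * g = g + 'X * g by ring.
have cX (g : {poly R}) k : ('X * g)`_k.+1 = g`_k by rewrite coefXM.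
have cXd : ('X * f^`())`_n = f`_n *+ n.
  by rewrite coefXM; case: (n) => [|m] //=; rewrite coef_deriv.
case: al be hal hbe => [|[]] // [|[]] //= _ _;
  rewrite ?expr0 ?expr1 ?mul1r ?mulr1 -?mulrA ?e1 ?e2.
all: rewrite !(coefD, coefN, cX, coef_deriv) ?cXd.
all: rewrite ?(f0 n.+1) ?(f0 n.+2) //; ring.
Qed.
End JacobiWeight.

Section JacobiGap.
Variable R : rcfType.
Implicit Types f g : {poly R}.

(** The inverse inequality: as [al + be <= 2], the eigenvalues [k.+1 * (k + (al + be))] with [k < N]
    are at most [N * N.+1]. *)
Lemma jacobi_energy_le al be N f : (al <= 1)%N -> (be <= 1)%N ->
  (size f <= N)%N ->
  ip (jweight R (1 - al) (1 - be)) (jweight R al be * f)^`()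
    (jweight R al be * f)^`() <= (N * N.+1)%:R * ip (jweight R al be) f f.
Proof.
move=> hal hbe sf; rewrite -ip_jacobi_op //.
apply: (spectral_le (jweight_neq0 R al be) (@jweight_ge0 R al be)
  (@jacobi_op_linear R al be) _ _ sf).
- by move=> g h; rewrite jacobi_op_sym.
- by move=> n g; apply: jacobi_op_coef.
- by move=> k ltk; rewrite ler_nat; nia.
Qed.

(** For [k >= N] the same eigenvalues are at least [N ^ 2]; this is where the gain of [1 / N] comes
    from. *)
Lemma jacobi_energy_ge al be N f : (al <= 1)%N -> (be <= 1)%N ->
  (forall g, (size g <= N)%N -> ip (jweight R al be) f g = 0) ->
  (N ^ 2)%:R * ip (jweight R al be) f f <=
  ip (jweight R (1 - al) (1 - be)) (jweight R al be * f)^`()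
    (jweight R al be * f)^`().
Proof.
move=> hal hbe fo; rewrite -ip_jacobi_op //.
apply: (spectral_ge (jweight_neq0 R al be) (@jweight_ge0 R al be)
  (@jacobi_op_linear R al be) _ _ fo).
- by move=> g h; rewrite jacobi_op_sym.
- by move=> n g; apply: jacobi_op_coef.
- by move=> k lek; rewrite ler_nat; nia.
Qed.

Lemma jweight00 : jweight R 0 0 = 1.
Proof. by rewrite jweightE !expr0 mulr1. Qed.

Lemma jweight11 : jweight R 1 1 = 1 - 'X^2.
Proof. rewrite jweightE !expr1; ring. Qed.

End JacobiGap.

(** * Legendre polynomials *)

Section Legendre.
Variable R : realType.
Implicit Types (f g h : {poly R}) (a x t : R).

(** Applied to Rodrigues' formula, [k < N] kills the boundary terms at [1] and [-1], and [k = N]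
    gives the value of the Legendre polynomial at [1]. *)
Lemma derivn_XsubC_exp a N h k : (k <= N)%N ->
  exists2 h' : {poly R}, (('X - a%:P) ^+ N * h)^`(k) = ('X - a%:P) ^+ (N - k) * h' &
    h'.[a] = (N ^_ k)%:R * h.[a].
Proof.
elim: k => [|k IHk] lek; first by exists h; rewrite ?subn0 // mul1r.
have [h' E E'] := IHk (ltnW lek).
have [m Em] : exists m, (N - k = m.+1)%N by exists (N - k).-1; lia.
exists (h' *+ m.+1 + ('X - a%:P) * h'^`()).
  rewrite derivnS E Em (_ : N - k.+1 = m)%N; last by lia.
  rewrite derivM deriv_exp derivXsubC mul1r /= exprS; ring.
rewrite hornerD hornerM hornerMn !hornerE subrr mul0r addr0 E' ffactnSr Em natrM.
by rewrite -mulr_natr; ring.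
Qed.

Lemma derivn_comp_opp f k :
  (f \Po - 'X)^`(k) = (-1) ^+ k *: (f^`(k) \Po - 'X).
Proof.
elim: k => [|k IHk]; first by rewrite expr0 scale1r.
rewrite !derivnS IHk derivZ deriv_comp derivN derivX mulrN1 exprS scalerN.
by rewrite mulN1r scaleNr.
Qed.

Variable N : nat.
Local Notation P := (legendre R N).
Local Notation lam := ((N * N.+1)%:R : R).
Let rodr := ('X^2 - 1 : {poly R}) ^+ N.

Let rodrE a b : a = - b -> a ^+ 2 = 1 -> rodr = ('X - a%:P) ^+ N * ('X - b%:P) ^+ N.
Proof.
move=> ->; rewrite sqrrN => b2; rewrite /rodr -exprMn; congr (_ ^+ _).
have <- : (b%:P) ^+ 2 = 1 :> {poly R} by rewrite -rmorphXn b2.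
rewrite polyCN; ring.
Qed.

Let rodr_root a k : a ^+ 2 = 1 -> (k < N)%N -> rodr^`(k).[a] = 0.
Proof.
move=> a1 lt; rewrite (@rodrE a (- a)) ?opprK //.
have [h -> _] := derivn_XsubC_exp a (('X - (- a)%:P) ^+ N) (ltnW lt).
rewrite hornerM horner_exp !hornerE subrr expr0n subn_eq0 leqNgt lt.
by rewrite mul0r.
Qed.

Let rodr_orth k g : (k <= N)%N -> (size g <= k)%N ->
  pint (-1) 1 (rodr^`(k) * g) = 0.
Proof.
elim: k g => [|k IHk] g lek sg.
  by move: sg; rewrite leqn0 size_poly_eq0 => /eqP ->; rewrite mulr0 pint0.
rewrite derivnS pint_by_parts !rodr_root ?sqrrN ?expr1n // !mul0r subrr sub0r.
by rewrite IHk ?oppr0 ?(ltnW lek) // size_deriv -subn1 leq_subLR.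
Qed.

Lemma legendre_orth g : (size g <= N)%N -> pint (-1) 1 (P * g) = 0.
Proof. by move=> sg; rewrite /legendre -scalerAl pintZ rodr_orth ?mulr0. Qed.

Lemma size_legendre : (size P <= N.+1)%N.
Proof.
rewrite (leq_trans (size_scale_leq _ _)) // cauchyreals.size_derivn.
rewrite -[1]/(1%:P) (leq_trans (leq_sub2r _ (size_exp_leq _ _))) //.
rewrite size_XnsubC // /=; lia.
Qed.

Lemma legendre_comp_opp : P \Po - 'X = (-1) ^+ N *: P.
Proof.
have e : rodr = rodr \Po - 'X.
  rewrite /rodr rmorphXn /= rmorphB /= rmorphXn /= comp_polyX sqrrN.
  by rewrite rmorph1.
rewrite /legendre -/rodr [in RHS]e derivn_comp_opp comp_polyZ !scalerA.
by rewrite mulrAC -exprD addnn -mul2n exprM sqrrN !expr1n mul1r.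
Qed.

Lemma legendreN x : P.[- x] = (-1) ^+ N * P.[x].
Proof.
by rewrite -[in RHS]hornerZ -legendre_comp_opp horner_comp !hornerE.
Qed.

Lemma legendre1 : P.[1] = 1.
Proof.
rewrite /legendre -/rodr (@rodrE 1 (-1)) ?opprK ?expr1n //.
have [h -> H] := derivn_XsubC_exp 1 (('X - (-1)%:P) ^+ N) (leqnn N).
rewrite subnn expr0 mul1r hornerZ H horner_exp hornerXsubC ffactnn opprK.
rewrite [_ * (1 + 1) ^+ N]mulrC mulVf // mulf_neq0 ?expf_neq0 ?pnatr_eq0 //.
Qed.

(** Orthogonality to lower degrees makes the Legendre polynomial an eigenvector of the Jacobi
    operator for the weight [1]. *)
Lemma legendre_ode : ((1 - 'X^2) * P^`())^`() = - lam *: P.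
Proof.
have : jacobi_op 0 0 P = (N.+1 * (N + (0 + 0)))%:R *: P.
  apply: (eigen_orthogonal (jweight_neq0 R 0 0) (@jweight_ge0 R 0 0)
    (T := jacobi_op 0 0) (mu := fun n => (n.+1 * (n + (0 + 0)))%:R)) => //.
  - by move=> f g; rewrite jacobi_op_sym.
  - by move=> n f; apply: jacobi_op_coef.
  - exact: size_legendre.
  - by move=> f sf; rewrite /ip jweight00 mul1r legendre_orth.
rewrite /jacobi_op jweight00 subn0 jweight11 mul1r !addn0 mulnC scaleNr => <-.
by rewrite opprK.
Qed.

End Legendre.

(* Sealed, so that rewriting with [hornerZ] or [derivZ] does not expose
   Rodrigues' formula. *)
Definition leg (R : realType) (N : nat) : {poly R} := locked (legendre R N).

Section LegendreEstimates.
Variables (R : realType) (N : nat).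
Implicit Types (f g h : {poly R}) (a x t : R).
Local Notation P := (leg R N).
Local Notation lam := ((N * N.+1)%:R : R).

Lemma legE : P = legendre R N.
Proof. by rewrite /leg -lock. Qed.

Lemma leg_orth g : (size g <= N)%N -> pint (-1) 1 (P * g) = 0.
Proof. by rewrite legE; apply: legendre_orth. Qed.

Lemma size_leg : (size P <= N.+1)%N.
Proof. by rewrite legE; apply: size_legendre. Qed.

Lemma legN x : P.[- x] = (-1) ^+ N * P.[x].
Proof. by rewrite legE legendreN. Qed.

Lemma deriv_legN x : P^`().[- x] = - ((-1) ^+ N * P^`().[x]).
Proof.
have := legendre_comp_opp R N; rewrite -legE => /(congr1 (fun q => q^`().[x])).
rewrite /= deriv_comp derivZ derivN derivX mulrN1 hornerN horner_comp.
by rewrite hornerN hornerX hornerZ => <-; rewrite opprK.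
Qed.

Lemma leg1 : P.[1] = 1.
Proof. by rewrite legE legendre1. Qed.

Lemma leg_ode : ((1 - 'X^2) * P^`())^`() = - lam *: P.
Proof. by rewrite legE legendre_ode. Qed.

Lemma legN1_sqr : P.[-1] ^+ 2 = 1.
Proof. by rewrite legN leg1 mulr1 -exprM mulnC exprM sqrrN !expr1n. Qed.

Lemma leg_odeE x : (1 - x ^+ 2) * (P^`()^`()).[x] = 2 * x * P^`().[x] - lam * P.[x].
Proof.
have /(congr1 (horner^~ x)) := leg_ode.
rewrite derivM derivB derivXn -[1]/(1%:P) derivC !hornerE /= => H.
lra.
Qed.

(** ['X * P' - N P] has degree below [N], hence is orthogonal to [P]; the identity then comes from
    integrating the derivative of ['X * P ^+ 2]. *)
Lemma pint_leg_sqr : (2 * N + 1)%:R * pint (-1) 1 (P ^+ 2) = 2.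
Proof.
have : pint (-1) 1 (P * ('X * P^`() - N%:R *: P)) = 0.
  apply: leg_orth; apply/leq_sizeP => j.
  have cX : ('X * P^`())`_j = P`_j *+ j.
    by rewrite coefXM; case: (j) => [|m] //=; rewrite coef_deriv.
  rewrite leq_eqVlt coefB coefZ cX => /predU1P[<-|lt].
    by rewrite -(mulr_natl P`_N) subrr.
  by rewrite nth_default ?mul0rn ?mulr0 ?subrr // (leq_trans size_leg).
have := pint_deriv (-1) 1 ('X * P ^+ 2).
rewrite !(hornerM 'X) !horner_exp !hornerX legN1_sqr leg1.
have -> : ('X * P ^+ 2)^`() =
    (2 * N + 1)%:R *: P ^+ 2 + 2%:R *: (P * ('X * P^`() - N%:R *: P)).
  rewrite !derivM derivX -!mul_polyC !rmorph_nat; ring.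
rewrite pintD !pintZ => A B; rewrite B mulr0 addr0 in A; rewrite A; ring.
Qed.

Lemma pint_deriv_leg_sqr :
  pint (-1) 1 ((1 - 'X^2) * P^`() ^+ 2) = lam * pint (-1) 1 (P ^+ 2).
Proof.
have := pint_by_parts (-1) 1 P ((1 - 'X^2) * P^`()).
have D0 (x : R) : x ^+ 2 = 1 -> ((1 - 'X^2) * P^`()).[x] = 0.
  by move=> x2; rewrite hornerM hornerD hornerC hornerN hornerXn x2 subrr mul0r.
rewrite leg_ode !D0 ?sqrrN ?expr1n // !mulr0 subrr -scalerAr pintZ -expr2.
have -> : P^`() * ((1 - 'X^2) * P^`()) = (1 - 'X^2) * P^`() ^+ 2 by ring.
by rewrite sub0r mulNr opprK.
Qed.

Let energy := lam *: P ^+ 2 + (1 - 'X^2) * P^`() ^+ 2.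

Let deriv_energy x : energy^`().[x] = 2 * x * P^`().[x] ^+ 2.
Proof.
have -> : energy^`() = lam *: (2 *: (P * P^`())) - 2 *: ('X * P^`() ^+ 2) +
    (1 - 'X^2) * (2 *: (P^`() * P^`()^`())).
  rewrite /energy derivD derivZ ![in LHS](derivM, derivB) derivX.
  rewrite -{1}polyC1 derivC -!mul_polyC !rmorph_nat; ring.
have := leg_odeE x; move=> H; rewrite !polyE.
have := congr1 ( *%R (2 * P^`().[x])) H; lra.
Qed.

(** By Legendre's equation the derivative of this energy is [2 x P'(x)^2], which is nonnegative for
    [x >= 0]; parity does the rest. *)
Lemma leg_energy_le (x y : R) : `|x| <= `|y| -> `|y| <= 1 ->
  lam * P.[x] ^+ 2 + (1 - x ^+ 2) * P^`().[x] ^+ 2 <=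
  lam * P.[y] ^+ 2 + (1 - y ^+ 2) * P^`().[y] ^+ 2.
Proof.
have eE z : lam * P.[z] ^+ 2 + (1 - z ^+ 2) * P^`().[z] ^+ 2 = energy.[z].
  by rewrite /energy; rewrite !polyE.
have eN z : energy.[- z] = energy.[z].
  rewrite -!eE sqrrN legN deriv_legN sqrrN.
  by rewrite !exprMn !sqrr_sign !mul1r.
have eA z : energy.[z] = energy.[`|z|] by case: (ger0P z); rewrite ?eN.
move=> xy y1; rewrite !eE (eA x) (eA y).
apply: (@ler_hornerW _ 0 1); rewrite ?in_itv /= ?normr_ge0 //; last lra.
move=> z; rewrite in_itv /= => /andP[z0 _].
by rewrite deriv_energy mulr_ge0 ?sqr_ge0 // mulr_ge0 // ltW.
Qed.

End LegendreEstimates.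

Section LegendreBounds.
Variables (R : realType).
Implicit Types (f g h p : {poly R}) (a x t : R) (N : nat).
Local Notation lam N := ((N * N.+1)%:R : R).

Lemma leg_sqr_le1 N x : -1 <= x -> x <= 1 -> (leg R N).[x] ^+ 2 <= 1.
Proof.
move=> x0 x1; case: N => [|N].
  have /size1_polyC e := size_leg R 0.
  have := leg1 R 0; rewrite e !hornerC => ->; lra.
have : `|x| <= `|1 : R| by rewrite normr1 ler_norml x0 x1.
move=> /(@leg_energy_le R N.+1); rewrite normr1 lexx leg1 => /(_ isT) H.
have l0 : 0 < lam N.+1 by rewrite ltr0n.
rewrite -(ler_pM2l l0); apply: le_trans (_ : _ <= lam N.+1 * (leg R N.+1).[x] ^+ 2 +
   (1 - x ^+ 2) * (leg R N.+1)^`().[x] ^+ 2) _; last lra.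
rewrite lerDl mulr_ge0 ?sqr_ge0 //; nra.
Qed.

Lemma leg_norm_le1 N x : -1 <= x -> x <= 1 -> `|(leg R N).[x]| <= 1.
Proof.
by move=> x0 x1; rewrite -(expr_le1 (n := 2)) // real_normK ?num_real // leg_sqr_le1.
Qed.

Lemma deriv_leg_pint N x :
  (1 - x ^+ 2) * (leg R N)^`().[x] = lam N * pint x 1 (leg R N).
Proof.
have := pint_deriv x 1 ((1 - 'X^2) * (leg R N)^`()).
rewrite leg_ode pintZ !polyE expr1n subrr mul0r sub0r; lra.
Qed.

Lemma deriv_leg_bound N x : -1 <= x -> x <= 1 ->
  `|(1 - x ^+ 2) * (leg R N)^`().[x]| <= lam N * (1 - x).
Proof.
move=> x0 x1; rewrite deriv_leg_pint normrM (ger0_norm (ler0n _ _)) ler_wpM2l //.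
rewrite -[1 - x]mul1r; apply: ler_norm_pint => // t xt t1.
by apply: leg_norm_le1 => //; lra.
Qed.

(** At the mean value point [c] in []a, 1[], the bound on [(1 - c^2) P'(c)] can be divided by
    [1 - c], and [1 + a <= 1 + c]. *)
Lemma leg_near1 N a : -1 < a -> a <= 1 ->
  `|1 - (leg R N).[a]| * (1 + a) <= lam N * (1 - a).
Proof.
move=> a0; rewrite le_eqVlt => /predU1P[->|a1].
  by rewrite leg1 subrr normr0 mul0r mulr0.
have [c] := poly_mvt (leg R N) a1; rewrite leg1 in_itv /= => /andP[ac c1] ->.
have := @deriv_leg_bound N c _ _.
have -> : (1 - c ^+ 2) * (leg R N)^`().[c] = (1 - c) * ((1 + c) * (leg R N)^`().[c]) by ring.
rewrite !normrM (gtr0_norm (_ : 0 < 1 - c)); last lra.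
rewrite (gtr0_norm (_ : 0 < 1 + c)); last lra.
rewrite (gtr0_norm (_ : 0 < 1 - a)); last lra.
rewrite [lam N * _]mulrC ler_pM2l; last lra.
move=> H; have {}H : (1 + c) * `|(leg R N)^`().[c]| <= lam N by apply: H; lra.
have : (1 + a) * `|(leg R N)^`().[c]| <= lam N.
  by apply: le_trans H; rewrite ler_wpM2r //; lra.
move: `|_| => d Hd; have : (1 - a) * ((1 + a) * d) <= (1 - a) * lam N.
  by rewrite ler_pM2l //; lra.
lra.
Qed.

Lemma leg_ge_half N x : 0 <= x -> x <= 1 -> 2 * lam N * (1 - x) <= 1 ->
  1 / 2 <= (leg R N).[x].
Proof.
move=> x0 x1 lx; have := @leg_near1 N x _ x1 => H.
have {}H : `|1 - (leg R N).[x]| * (1 + x) <= lam N * (1 - x) by apply: H; lra.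
have : `|1 - (leg R N).[x]| <= 1 / 2.
  have := normr_ge0 (1 - (leg R N).[x]); nra.
by rewrite ler_norml => /andP[]; lra.
Qed.

(** Near [1] the polynomial exceeds [1 / 2], and by the integrated Legendre equation [P'(x)] has the
    sign of the integral of [P] over [[x, 1]]. This keeps the critical points at distance more than
    [1 / (2 lam)] from the endpoints. *)
Lemma deriv_leg_gt0 N x : (0 < N)%N -> 0 <= x -> x < 1 ->
  2 * lam N * (1 - x) <= 1 -> 0 < (leg R N)^`().[x].
Proof.
move=> N0 x0 x1 lx.
have l0 : 0 < lam N by rewrite ltr0n muln_gt0 N0.
have : pint x 1 (1 / 2)%:P <= pint x 1 (leg R N).
  apply: ler_pint => [|t xt t1]; first exact: ltW.
  rewrite hornerC leg_ge_half //; first lra.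
  apply: le_trans lx; rewrite ler_wpM2l //; lra.
rewrite pint_const => H.
have : 0 < (1 - x ^+ 2) * (leg R N)^`().[x].
  rewrite deriv_leg_pint mulr_gt0 //; lra.
rewrite pmulr_rgt0 //; nra.
Qed.

Lemma leg_lead_neq0 N : (leg R N)`_N != 0.
Proof.
apply/eqP => c0; have sP : (size (leg R N) <= N)%N.
  apply/leq_sizeP => j; rewrite leq_eqVlt => /predU1P[<-//|lt].
  by rewrite nth_default // (leq_trans (size_leg R N)).
by have := pint_leg_sqr R N; rewrite expr2 leg_orth // mulr0; lra.
Qed.

Lemma add_sqr_le (x y A B U V : R) : 0 <= A -> 0 <= B -> 0 <= U -> 0 <= V ->
  x ^+ 2 <= A * U -> y ^+ 2 <= B * V -> (x + y) ^+ 2 <= (A + B) * (U + V).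
Proof.
move=> A0 B0 U0 V0 hx hy.
suff : 2 * (x * y) <= A * V + B * U by lra.
have AV := mulr_ge0 A0 V0; have BU := mulr_ge0 B0 U0.
rewrite (le_trans (ler_norm _)) // -(ler_pXn2r (n := 2)) ?nnegrE ?addr_ge0 //.
rewrite real_normK ?num_real //.
have h : (x * y) ^+ 2 <= (A * U) * (B * V).
  by rewrite exprMn ler_pM ?sqr_ge0.
have := sqr_ge0 (A * V - B * U); lra.
Qed.

(* Expansion in Legendre polynomials and Cauchy-Schwarz; the factor is
   [\sum_(n <= m) n (n + 1) (2 n + 1) / 2]. *)
Lemma endpoint_trace m p a : -1 < a -> a < 1 -> (size p <= m.+1)%N ->
  4 * (p.[1] - p.[a]) ^+ 2 <=
  (m * m.+1 ^ 2 * m.+2)%:R * ((1 - a) / (1 + a)) ^+ 2 *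
    pint (-1) 1 ((1 - 'X^2) * p^`() ^+ 2).
Proof.
move=> a0 a1; set c := (1 - a) / (1 + a).
have E0 (q : {poly R}) : 0 <= pint (-1) 1 ((1 - 'X^2) * q ^+ 2).
  apply: pint_ge0 => [|x x0 x1]; first lra.
  rewrite !polyE mulr_ge0 ?sqr_ge0 //; nra.
elim: m p => [|m IHm] p sp.
  by rewrite (size1_polyC sp) !hornerC subrr expr0n mulr0 !mul0n !mul0r.
set P := leg R m.+1.
pose al := p`_m.+1 / P`_m.+1; pose q := p - al *: P.
have sq : (size q <= m.+1)%N.
  apply/leq_sizeP => j; rewrite leq_eqVlt coefB coefZ => /predU1P[<-|lt].
    by rewrite divfK ?leg_lead_neq0 // subrr.
  by rewrite (nth_default 0 (leq_trans sp lt))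
    (nth_default 0 (leq_trans (size_leg R m.+1) lt)) mulr0 subrr.
have pE : p = al *: P + q by rewrite addrC subrK.
clearbody al q.
have orth : pint (-1) 1 ((1 - 'X^2) * (P^`() * q^`())) = 0.
  have := pint_by_parts (-1) 1 ((1 - 'X^2) * P^`()) q.
  rewrite leg_ode -scalerAl pintZ leg_orth // mulr0 !polyE sqrrN !expr1n !subrr.
  by rewrite !mul0r subrr sub0r mulrA => /esym/eqP; rewrite oppr_eq0 => /eqP.
have -> : pint (-1) 1 ((1 - 'X^2) * p^`() ^+ 2) = 
   al ^+ 2 * (lam m.+1 * pint (-1) 1 (P ^+ 2)) + pint (-1) 1 ((1 - 'X^2) * q^`() ^+ 2).
  have -> : (1 - 'X^2) * p^`() ^+ 2 = (al ^+ 2) *: ((1 - 'X^2) * P^`() ^+ 2)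
     + (2 * al) *: ((1 - 'X^2) * (P^`() * q^`())) + (1 - 'X^2) * q^`() ^+ 2.
    rewrite pE derivD derivZ -!mul_polyC !rmorphM /= rmorph_nat ?rmorphXn /=; ring.
  by rewrite !pintD !pintZ orth pint_deriv_leg_sqr mulr0 addr0.
rewrite -/P; have := pint_leg_sqr R m.+1; rewrite -/P => G.
have -> : p.[1] - p.[a] = al * (P.[1] - P.[a]) + (q.[1] - q.[a]).
  by rewrite pE !polyE; ring.
have := IHm q sq; move: (q.[1] - q.[a]) (pint _ _ (_ * q^`() ^+ 2)) (E0 q^`()).
move=> y V V0 hy.
have hP : (P.[1] - P.[a]) ^+ 2 <= (lam m.+1 * c) ^+ 2.
  rewrite /P leg1 -real_normK ?num_real // ler_pXn2r ?nnegrE //.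
    rewrite mulrA ler_pdivlMr; last lra.
    by apply: leg_near1 => //; lra.
  by rewrite mulr_ge0 // divr_ge0; lra.
have n21 : (0 : R) < (2 * m.+1 + 1)%:R by rewrite ltr0n addn1.
(* The factor grows by [2 n (n + 1) (2 n + 1)] with [n = m + 1], which is four times the term of the
   sum. *)
have -> : (m.+1 * m.+2 ^ 2 * m.+3)%:R =
   4 * ((lam m.+1) * (2 * m.+1 + 1)%:R / 2 + (m * m.+1 ^ 2 * m.+2)%:R / 4) :> R.
  by field.
set G1 := pint _ _ _ in G *.
have G1E : G1 = 2 / (2 * m.+1 + 1)%:R.
  by rewrite -G mulrC mulKf // gt_eqF.
set A := lam m.+1 * (2 * m.+1 + 1)%:R / 2; set B : R := (m * m.+1 ^ 2 * m.+2)%:R / 4.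
rewrite (_ : 4 * (A + B) * c ^+ 2 * _ = 4 * ((A * c ^+ 2 + B * c ^+ 2) *
  (al ^+ 2 * (lam m.+1 * G1) + V))); last by ring.
rewrite ler_pM2l; last lra.
have G10 : 0 <= G1 by rewrite G1E divr_ge0.
apply: add_sqr_le => //.
- by rewrite mulr_ge0 ?sqr_ge0 // divr_ge0 // mulr_ge0.
- by rewrite mulr_ge0 ?sqr_ge0 // divr_ge0.
- by rewrite mulr_ge0 ?sqr_ge0 // mulr_ge0.
- rewrite exprMn (_ : _ * c ^+ 2 * _ = al ^+ 2 * (lam m.+1 * c) ^+ 2).
    by rewrite ler_wpM2l ?sqr_ge0.
  by rewrite G1E /A; field; rewrite gt_eqF.
- by rewrite /B mulrAC -(mulrA _ _ (c ^+ 2)); lra.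
Qed.
End LegendreBounds.

(** * Gauss-Lobatto nodes and quadrature *)

Section CriticalPoints.
Variables (R : realType) (N : nat).
Implicit Types (f g h p : {poly R}) (a x t : R).
Local Notation P := (leg R N).
Local Notation lam := ((N * N.+1)%:R : R).

Lemma deriv_leg_neq0 : (0 < N)%N -> P^`() != 0.
Proof.
move=> N0; apply/eqP => d0; have := leg_ode R N.
rewrite d0 mulr0 deriv0 => /(congr1 (horner^~ 1)).
rewrite !polyE leg1 mulr1 => /esym/eqP; rewrite oppr_eq0 pnatr_eq0; lia.
Qed.

(** A common zero of [P] and [P'] forces [P = 0]: by parity [x >= 0], the function [M] has
    derivative [- 2 lam t P(t)^2], and on [[x, 1]] it is nonnegative, starts at [0] and does not
    increase. *)
Lemma leg_neq0_crit x : (0 < N)%N -> -1 < x -> x < 1 -> P^`().[x] = 0 -> P.[x] != 0.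
Proof.
move=> N0; have l0 : 0 < lam by rewrite ltr0n muln_gt0 N0.
wlog x0 : x / 0 <= x => [wl|] xl xu dx.
  have [/wl->//|xn] := leP 0 x.
  have := wl (- x) _ _ _ _; rewrite legN deriv_legN dx mulr0 oppr0 mulf_eq0.
  by rewrite signr_eq0; apply; lra.
apply/eqP => Px.
pose M := lam *: ((1 - 'X^2) * P ^+ 2) + ((1 - 'X^2) * P^`()) ^+ 2.
have dM t : M^`().[t] = - (2 * lam * t * P.[t] ^+ 2).
  have -> : M^`() = - (2 * lam) *: ('X * P ^+ 2).
    rewrite /M derivD derivZ [(_ ^+ 2)^`()]deriv_exp /= leg_ode !derivM derivB.
    rewrite -polyC1 derivC derivXn /= -!mul_polyC !rmorphN !rmorphM /= !rmorph_nat.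
    rewrite expr1 polyC1; ring.
  by rewrite !polyE; ring.
have : P = 0.
  apply: (@poly_eq0_on _ _ x 1) => // t xt t1; apply/eqP; rewrite -sqrf_eq0.
  have Mx : M.[x] = 0 by rewrite /M !polyE Px dx; ring.
  have : (- M).[x] <= (- M).[t].
    apply: (@ler_hornerW _ x 1); rewrite ?in_itv /= ?lexx ?(ltW xt) ?(ltW t1) ?(ltW xu) //.
    move=> s; rewrite in_itv /= => /andP[xs _].
    rewrite derivN hornerN dM opprK mulr_ge0 ?sqr_ge0 // !mulr_ge0 //; lra.
  rewrite !hornerN Mx oppr0 oppr_ge0 /M !polyE => H.
  have h1 : 0 <= ((1 - t ^+ 2) * P^`().[t]) ^+ 2 by apply: sqr_ge0.
  have h2 : 0 <= P.[t] ^+ 2 by apply: sqr_ge0.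
  have lt0 : 0 < lam * (1 - t ^+ 2) by rewrite mulr_gt0 //; nra.
  rewrite eq_le h2 andbT -(ler_pM2l lt0) mulr0; lra.
by move=> P0; have := leg1 R N; rewrite P0 horner0; lra.
Qed.

Lemma simple_crit x : (0 < N)%N -> -1 < x -> x < 1 -> P^`().[x] = 0 ->
  P^`()^`().[x] != 0.
Proof.
move=> N0 xl xu dx; apply/eqP => ddx; have := leg_odeE N x.
rewrite dx ddx !mulr0 sub0r => /esym/eqP; rewrite oppr_eq0 mulf_eq0 pnatr_eq0.
by rewrite (negPf (leg_neq0_crit N0 xl xu dx)) orbF; lia.
Qed.

Let s := roots P^`() (-1) 1.

(** The critical points are simple, so the cofactor [q] of their product [r] in [P'] has constant
    sign on the open interval. If they were fewer than [N - 1], then [P'] would be orthogonal to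
    [(1 - 'X^2) * r], although the product [q (1 - 'X^2) r^2] does not change sign. *)
Let size_s : (0 < N)%N -> size s = N.-1.
Proof.
move=> N0; have dP0 := deriv_leg_neq0 N0.
have uniq_s : uniq s by exact: uniq_roots.
have all_s : all (root P^`()) s by apply/allP => x; exact: root_roots.
have sd : (size P^`() <= N)%N.
  by rewrite size_deriv -subn1 leq_subLR add1n size_leg.
apply/eqP; rewrite eqn_leq -ltnS prednK // (leq_trans (max_poly_roots dP0 all_s uniq_s)) //=.
rewrite leqNgt; apply/negP => lt_s.
have [q dPE] : exists q, P^`() = q * \prod_(x <- s) ('X - x%:P).
  by apply/dvdpP; apply: uniq_roots_dvdp => //; rewrite uniq_rootsE.
set r := \prod_(x <- s) _ in dPE.
have rs x : x \in s -> r.[x] = 0.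
  by move=> xs; apply/rootP; rewrite root_prod_XsubC.
have q0 : {in `](-1), 1[, forall x, ~~ root q x}.
  move=> x xi; apply/negP => /rootP qx.
  have dx : P^`().[x] = 0 by rewrite dPE hornerM qx mul0r.
  have xs : x \in s by rewrite -root_is_roots //; apply/rootP.
  move: xi; rewrite in_itv /= => /andP[xl xu].
  have := simple_crit N0 xl xu dx.
  by rewrite dPE derivM !polyE qx (rs _ xs) mulr0 mul0r addr0 eqxx.
have sr : size r = (size s).+1 by rewrite size_prod_XsubC.
have r0 : r != 0 by rewrite -size_poly_gt0 sr.
have q00 : q != 0 by apply: contra_neq dP0 => q0'; rewrite dPE q0' mul0r.
have orth : pint (-1) 1 (P^`() * ((1 - 'X^2) * r)) = 0.
  rewrite pint_by_parts !polyE sqrrN !expr1n subrr !mul0r !mulr0 subrr sub0r.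
  rewrite leg_orth ?oppr0 // size_deriv -subn1 leq_subLR.
  apply: leq_trans (size_polyMleq _ _) _; rewrite sr.
  rewrite (_ : size (1 - 'X^2 : {poly R}) = 3%N).
    rewrite addnS /= add3n; move: lt_s; lia.
  by rewrite -opprB size_polyN -polyC1 size_XnsubC.
have [sg sgE] : exists2 sg : R, sg != 0 & forall x, -1 < x -> x < 1 -> 0 <= sg * q.[x].
  exists (q.[0]).
    by have := q0 0; rewrite in_itv /=  => H; rewrite -rootE H //; apply/andP; split; lra.
  move=> x xl xu; have := polyrN0_itv q0.
  move=> /(_ x 0); rewrite !in_itv /= xl xu => /(_ isT) H.
  have {}H : Num.sg q.[x] = Num.sg q.[0] by apply/esym/H; apply/andP; split; lra.
  by rewrite -sgr_ge0 sgrM H -expr2 sqr_ge0.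
move=> sgq.
have z0 : sg *: (P^`() * ((1 - 'X^2) * r)) = 0.
  apply: (@pint_ge0_eq0 _ (-1) 1); first lra.
    move=> x; rewrite le_eqVlt => /predU1P[<- _|xl].
      by rewrite dPE !polyE sqrrN expr1n subrr !(mul0r, mulr0).
    rewrite le_eqVlt => /predU1P[->|xu].
      by rewrite dPE !polyE expr1n subrr !(mul0r, mulr0).
    rewrite dPE !polyE.
    have -> : sg * (q.[x] * r.[x] * ((1 - x ^+ 2) * r.[x])) =
      (sg * q.[x]) * ((1 - x ^+ 2) * r.[x] ^+ 2) by ring.
    rewrite mulr_ge0 ?sgq // mulr_ge0 ?sqr_ge0 //; nra.
  by rewrite pintZ orth mulr0.
move/eqP: z0; rewrite dPE -mul_polyC !mulf_eq0 polyC_eq0 (negPf sgE) (negPf q00) (negPf r0).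
by rewrite !orbF /= -jweight11 (negPf (jweight_neq0 _ _ _)).
Qed.

(** The right-hand list is sorted and made of roots; having [N + 1] entries, it exhausts what the
    degree allows. *)
Lemma gauss_lobattoE : (0 < N)%N -> gauss_lobatto R N = -1 :: rcons s 1.
Proof.
move=> N0; have dP0 := deriv_leg_neq0 N0.
rewrite /gauss_lobatto -legE.
have w0 : (1 - 'X^2 : {poly R}) != 0.
  by rewrite -jweight11 jweight_neq0.
have Om0 : (1 - 'X^2) * P^`() != 0 by rewrite mulf_neq0.
have sorted_l : sorted <%R (-1 :: rcons s 1).
  rewrite /= rcons_path path_roots /=.
  by apply: last_roots_le; lra.
apply: lt_sorted_eq => //; first exact: sorted_roots.
have sub x : x \in -1 :: rcons s 1 -> x \in rootsR ((1 - 'X^2) * P^`()).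
  rewrite -(roots_on_rootsR Om0 x) in_itv /= rootM inE mem_rcons inE.
  case/or3P => [/eqP->|/eqP->|xs]; rewrite ?(root_roots xs) ?orbT //;
    by rewrite [root _ _]rootE !polyE ?sqrrN expr1n subrr eqxx.
have ul : uniq (-1 :: rcons s 1) by exact: lt_sorted_uniq.
have H := uniq_min_size ul sub _.
have [//|_ E] := H _; last by move=> x; rewrite E.
rewrite /= size_rcons size_s // prednK //.
have all_r : all (root ((1 - 'X^2) * P^`())) (rootsR ((1 - 'X^2) * P^`())).
  by apply/allP => x; exact: root_roots.
have := max_poly_roots Om0 all_r (uniq_roots _ _ _).
rewrite size_mul // size_deriv -opprB size_polyN -polyC1 size_XnsubC //=.
by have := size_leg R N; move: (size (leg R N)) (size (rootsR _)) => m n; lia.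
Qed.

Lemma size_gauss_lobatto : (0 < N)%N -> size (gauss_lobatto R N) = N.+1.
Proof. by move=> N0; rewrite gauss_lobattoE //= size_rcons size_s // prednK. Qed.

End CriticalPoints.

Section Nodes.
Variables (R : realType) (N : nat).
Hypothesis N0 : (0 < N)%N.
Implicit Types (f g h p d : {poly R}) (y t : R) (i j : nat).
Local Notation P := (leg R N).
Local Notation lam := ((N * N.+1)%:R : R).
Local Notation x := (gl_point R N).

Lemma lam_gt0 : 0 < lam.
Proof. by rewrite ltr0n muln_gt0 N0. Qed.

Lemma gl_first : x 0 = -1.
Proof. by rewrite /gl_point gauss_lobattoE. Qed.

Lemma gl_last : x N = 1.
Proof.
rewrite /gl_point -[N in _`_N]/(N.+1.-1) -(size_gauss_lobatto R N0) nth_last.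
by rewrite gauss_lobattoE //= last_rcons.
Qed.

Lemma gl_lt i j : (i < j)%N -> (j <= N)%N -> x i < x j.
Proof.
move=> ij jN; rewrite /gl_point.
have srt : sorted <%R (gauss_lobatto R N) by exact: sorted_roots.
apply: (sorted_ltn_nth lt_trans) => //; rewrite ?inE ?size_gauss_lobatto //;
  lia.
Qed.

Lemma gl_le i j : (i <= j)%N -> (j <= N)%N -> x i <= x j.
Proof. by rewrite leq_eqVlt => /predU1P[->//|ij jN]; rewrite ltW // gl_lt. Qed.

Lemma gl_inj i j : (i <= N)%N -> (j <= N)%N -> x i = x j -> i = j.
Proof.
move=> iN jN E; case: (ltngtP i j) => // ij; [have := gl_lt ij jN|have := gl_lt ij iN];
  by rewrite E ltxx.
Qed.

Lemma gl_geN1 i : (i <= N)%N -> -1 <= x i.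
Proof. by move=> iN; rewrite -gl_first gl_le. Qed.

Lemma gl_le1 i : (i <= N)%N -> x i <= 1.
Proof. by move=> iN; rewrite -gl_last gl_le. Qed.

Lemma gl_gtN1 i : (0 < i)%N -> (i <= N)%N -> -1 < x i.
Proof. by move=> i0 iN; rewrite -gl_first gl_lt. Qed.

Lemma gl_lt1 i : (i < N)%N -> x i < 1.
Proof. by move=> iN; rewrite -gl_last gl_lt. Qed.

Definition gl_poly : {poly R} := (1 - 'X^2) * P^`().
Local Notation Om := gl_poly.

Lemma gl_poly_root i : (i <= N)%N -> Om.[x i] = 0.
Proof.
move=> iN; apply/rootP; rewrite /gl_poly legE.
apply: (@root_roots _ _ (- cauchy_bound ((1 - 'X^2) * (legendre R N)^`()))
  (cauchy_bound ((1 - 'X^2) * (legendre R N)^`()))).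
by apply: mem_nth; rewrite -/(gauss_lobatto R N) size_gauss_lobatto.
Qed.

Lemma gl_crit i : (0 < i)%N -> (i < N)%N -> P^`().[x i] = 0.
Proof.
move=> i0 iN; have := gl_poly_root (ltnW iN); rewrite /gl_poly !polyE => /eqP.
have h1 := gl_gtN1 i0 (ltnW iN); have h2 := gl_lt1 iN.
rewrite mulf_eq0 => /orP[/eqP H|/eqP//]; nra.
Qed.

Lemma gl_no_crit i y : (i < N)%N -> x i < y -> y < x i.+1 -> P^`().[y] != 0.
Proof.
move=> iN xy yx; apply/negP => /eqP dy.
have y1 : -1 < y by apply: le_lt_trans xy; rewrite gl_geN1 // ltnW.
have y2 : y < 1 by apply: lt_le_trans yx _; rewrite gl_le1.
have : y \in gauss_lobatto R N.
  rewrite gauss_lobattoE // inE mem_rcons inE root_in_roots ?orbT //.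
  - exact: deriv_leg_neq0.
  - by rewrite in_itv /= y1.
  - exact/rootP.
move=> /(nthP 0)[j]; rewrite size_gauss_lobatto // => jN; rewrite -/(x j) => E.
move: xy yx; rewrite -E; case: (leqP j i) => ji.
  by rewrite ltNge gl_le // ltnW.
by move=> _; rewrite ltNge gl_le.
Qed.

Lemma size_deriv_leg : size P^`() = N.
Proof.
rewrite size_deriv; suff -> : size P = N.+1 by [].
apply/eqP; rewrite eqn_leq size_leg ltnNge; apply/negP => sz.
by have := leg_lead_neq0 R N; rewrite nth_default ?eqxx.
Qed.

Lemma lead_coef_deriv_leg : lead_coef P^`() = N%:R * P`_N.
Proof. by rewrite lead_coefE size_deriv_leg coef_deriv prednK // mulr_natl. Qed.

Lemma gl_polyE : Om = - (('X^2 - 1) * P^`()).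
Proof. by rewrite /gl_poly -[RHS]mulNr opprB. Qed.

Lemma size_gl_poly : size Om = N.+2.
Proof.
rewrite gl_polyE size_polyN size_mul ?deriv_leg_neq0 // -?size_poly_gt0 -polyC1 size_XnsubC //.
by rewrite size_deriv_leg.
Qed.

Lemma lead_coef_gl_poly : lead_coef Om = - (N%:R * P`_N).
Proof.
by rewrite gl_polyE lead_coefN lead_coefM lead_coef_deriv_leg -polyC1 lead_coefXnsubC // mul1r.
Qed.

Lemma gl_poly_neq0 : Om != 0.
Proof. by rewrite -size_poly_gt0 size_gl_poly. Qed.

Lemma gl_poly_orth d : (size d < N)%N -> pint (-1) 1 (Om * d) = 0.
Proof.
move=> sd; rewrite /gl_poly mulrAC mulrC.
rewrite pint_by_parts !polyE sqrrN !expr1n subrr !mul0r !mulr0 subrr sub0r.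
rewrite leg_orth ?oppr0 // size_deriv -subn1 leq_subLR add1n.
apply: leq_trans (size_polyMleq _ _) _.
rewrite -opprB size_polyN -polyC1 size_XnsubC //.
Qed.

Lemma leg_node_neq0 i : (i <= N)%N -> P.[x i] != 0.
Proof.
move=> iN; have [->|i0] := posnP i.
  by rewrite gl_first -sqrf_eq0 legN1_sqr oner_neq0.
move: iN; rewrite leq_eqVlt => /predU1P[->|iN]; first by rewrite gl_last leg1 oner_neq0.
by rewrite leg_neq0_crit ?gl_crit ?gl_lt1 ?gl_gtN1 // ltnW.
Qed.

Lemma deriv_gl_poly_node i : Om^`().[x i] = - (lam * P.[x i]).
Proof. by rewrite /gl_poly leg_ode hornerZ mulNr. Qed.

(** The Lagrange polynomial of node [i] without its normalisation; its value at that node is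
    [- (lam * P)]. *)
Definition gl_cofactor i : {poly R} := Om %/ ('X - (x i)%:P).
Local Notation L := gl_cofactor.

Lemma gl_cofactorE i : (i <= N)%N -> Om = L i * ('X - (x i)%:P).
Proof. by move=> iN; rewrite /gl_cofactor divpK // dvdp_XsubCl; apply/rootP/gl_poly_root. Qed.

Lemma size_gl_cofactor i : (i <= N)%N -> size (L i) = N.+1.
Proof. by move=> iN; rewrite /gl_cofactor size_divp ?polyXsubC_eq0 // size_XsubC size_gl_poly. Qed.

Lemma gl_cofactor_node i : (i <= N)%N -> (L i).[x i] = - (lam * P.[x i]).
Proof.
move=> iN; rewrite -deriv_gl_poly_node (gl_cofactorE iN) derivM derivXsubC !polyE.
by rewrite subrr mulr0 add0r mulr1.
Qed.

Lemma gl_cofactor_other i j : (i <= N)%N -> (j <= N)%N -> i != j -> (L i).[x j] = 0.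
Proof.
move=> iN jN ij; have := gl_poly_root jN; rewrite (gl_cofactorE iN) !polyE => /eqP.
rewrite mulf_eq0 subr_eq0 => /orP[/eqP//|/eqP /(gl_inj jN iN) E].
by rewrite E eqxx in ij.
Qed.

Definition gl_weight i : R := pint (-1) 1 (L i) / (L i).[x i].
Local Notation om := gl_weight.

Definition quad f : R := \sum_(i < N.+1) om i * f.[x i].

Lemma gl_interpolation f : (size f <= N.+1)%N ->
  f = \sum_(i < N.+1) (f.[x i] / (L i).[x i]) *: L i.
Proof.
move=> sf; apply/eqP; rewrite -subr_eq0; apply/eqP.
apply: (@poly_ltsp_roots _ _ (gauss_lobatto R N)).
- rewrite size_gauss_lobatto // (leq_trans (size_polyD _ _)) // geq_max sf size_polyN.
  rewrite (leq_trans (size_sum _ _ _)) //; apply/bigmax_leqP => i _.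
  by rewrite (leq_trans (size_scale_leq _ _)) // size_gl_cofactor // -ltnS.
- exact: uniq_roots.
- apply/allP => y /(nthP 0)[j]; rewrite size_gauss_lobatto // ltnS => jN <-.
  rewrite -/(x j); apply/rootP; rewrite hornerD hornerN horner_sum.
  rewrite (bigD1 (Ordinal (jN : j < N.+1)%N)) //= big1 => [|i].
    rewrite hornerZ addr0 divfK ?subrr // gl_cofactor_node // oppr_eq0.
    by rewrite mulf_neq0 ?leg_node_neq0 // gt_eqF // lam_gt0.
  rewrite -val_eqE /= => ij; have iN : (i <= N)%N by rewrite -ltnS.
  by rewrite hornerZ (gl_cofactor_other iN jN ij) mulr0.
Qed.

(** Division by the node polynomial leaves a remainder that is its own interpolant, and a quotient
    of size below [N], to which the node polynomial is orthogonal. *)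
Lemma quad_exact f : (size f <= 2 * N)%N -> pint (-1) 1 f = quad f.
Proof.
move=> sf; rewrite {1}(divp_eq f Om) pintD (mulrC _ Om) gl_poly_orth ?add0r.
  have sr : (size (f %% Om)%R <= N.+1)%N.
    by rewrite -ltnS -size_gl_poly ltn_modp gl_poly_neq0.
  rewrite {1}(gl_interpolation sr) raddf_sum /=; apply: eq_bigr => i _.
  have -> : f.[x i] = (f %% Om).[x i].
    rewrite {1}(divp_eq f Om) hornerD hornerM gl_poly_root ?mulr0 ?add0r //.
    by rewrite -ltnS.
  by rewrite pintZ /gl_weight; ring.
rewrite size_divp ?gl_poly_neq0 // size_gl_poly /=.
by move: (size f) sf => m; lia.
Qed.

(** A detector of the quadrature error: [D] has degree [2 N], a positive leading coefficient, zeros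
    at all nodes and a nonpositive integral. Adding a multiple of it brings a polynomial of degree
    [2 N] into the range of exactness without changing its nodal values. *)
Let D : {poly R} := ('X^2 - 1) * P^`() ^+ 2.

Let D_coef : D`_(2 * N) = (N%:R * P`_N) ^+ 2.
Proof.
have X0 : ('X^2 - 1 : {poly R}) != 0 by rewrite -size_poly_gt0 -polyC1 size_XnsubC.
have sD : size D = (2 * N).+1.
  rewrite /D size_mul ?expf_neq0 ?deriv_leg_neq0 // -polyC1 size_XnsubC //.
  rewrite expr2 size_mul ?deriv_leg_neq0 // size_deriv_leg; lia.
have -> : D`_(2 * N) = lead_coef D by rewrite lead_coefE sD.
rewrite /D (expr2 P^`()) !lead_coefM lead_coef_deriv_leg -polyC1 lead_coefXnsubC //; ring.
Qed.

Let sD : (size D <= (2 * N).+1)%N.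
Proof.
rewrite /D (leq_trans (size_polyMleq _ _)) // -polyC1 size_XnsubC //.
rewrite expr2 size_mul ?deriv_leg_neq0 // size_deriv_leg; lia.
Qed.

Let pint_D : pint (-1) 1 D = - (lam * pint (-1) 1 (P ^+ 2)).
Proof. by rewrite -pint_deriv_leg_sqr -pintN /D -mulNr opprB. Qed.

Let D_node i : (i <= N)%N -> D.[x i] = 0.
Proof.
move=> iN; have -> : D = - (Om * P^`()) by rewrite /D /gl_poly; ring.
by rewrite hornerN hornerM gl_poly_root // mul0r oppr0.
Qed.

Let D_coef_gt0 : 0 < D`_(2 * N).
Proof.
rewrite D_coef lt_neqAle sqr_ge0 andbT eq_sym sqrf_eq0 mulf_neq0 ?leg_lead_neq0 //.
by rewrite pnatr_eq0 -lt0n.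
Qed.

Lemma quad_addD f c : quad (f + c *: D) = quad f.
Proof.
apply: eq_bigr => i _; rewrite hornerD hornerZ D_node ?mulr0 ?addr0 //.
by rewrite -ltnS.
Qed.

Lemma quad_ge f : (size f <= (2 * N).+1)%N -> 0 <= f`_(2 * N) ->
  pint (-1) 1 f <= quad f.
Proof.
move=> sf f0; pose c := f`_(2 * N) / D`_(2 * N).
have c0 : 0 <= c by rewrite divr_ge0 // ltW.
have : pint (-1) 1 (f + (- c) *: D) = quad (f + (- c) *: D).
  apply: quad_exact; apply/leq_sizeP => j.
  rewrite leq_eqVlt coefD coefZ => /predU1P[<-|lt].
    by rewrite mulNr divfK ?subrr // gt_eqF.
  by rewrite (nth_default 0 (leq_trans sf lt)) (nth_default 0 (leq_trans sD lt)) mulr0 addr0.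
rewrite quad_addD pintD pintZ => <-; rewrite lerDl pint_D mulrNN.
have G0 : 0 <= pint (-1) 1 (P ^+ 2).
  by apply: pint_ge0 => [|y _ _]; [lra | rewrite polyE sqr_ge0].
by rewrite mulr_ge0 // mulr_ge0.
Qed.

Lemma gl_weightE i : (i <= N)%N -> om i * (lam * P.[x i] ^+ 2) = 2.
Proof.
move=> iN.
(* The coefficients of degree [2 N] cancel, since [L i] and [P] have leading coefficients [- N P_N]
   and [P_N]. Only node [i] contributes to the quadrature of the sum. *)
have sf : (size (N%:R *: (L i * P) + 1 *: D)%R <= 2 * N)%N.
  apply/leq_sizeP => j; rewrite leq_eqVlt coefD !coefZ => /predU1P[<-|lt].
    have sP : size P = N.+1 by have := size_deriv_leg; rewrite size_deriv; case: size => //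
      [|k /= ->//]; lia.
    have sLP : (size (L i * P)%R = (2 * N).+1)%N.
      by rewrite size_mul ?size_gl_cofactor ?sP -?size_poly_gt0 ?size_gl_cofactor ?sP //; lia.
    have -> : (L i * P)`_(2 * N) = lead_coef (L i * P) by rewrite lead_coefE sLP.
    have : lead_coef Om = lead_coef (L i) by rewrite (gl_cofactorE iN) lead_coefM lead_coefXsubC
      mulr1.
    rewrite lead_coef_gl_poly lead_coefM => <-; rewrite D_coef [lead_coef P]lead_coefE sP; ring.
  rewrite (nth_default 0 (leq_trans sD lt)) nth_default ?mulr0 ?addr0 //.
  apply: leq_trans (size_polyMleq _ _) _; rewrite size_gl_cofactor //.
  by apply: leq_trans lt; rewrite -ltnS prednK; have := size_leg R N; lia.
have := quad_exact sf; rewrite quad_addD scale1r pintD pintZ pint_D.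
have -> : pint (-1) 1 (L i * P) = - N%:R * pint (-1) 1 (P ^+ 2).
  have : pint (-1) 1 (P * (L i + N%:R *: P)) = 0.
    apply: leg_orth; apply/leq_sizeP => j; rewrite leq_eqVlt coefD coefZ => /predU1P[<-|lt].
      have : lead_coef Om = lead_coef (L i) by rewrite (gl_cofactorE iN) lead_coefM lead_coefXsubC
        mulr1.
      by rewrite lead_coef_gl_poly [lead_coef (L i)]lead_coefE size_gl_cofactor //= => <-;
        rewrite addNr.
    rewrite !nth_default ?mulr0 ?addr0 ?size_gl_cofactor //.
    exact: leq_trans (size_leg R N) lt.
  rewrite mulrDr -scalerAr pintD pintZ -expr2 mulrC; lra.
rewrite /quad (bigD1 (Ordinal (iN : i < N.+1)%N)) //= big1 ?addr0; last first.
  move=> j; rewrite -val_eqE /= => ij; have jN : (j <= N)%N by rewrite -ltnS.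
  by rewrite !polyE (gl_cofactor_other iN jN) ?mul0r ?mulr0 // eq_sym.
rewrite !polyE gl_cofactor_node //; have := pint_leg_sqr R N.
have n0 : N%:R != 0 :> R by rewrite pnatr_eq0 -lt0n.
move: (pint _ _ _) => G GE H; apply: (mulfI n0).
move: H; rewrite !natrM -!natr1 natrD natrM in GE *; move: GE; nra.
Qed.

Lemma gl_weight_gt0 i : (i <= N)%N -> 0 < om i.
Proof.
move=> iN; have := gl_weightE iN.
have : 0 < lam * P.[x i] ^+ 2.
  by rewrite mulr_gt0 ?lam_gt0 // lt_neqAle sqr_ge0 eq_sym sqrf_eq0 leg_node_neq0.
move=> h E; rewrite -(pmulr_lgt0 _ h) E; lra.
Qed.

End Nodes.

Lemma is_derive_horner (R : realType) (p : {poly R}) (x : R) :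
  is_derive x 1 (horner p) p^`().[x].
Proof.
apply: DeriveDef; first exact: derivable_horner.
by rewrite derivE derive1E.
Qed.

(** Monotonicity of a rational function from a polynomial inequality; needed because the Sonin
    function is not a polynomial. *)
Lemma ler_ratio_horner (R : realType) (A B : {poly R}) (a b : R) : a <= b ->
  (forall x, a <= x -> x <= b -> 0 < B.[x]) ->
  (forall x, a <= x -> x <= b -> (A^`() * B - A * B^`()).[x] <= 0) ->
  A.[b] / B.[b] <= A.[a] / B.[a].
Proof.
move=> ab B0 AB.
pose f x := A.[x] * B.[x]^-1.
pose df x := A.[x] *: (- B.[x] ^- 2 *: B^`().[x]) + B.[x]^-1 *: A^`().[x].
have fD x : x \in `[a, b]%R -> is_derive x 1 f (df x).
  rewrite in_itv /= => /andP[ax xb].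
  have hB : is_derive x 1 (fun y => B.[y]^-1) (- B.[x] ^- 2 *: B^`().[x]).
    have Bx : B.[x] != 0 by rewrite gt_eqF // B0.
    have dB := is_derive_horner B x.
    apply: DeriveDef; first by apply: derivableV => //; exact: derivable_horner.
    by rewrite deriveV ?derive_val //; exact: derivable_horner.
  exact: (@is_deriveM _ _ (horner A) (fun y => B.[y]^-1) x 1 _ _ (is_derive_horner A x) hB).
have fD' x : x \in `]a, b[%R -> is_derive x 1 f (df x).
  by move=> xab; apply: fD; exact: subset_itv_oo_cc xab.
have fC : {within `[a, b], continuous f}%classic.
  apply: continuous_in_subspaceT => x xab; apply: differentiable_continuous.
  apply/derivable1_diffP; apply: (@ex_derive _ _ _ _ _ _ _ (fD x _)).
  by move: xab; rewrite inE.
have [c] := @MVT_segment R f df a b ab fD' fC.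
rewrite in_itv /= => /andP[ac cb] E.
suff : f b - f a <= 0 by rewrite subr_le0.
rewrite E mulr_le0_ge0 ?subr_ge0 //.
have := AB c ac cb; rewrite hornerD hornerN !hornerM.
have Bc := B0 c ac cb.
have -> : df c = (A^`().[c] * B.[c] - A.[c] * B^`().[c]) * B.[c] ^- 2.
  by rewrite /df /GRing.scale /=; field; rewrite gt_eqF.
by move=> H; rewrite mulr_le0_ge0 // invr_ge0 sqr_ge0.
Qed.

(** * Geometry of the nodes *)

Section Sonin.
Variables (R : realType) (N : nat).
Hypothesis N0 : (0 < N)%N.
Implicit Types (x y t : R).
Local Notation P := (leg R N).
Local Notation lam := ((N * N.+1)%:R : R).

Lemma lam_ge2 : 2 <= lam.
Proof. by rewrite (ler_nat R 2); nia. Qed.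

Lemma crit_dist_right y : y < 1 -> P^`().[y] = 0 -> 1 < 2 * lam * (1 - y).
Proof.
move=> y1 dy; rewrite ltNge; apply/negP => H.
have l2 := lam_ge2.
have := @deriv_leg_gt0 R N y N0 _ y1 H; rewrite dy ltxx => K.
by have : false by apply: K; nra.
Qed.

Lemma crit_dist_left y : -1 < y -> P^`().[y] = 0 -> 1 < 2 * lam * (1 + y).
Proof.
move=> y1 dy; rewrite -[y]opprK; apply: crit_dist_right; first lra.
by rewrite deriv_legN dy mulr0 oppr0.
Qed.

Lemma crit_dist y : -1 < y -> y < 1 -> P^`().[y] = 0 -> 1 <= 2 * lam * (1 - y ^+ 2).
Proof.
move=> yl yu dy; have := crit_dist_left yl dy; have := crit_dist_right yu dy.
have l2 := lam_ge2; have [y0|y0] := leP 0 y; nra.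
Qed.

(** With [x = cos theta] and [S = sin^2 theta], the equation for [y = sqrt (sin theta) P] has
    coefficient [k = Den / (4 S)], and [y' = V / (2 sqrt (sin theta))]. The Sonin function is then
    [sin theta * Num / Den]; squaring it makes it rational in [x]. *)
Let Q := 4 * lam + 1.
Let S : {poly R} := 1 - 'X^2.
Let V : {poly R} := 'X * P - 2 *: (S * P^`()).
Let Den : {poly R} := Q *: S + 1.
Let Num : {poly R} := Den * P ^+ 2 + V ^+ 2.

Let dS x : S^`().[x] = - (2 * x).
Proof. by rewrite /S derivB -polyC1 derivC derivXn /= !polyE expr1; ring. Qed.

Let dDen x : Den^`().[x] = - (2 * Q * x).
Proof.
by rewrite /Den derivD derivZ -polyC1 derivC hornerD hornerZ horner0 dS; ring.
Qed.

Let dV x : V^`().[x] = (1 + 2 * lam) * P.[x] + x * P^`().[x].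
Proof.
have := leg_odeE N x.
rewrite /V derivB derivZ leg_ode derivM derivX !polyE => H; ring.
Qed.

Let Den_ge1 t : t ^+ 2 <= 1 -> 1 <= Den.[t].
Proof.
move=> t1; have -> : Den.[t] = Q * (1 - t ^+ 2) + 1 by rewrite /Den /S !polyE.
have l2 := lam_ge2; have Q0 : 0 <= Q by rewrite /Q; lra.
by rewrite lerDr mulr_ge0 //; lra.
Qed.

(* In the variable [theta], with [x = cos theta] and
   [y = sqrt (sin theta) * P (cos theta)], one has [y'' + k y = 0], and the
   quotient below is the square of the Sonin function [y ^ 2 + y' ^ 2 / k]. *)
Lemma sonin_decr x y : 0 <= x -> x <= y -> y < 1 ->
  (S * Num ^+ 2).[y] / (Den ^+ 2).[y] <= (S * Num ^+ 2).[x] / (Den ^+ 2).[x].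
Proof.
move=> x0 xy y1; apply: ler_ratio_horner => // t xt ty.
  rewrite horner_exp exprn_gt0 //; have : 1 <= Den.[t] by apply: Den_ge1; nra.
  lra.
have -> : (S * Num ^+ 2)^`() * Den ^+ 2 - (S * Num ^+ 2) * (Den ^+ 2)^`() =
   (Num * Den) * ((S^`() * Num + 2%:R *: (S * Num^`())) * Den - 2%:R *: (S * Num * Den^`())).
  by rewrite !derivM -!mul_polyC !rmorph_nat; ring.
have -> : Num^`() = Den^`() * P ^+ 2 + 2%:R *: (Den * P * P^`()) + 2%:R *: (V * V^`()).
  by rewrite /Num derivD !derivM -!mul_polyC !rmorph_nat; ring.
have D0 : 0 <= Den.[t] by apply: le_trans ler01 (Den_ge1 _); nra.
have N00 : 0 <= Num.[t].
  by rewrite /Num hornerD hornerM !horner_exp addr_ge0 ?sqr_ge0 // mulr_ge0 ?sqr_ge0.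
rewrite hornerM mulr_ge0_le0 //; first by rewrite hornerM mulr_ge0.
have -> : ((S^`() * Num + 2 *: (S * (Den^`() * P ^+ 2 + 2 *: (Den * P * P^`()) +
   2 *: (V * V^`())))) * Den - 2 *: (S * Num * Den^`())).[t] = - (4 * t * V.[t] ^+ 2).
  rewrite !(hornerD, hornerN, hornerZ, hornerM) dS dDen dV /Num /V /Den /S !polyE /Q.
  by ring.
rewrite oppr_le0 mulr_ge0 ?sqr_ge0 // mulr_ge0 //; lra.
Qed.

(** The Sonin function at [x] is compared with that at [y = 1 - 1 / (2 lam)]: no critical point lies
    beyond [y], and [P >= 1 / 2] there. At a critical point [V = x P], so [Num <= 2 P^2 Den]. *)
Lemma crit_value_ge x : -1 < x -> x < 1 -> P^`().[x] = 0 ->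
  1 <= 128 * lam * (1 - x ^+ 2) * P.[x] ^+ 4.
Proof.
wlog x0 : x / 0 <= x => [wl|] xl xu dx.
  have [/wl->//|xn] := leP 0 x.
  have := wl (- x) _ _ _ _; rewrite legN deriv_legN dx mulr0 oppr0 exprMn sqrrN.
  have -> : ((-1) ^+ N) ^+ 4 = 1 :> R by rewrite exprAC (_ : (-1) ^+ 4 = 1) ?expr1n //; ring.
  by rewrite mul1r; apply; lra.
have l2 := lam_ge2; have [i li] : exists i, 2 * lam * i = 1 by exists (2 * lam)^-1;
  rewrite mulfV //; lra.
pose y := 1 - i.
have i0 : 0 < i by rewrite -(pmulr_rgt0 _ (_ : 0 < 2 * lam)); lra.
have i4 : i <= 1 / 4 by have : 0 <= (lam - 2) * i by [rewrite mulr_ge0; lra]; lra.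
have y1 : y < 1 by rewrite /y; lra.
have y0 : 0 <= y by rewrite /y; lra.
have xy : x <= y by have := crit_dist_right xu dx; rewrite /y; nra.
have := sonin_decr x0 xy y1.
have P2 : 1 / 2 <= P.[y] by apply: leg_ge_half => //; rewrite /y; lra.
have DenE t : Den.[t] = Q * (1 - t ^+ 2) + 1 by rewrite /Den /S !polyE.
have NumE t : Num.[t] = Den.[t] * P.[t] ^+ 2 + (t * P.[t] - 2 * ((1 - t ^+ 2) * P^`().[t])) ^+ 2.
  by rewrite /Num hornerD hornerM !horner_exp /V /S !polyE.
have Q0 : 1 <= Q by rewrite /Q; lra.
have Sx : 0 < 1 - x ^+ 2 by nra.
have Sy : i <= 1 - y ^+ 2 by rewrite /y; nra.
have Sy0 : 0 < 1 - y ^+ 2 by nra.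
have Dx : 1 <= Den.[x] by apply: Den_ge1; lra.
have Dy : 1 <= Den.[y] by apply: Den_ge1; lra.
have SE t : S.[t] = 1 - t ^+ 2 by rewrite /S !polyE.
rewrite !(hornerM S) !horner_exp !SE !ler_pdivlMr ?exprn_gt0 //; try lra.
rewrite mulrAC ler_pdivrMr ?exprn_gt0 //; try lra.
have NumY : Den.[y] / 4 <= Num.[y].
  rewrite NumE -[X in X <= _]addr0 lerD ?sqr_ge0 //.
  rewrite ler_pM2l; [nra | lra].
have NumX : Num.[x] <= 2 * P.[x] ^+ 2 * Den.[x].
  rewrite NumE dx mulr0 mulr0 subr0 exprMn.
  have : x ^+ 2 <= 1 by nra.
  have := sqr_ge0 P.[x]; nra.
have NumX0 : 0 <= Num.[x].
  rewrite NumE addr_ge0 ?sqr_ge0 // mulr_ge0 ?sqr_ge0 //; lra.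
move=> H.
have h1 : (Den.[y] / 4) ^+ 2 <= Num.[y] ^+ 2 by rewrite ler_pXn2r ?nnegrE //; lra.
have h2 : Num.[x] ^+ 2 <= (2 * P.[x] ^+ 2 * Den.[x]) ^+ 2.
  by rewrite ler_pXn2r ?nnegrE //; apply: le_trans NumX.
have D2x : 0 < Den.[x] ^+ 2 by rewrite exprn_gt0; lra.
have D2y : 0 < Den.[y] ^+ 2 by rewrite exprn_gt0; lra.
have h3 : (1 - y ^+ 2) * (Den.[y] / 4) ^+ 2 * Den.[x] ^+ 2 <=
   (1 - x ^+ 2) * (2 * P.[x] ^+ 2 * Den.[x]) ^+ 2 * Den.[y] ^+ 2.
  apply: (@le_trans _ _ ((1 - y ^+ 2) * Num.[y] ^+ 2 * Den.[x] ^+ 2)).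
    by rewrite ler_pM2r // ler_pM2l.
  apply: (le_trans H); rewrite ler_pM2r // ler_pM2l //.
have h4 : (1 - y ^+ 2) / 16 <= (1 - x ^+ 2) * (4 * P.[x] ^+ 4).
  rewrite -(ler_pM2r D2x) -(ler_pM2r D2y).
  by move: h3; congr (_ <= _); field.
have : 0 <= lam * ((1 - x ^+ 2) * (4 * P.[x] ^+ 4) - i / 16).
  by rewrite mulr_ge0 //; lra.
lra.
Qed.

End Sonin.

Lemma noroot_sign (R : rcfType) (p : {poly R}) (a b : R) : a < b ->
  (forall t, a < t -> t < b -> p.[t] != 0) ->
  exists2 c, c != 0 & forall t, a < t -> t < b -> 0 < c * p.[t].
Proof.
move=> ab p0; have nr : {in `]a, b[, forall t, ~~ root p t}.
  by move=> t; rewrite in_itv /= rootE => /andP[]; exact: p0.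
pose m := (a + b) / 2; have am : a < m by rewrite /m; lra.
have mb : m < b by rewrite /m; lra.
exists p.[m]; first exact: p0.
move=> t at_ tb; have := polyrN0_itv nr; move=> /(_ t m).
rewrite !in_itv /= at_ tb am mb => /(_ isT isT) E.
by rewrite -sgr_gt0 sgrM E -expr2 sqr_sg p0 ?ltr01.
Qed.

(** * Distances between nodes and size of the quadrature weights *)

Section Gaps.
Variables (R : realType) (N : nat).
Hypothesis N0 : (0 < N)%N.
Implicit Types (i : nat) (t K : R).
Local Notation P := (leg R N).
Local Notation lam := ((N * N.+1)%:R : R).
Local Notation x := (gl_point R N).
Local Notation om := (gl_weight R N).

(** A Sturm comparison by testing. Two integrations by parts show that [P'] is orthogonal on the
    cell to [(1 - 'X^2) f'' + lam f]; in too long a cell this function is positive, while [P'] has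
    constant sign. Squaring [m] makes [f''] positive near the ends. *)
Lemma gl_gap_le i K : (i < N)%N ->
  (forall t, x i <= t -> t <= x i.+1 -> 1 - t ^+ 2 <= K) ->
  lam * (x i.+1 - x i) ^+ 2 <= 36 * K.
Proof.
move=> iN HK; rewrite leNgt; apply/negP => big.
have ab : x i < x i.+1 by rewrite gl_lt.
have [c c0 cP] := noroot_sign ab (fun t => @gl_no_crit R N N0 i t iN).
have a1 : -1 <= x i by rewrite gl_geN1 // ltnW.
have b1 : x i.+1 <= 1 by rewrite gl_le1.
have Da : ((1 - 'X^2) * P^`()).[x i] = 0 by rewrite -/(gl_poly R N) gl_poly_root // ltnW.
have Db : ((1 - 'X^2) * P^`()).[x i.+1] = 0 by rewrite -/(gl_poly R N) gl_poly_root.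
move: (x i) (x i.+1) ab a1 b1 Da Db HK big cP => a b ab a1 b1 Da Db HK big cP.
pose m : {poly R} := ('X - a%:P) * (b%:P - 'X).
pose f := m ^+ 2.
have fa : f.[a] = 0 by rewrite /f /m !polyE; ring.
have fb : f.[b] = 0 by rewrite /f /m !polyE; ring.
have l0 := lam_gt0 R N0.
have h0 : pint a b (P^`() * ((1 - 'X^2) * f^`()^`() + lam *: f)) = 0.
  have -> : P^`() * ((1 - 'X^2) * f^`()^`() + lam *: f) =
    f^`()^`() * ((1 - 'X^2) * P^`()) + lam *: (P^`() * f).
    by rewrite -!mul_polyC; ring.
  rewrite pintD pintZ (pint_by_parts _ _ f^`()) (pint_by_parts _ _ P) leg_ode Da Db fa fb !mulr0
    subrr !sub0r.
  rewrite -scalerAr pintZ (mulrC P); ring.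
have hE t : ((1 - 'X^2) * f^`()^`() + lam *: f).[t] =
   (1 - t ^+ 2) * (2 * (b - a) ^+ 2 - 12 * ((t - a) * (b - t))) + lam * ((t - a) * (b - t)) ^+ 2.
  have -> : f^`()^`() = (2 * (b - a) ^+ 2)%:P - 12%:P * m.
    rewrite /f /m !(derivM, derivD, derivB, derivN, derivC, derivX).
    rewrite !(rmorphM, rmorphXn, rmorphB, rmorph_nat) /=; ring.
  by rewrite /f /m !polyE.
have pos t : a < t -> t < b -> 0 < ((1 - 'X^2) * f^`()^`() + lam *: f).[t].
  move=> at_ tb; rewrite hE; set q := (t - a) * (b - t).
  have q0 : 0 < q by rewrite mulr_gt0 ?subr_gt0.
  have t1 : 0 <= 1 - t ^+ 2 by nra.
  have tK : 1 - t ^+ 2 <= K by apply: HK; exact: ltW.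
  have q4 : 4 * q <= (b - a) ^+ 2 by have := sqr_ge0 (a + b - 2 * t); rewrite /q; lra.
  (* [f''] is negative only where [q > (b - a)^2 / 6]; it is at least [- (b - a)^2], and [lam q^2]
     outweighs this: hence the [36]. *)
  have [le6|gt6] := leP (12 * q) (2 * (b - a) ^+ 2).
    by rewrite ltr_wpDl // ?mulr_ge0 ?mulr_gt0 ?exprn_gt0 //; lra.
  have K0 : 0 <= K by lra.
  have L0 : 0 < (b - a) ^+ 2 by rewrite exprn_gt0 // subr_gt0.
  have h1 : K * (2 * (b - a) ^+ 2 - 12 * q) <= (1 - t ^+ 2) * (2 * (b - a) ^+ 2 - 12 * q).
    by rewrite ler_wnM2r //; lra.
  have h2 : K * (- (b - a) ^+ 2) <= K * (2 * (b - a) ^+ 2 - 12 * q).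
    by rewrite ler_wpM2l //; lra.
  have h3 : lam * ((b - a) ^+ 2 / 6) ^+ 2 <= lam * q ^+ 2.
    by rewrite ler_pM2l // ler_pXn2r ?nnegrE //; lra.
  have h4 : 36 * K * (b - a) ^+ 2 < lam * (b - a) ^+ 2 * (b - a) ^+ 2 by rewrite ltr_pM2r.
  lra.
have z0 : c *: (P^`() * ((1 - 'X^2) * f^`()^`() + lam *: f)) = 0.
  apply: (@pint_ge0_eq0_oo _ a b) => // [t at_ tb|]; last by rewrite pintZ h0 mulr0.
  by rewrite hornerZ hornerM mulrA mulr_ge0 // ltW ?cP ?pos.
pose t := (a + b) / 2; have at_ : a < t by rewrite /t; lra.
have tb : t < b by rewrite /t; lra.
have := congr1 (horner^~ t) z0; rewrite /= hornerZ hornerM mulrA horner0 => /eqP.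
by rewrite gt_eqF // mulr_gt0 ?cP ?pos.
Qed.

(** Rolle for the node polynomial gives a zero [c] of [P] in the cell. With [m] the end of larger
    modulus, [P(m) = P'(e) (m - c)] for some [e] between them, and the Legendre energy at [e] is at
    most that at [m], namely [lam P(m)^2]. *)
Lemma gl_gap_ge_aux i : (i < N)%N ->
  exists e, [/\ x i < e, e < x i.+1 & 1 - e ^+ 2 <= lam * (x i.+1 - x i) ^+ 2].
Proof.
move=> iN; have ab : x i < x i.+1 by rewrite gl_lt.
have a1 : -1 <= x i by rewrite gl_geN1 // ltnW.
have b1 : x i.+1 <= 1 by rewrite gl_le1.
have Da : (gl_poly R N).[x i] = 0 by rewrite gl_poly_root // ltnW.
have Db : (gl_poly R N).[x i.+1] = 0 by rewrite gl_poly_root.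
have Pa : P.[x i] != 0 by rewrite leg_node_neq0 // ltnW.
have Pb : P.[x i.+1] != 0 by rewrite leg_node_neq0.
move: (x i) (x i.+1) ab a1 b1 Da Db Pa Pb => a b ab a1 b1 Da Db Pa Pb.
have [|c] := @poly_rolle _ a b (gl_poly R N) ab; first by rewrite Da Db.
rewrite in_itv /= /gl_poly leg_ode hornerZ => /andP[ac cb] /eqP.
rewrite mulf_eq0 oppr_eq0 gt_eqF ?lam_gt0 //= => /eqP Pc.
have key m e : -1 <= m -> m <= 1 -> a <= m -> m <= b -> (gl_poly R N).[m] = 0 -> P.[m] != 0 ->
    `|e| <= `|m| -> P.[m] ^+ 2 = (P^`().[e] * (m - c)) ^+ 2 ->
    1 - e ^+ 2 <= lam * (b - a) ^+ 2.
  move=> m1 m2 am mb Dm Pm em E.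
  have := leg_energy_le N em; rewrite ler_norml m1 m2 => /(_ isT).
  have -> : (1 - m ^+ 2) * P^`().[m] ^+ 2 = 0.
    by move: Dm; rewrite /gl_poly !polyE expr2 mulrA => ->; rewrite mul0r.
  rewrite addr0 => H.
  have P2 : 0 < P.[m] ^+ 2 by rewrite lt_neqAle sqr_ge0 eq_sym sqrf_eq0 Pm.
  have l0 := lam_gt0 R N0.
  have p2 : 0 <= lam * P.[e] ^+ 2 by rewrite mulr_ge0 ?sqr_ge0.
  have mc : (m - c) ^+ 2 <= (b - a) ^+ 2 by nra.
  rewrite -(ler_pM2r P2).
  have h1 : (1 - e ^+ 2) * P^`().[e] ^+ 2 <= lam * P.[m] ^+ 2 by lra.
  apply: (@le_trans _ _ (lam * P.[m] ^+ 2 * (m - c) ^+ 2)).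
    rewrite {1}E exprMn mulrA ler_wpM2r ?sqr_ge0 //.
  by rewrite mulrAC ler_pM2r // ler_pM2l.
have [ba|ab'] := leP `|a| `|b|.
  have [e] := poly_mvt P cb; rewrite Pc subr0 in_itv /= => /andP[ce eb] E.
  exists e; split=> //; first exact: lt_trans ce.
  apply: (key b e) => //; rewrite ?E //; try lra.
  rewrite ler_norml; move: ba; rewrite ler_norml; case: (ger0P b); lra.
have [e] := poly_mvt P ac; rewrite Pc sub0r in_itv /= => /andP[ae ec] E.
exists e; split=> //; first exact: lt_trans cb.
apply: (key a e) => //; try lra.
  rewrite ler_norml; move/ltW: ab'; rewrite ler_norml; case: (ger0P a); lra.
by rewrite -[P.[a]]opprK E; ring.
Qed.

(** Since [om i * lam * P^2 = 2], this is the lower bound on critical values multiplied by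
    [lam * om i ^+ 2]; [512 = 128 * 2^2]. *)
Lemma gl_weight_sqr i : (0 < i)%N -> (i < N)%N ->
  lam * om i ^+ 2 <= 512 * (1 - x i ^+ 2).
Proof.
move=> i0 iN; have x1 := gl_gtN1 R N0 i0 (ltnW iN); have x2 := gl_lt1 R N0 iN.
have := crit_value_ge N0 x1 x2 (gl_crit R N0 i0 iN).
have := gl_weightE R N0 (ltnW iN).
have := lam_gt0 R N0; have := gl_weight_gt0 R N0 (ltnW iN).
move: (om i) (P.[x i]) => w p w0 l0 E H.
have : lam * w ^+ 2 * 1 <= lam * w ^+ 2 * (128 * lam * (1 - x i ^+ 2) * p ^+ 4).
  by rewrite ler_wpM2l // mulr_ge0 ?sqr_ge0 // ltW.
have -> : lam * w ^+ 2 * (128 * lam * (1 - x i ^+ 2) * p ^+ 4) =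
  128 * (1 - x i ^+ 2) * (w * (lam * p ^+ 2)) ^+ 2 by ring.
rewrite E; lra.
Qed.

Lemma gl_weight_le i : (0 < i)%N -> (i < N)%N -> om i <= 32 * (1 - x i ^+ 2).
Proof.
move=> i0 iN; have x1 := gl_gtN1 R N0 i0 (ltnW iN); have x2 := gl_lt1 R N0 iN.
have := gl_weight_sqr i0 iN; have := crit_dist N0 x1 x2 (gl_crit R N0 i0 iN).
have := lam_gt0 R N0; have := gl_weight_gt0 R N0 (ltnW iN).
have S0 : 0 < 1 - x i ^+ 2 by nra.
move: (om i) (1 - x i ^+ 2) S0 => w S S0 w0 l0 h1 h2.
rewrite -(ler_pXn2r (n := 2)) ?nnegrE //; [|lra|lra].
rewrite -(ler_pM2l l0); apply: (le_trans h2).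
have := ler_wpM2l (_ : 0 <= 512 * S) h1; lra.
Qed.

Lemma gl_gap_ge i : (i.+1 < N)%N -> om i.+1 <= 100 * (x i.+1 - x i).
Proof.
move=> iN; have [e [ae eb H]] := gl_gap_ge_aux (ltnW iN).
have a1 := gl_geN1 R N0 (leq_trans (leqnSn i) (ltnW iN)).
have b1 := gl_lt1 R N0 iN.
have := gl_weight_sqr (ltn0Sn i) iN; have := gl_weight_le (ltn0Sn i) iN.
have := gl_weight_gt0 R N0 (ltnW iN); have := lam_gt0 R N0.
move: (om i.+1) (x i) (x i.+1) ae eb a1 b1 H => w a b ae eb a1 b1 H l0 w0 h1 h2.
(* Either [1 - x^2] is comparable at [e] and [b], or its variation [e^2 - b^2] already forces a gap
   of order [1 - b^2], which bounds the weight. *)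
have [le4|gt4] := leP (1 - b ^+ 2) (4 * (1 - e ^+ 2)); last first.
  have : (e - b) * (e + b) <= 2 * (b - a) by nra.
  lra.
rewrite -(ler_pXn2r (n := 2)) ?nnegrE //; [|lra|lra].
have := sqr_ge0 (b - a); rewrite -(ler_pM2l l0); lra.
Qed.

(** The squared gap is at most [72 (1 - x i) / lam], and [1 - x i.+1 > 1 / (2 lam)]. Were the gap
    above [145 (1 - x i.+1)], these would conflict; [145 = 2 * 72 + 1]. *)
Lemma gl_comp_right i : (i.+1 < N)%N -> 1 - x i <= 146 * (1 - x i.+1).
Proof.
move=> iN; have ab : x i < x i.+1 by rewrite gl_lt // ltnW.
have b1 := gl_lt1 R N0 iN.
have := crit_dist_right N0 b1 (gl_crit R N0 (ltn0Sn i) iN).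
have := @gl_gap_le i (2 * (1 - x i)) (ltnW iN).
have := lam_gt0 R N0.
move: (x i) (x i.+1) ab b1 => a b ab b1 l0 H h.
have {}H : lam * (b - a) ^+ 2 <= 36 * (2 * (1 - a)).
  by apply: H => t at_ tb; nra.
have y0 : 0 < 1 - b by lra.
rewrite leNgt; apply/negP => big.
have h1 : lam * (145 * (1 - b) * (b - a)) <= lam * (b - a) ^+ 2.
  by rewrite ler_pM2l // expr2 ler_pM2r; lra.
have h2 : (b - a) <= 2 * lam * (1 - b) * (b - a) by rewrite ler_peMl; lra.
have h3 : 2 * lam * (1 - b) * (145 * (1 - b)) <= 2 * lam * (1 - b) * (b - a).
  by rewrite ler_wpM2l //; [rewrite mulr_ge0; lra|lra].
have h4 : 1 - b <= 2 * lam * (1 - b) * (1 - b) by rewrite ler_peMl; lra.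
nra.
Qed.
End Gaps.

Section EndGaps.
Variables (R : realType) (N : nat).
Hypothesis N0 : (0 < N)%N.
Local Notation lam := ((N * N.+1)%:R : R).
Local Notation x := (gl_point R N).

Lemma gl_comp_left i : (0 < i)%N -> (i < N)%N -> 1 + x i.+1 <= 146 * (1 + x i).
Proof.
move=> i0 iN; have ab : x i < x i.+1 by rewrite gl_lt.
have a1 := gl_gtN1 R N0 i0 (ltnW iN).
have := crit_dist_left N0 a1 (gl_crit R N0 i0 iN).
have := @gl_gap_le R N N0 i (2 * (1 + x i.+1)) iN.
have := lam_gt0 R N0.
move: (x i) (x i.+1) ab a1 => a b ab a1 l0 H h.
have {}H : lam * (b - a) ^+ 2 <= 36 * (2 * (1 + b)).
  by apply: H => t at_ tb; nra.
have y0 : 0 < 1 + a by lra.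
rewrite leNgt; apply/negP => big.
have h1 : lam * (145 * (1 + a) * (b - a)) <= lam * (b - a) ^+ 2.
  by rewrite ler_pM2l // expr2 ler_pM2r; lra.
have h2 : (b - a) <= 2 * lam * (1 + a) * (b - a) by rewrite ler_peMl; lra.
have h3 : 2 * lam * (1 + a) * (145 * (1 + a)) <= 2 * lam * (1 + a) * (b - a).
  by rewrite ler_wpM2l //; [rewrite mulr_ge0; lra|lra].
have h4 : 1 + a <= 2 * lam * (1 + a) * (1 + a) by rewrite ler_peMl; lra.
nra.
Qed.

Lemma gl_last_gap : lam * (1 - x N.-1) <= 72.
Proof.
have := @gl_gap_le R N N0 N.-1 (2 * (1 - x N.-1)) _ _.
rewrite prednK // gl_last // => H; have ab : x N.-1 < 1 by rewrite gl_lt1 // prednK.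
have {}H : lam * (1 - x N.-1) ^+ 2 <= 36 * (2 * (1 - x N.-1)).
  by apply: H => // t at_ tb; nra.
by rewrite -(ler_pM2r (_ : 0 < 1 - x N.-1)); lra.
Qed.

Lemma gl_first_gap : lam * (1 + x 1) <= 72.
Proof.
have := @gl_gap_le R N N0 0 (2 * (1 + x 1)) N0.
rewrite gl_first // => H; have ab : -1 < x 1 by rewrite gl_gtN1.
have {}H : lam * (x 1 - -1) ^+ 2 <= 36 * (2 * (1 + x 1)).
  by apply: H => // t at_ tb; nra.
by rewrite -(ler_pM2r (_ : 0 < 1 + x 1)); lra.
Qed.

End EndGaps.

(** * Estimate of the interior nodes by duality *)

Section Approximation.
Variable R : realType.

(** The classical iteration increasing to the absolute value on [[-1, 1]], as in proofs of the
    Weierstrass theorem. *)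
Fixpoint abs_approx (n : nat) : {poly R} :=
  if n is m.+1 then
    let q := abs_approx m in q + 2^-1 *: ('X^2 - q ^+ 2) else 0.

(** For [u = |t| / 2] it bounds [|t| (1 - |t| / 2)^n] by [2 / n], uniformly in [t]. *)
Lemma bernoulli_inv (u : R) n : 0 <= u -> u <= 1 -> (1 - u) ^+ n * (1 + n%:R * u) <= 1.
Proof.
move=> u0 u1; elim: n => [|n IHn]; first by rewrite expr0 mul0r addr0 mulr1.
apply: le_trans IHn; rewrite exprS -mulrA mulrCA ler_wpM2l ?exprn_ge0 //; first lra.
rewrite -natr1; have : 0 <= n%:R * u * u by rewrite !mulr_ge0.
have := mulr_ge0 u0 u0; lra.
Qed.

Lemma abs_approxP n t : `|t| <= 1 ->
  [/\ 0 <= (abs_approx n).[t], (abs_approx n).[t] <= `|t| &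
      `|t| - (abs_approx n).[t] <= `|t| * (1 - `|t| / 2) ^+ n].
Proof.
move=> t1; have t0 := normr_ge0 t.
elim: n => [|n [q0 q1 q2]]; first by rewrite /= horner0 subr0 expr0 mulr1.
rewrite /= !polyE -[t ^+ 2](real_normK (num_real t)).
move: (abs_approx n).[t] `|t| t0 t1 q0 q1 q2 => q s t0 t1 q0 q1 q2.
split; [nra | nra |].
rewrite [_ ^+ n.+1]exprSr mulrA; apply: le_trans (_ : (s - q) * (1 - s / 2) <= _); first nra.
by rewrite ler_wpM2r //; lra.
Qed.

Lemma abs_approx_lim (e : R) : 0 < e ->
  exists q : {poly R}, forall t, `|t| <= 1 -> `|q.[t] - `|t| | <= e.
Proof.
move=> e0; pose n := Num.Def.archi_bound (2 / e).
have nP : 2 / e < n%:R.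
  by have := archi_boundP (_ : 0 <= 2 / e); apply; rewrite divr_ge0 // ltW.
exists (abs_approx n) => t t1; have [q0 q1 q2] := abs_approxP n t1.
have t0 := normr_ge0 t.
rewrite distrC ger0_norm ?subr_ge0 //; apply: le_trans q2 _.
have u0 : 0 <= `|t| / 2 by lra.
have u1 : `|t| / 2 <= 1 by lra.
have := bernoulli_inv n u0 u1.
have p0 : 0 <= (1 - `|t| / 2) ^+ n by rewrite exprn_ge0 //; lra.
move: ((1 - `|t| / 2) ^+ n) p0 => P p0 H.
have n0 : 0 < n%:R :> R by apply: le_lt_trans nP; rewrite divr_ge0 // ltW.
have h : n%:R * (`|t| * P) <= 2 by have := mulr_ge0 t0 p0; lra.
have h2 : 2 < n%:R * e by rewrite -ltr_pdivrMr.
by rewrite -(ler_pM2l n0); lra.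
Qed.

Lemma pos_part_approx (b : {poly R}) (e : R) : 0 < e ->
  exists q : {poly R}, forall t, -1 <= t -> t <= 1 ->
    `|q.[t] - Num.max 0 b.[t]| <= e.
Proof.
move=> e0; have [M0 M0P] := @poly_itv_bound R b (-1) 1.
pose M := `|M0| + 1; have Mgt : 0 < M by rewrite /M; have := normr_ge0 M0; lra.
have eM : 0 < 2 * e / M by rewrite divr_gt0 // mulr_gt0.
have [q qP] := abs_approx_lim eM.
exists (2^-1 *: (b + M *: (q \Po (M^-1 *: b)))) => t t0 t1.
have bM : `|b.[t]| <= M.
  have := M0P t; rewrite t0 t1 => /(_ isT); rewrite /M.
  by have := ler_norm M0; lra.
have bt : `|M^-1 * b.[t]| <= 1.
  by rewrite normrM gtr0_norm ?invr_gt0 // mulrC ler_pdivrMr // mul1r.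
have := qP _ bt; rewrite !polyE horner_comp !polyE.
move: q.[_] => v; rewrite normrM gtr0_norm ?invr_gt0 //.
have -> : 2^-1 * (b.[t] + M * v) - Num.max 0 b.[t] =
  M / 2 * (v - M^-1 * `|b.[t]|).
  rewrite maxElt; case: (ltrP 0 b.[t]) => h.
    by rewrite gtr0_norm //; field; rewrite gt_eqF.
  by rewrite ler0_norm //; field; rewrite gt_eqF.
move=> h; rewrite normrM gtr0_norm; last by rewrite divr_gt0.
have -> : e = M / 2 * (2 * e / M) by field; rewrite gt_eqF.
by rewrite ler_pM2l // divr_gt0.
Qed.

Lemma sum_pos_part_approx n (c : nat -> R) (b : nat -> {poly R}) (e : R) : 0 < e ->
  exists q : {poly R}, forall t, -1 <= t -> t <= 1 ->
    `|q.[t] - \sum_(j < n) c j * Num.max 0 (b j).[t]| <= e.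
Proof.
elim: n e => [|n IHn] e e0.
  by exists 0 => t _ _; rewrite big_ord0 horner0 subrr normr0 ltW.
have [|q1 q1P] := IHn (e / 2); first by rewrite divr_gt0.
have c0 : 0 < `|c n| + 1 by have := normr_ge0 (c n); lra.
have [|q2 q2P] := @pos_part_approx (b n) (e / 2 / (`|c n| + 1)).
  by rewrite !divr_gt0.
exists (q1 + c n *: q2) => t t0 t1; rewrite big_ord_recr /= !polyE opprD addrACA -mulrBr.
apply: (le_trans (ler_normD _ _)).
have := q1P t t0 t1; have := q2P t t0 t1; rewrite normrM.
rewrite ler_pdivlMr // mulrDr mulr1 => h1 h2.
have := normr_ge0 (q2.[t] - Num.max 0 (b n).[t]); lra.
Qed.

End Approximation.

Section JacobiTail.
Variables (R : rcfType) (al be : nat).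
Hypotheses (hal : (al <= 1)%N) (hbe : (be <= 1)%N).
Implicit Types f g Y Z : {poly R}.
Local Notation w := (jweight R al be).
Local Notation ws := (jweight R (1 - al) (1 - be)).

(** [Z] is [Y] minus its projection. The Jacobi operator preserves degree bounds, so low degrees and
    tail are orthogonal for the energy too, and the tail has the smaller energy. *)
Lemma jacobi_tail N Y : exists Z : {poly R},
  (forall f, (size f <= N)%N -> ip w Z f = 0) /\ (size (Y - Z)%R <= N)%N /\
  (N ^ 2)%:R * ip w Z Z <= ip ws (w * Y)^`() (w * Y)^`().
Proof.
have [|t st tP] := @riesz R w (jweight_neq0 R al be) (@jweight_ge0 R al be) N (ip w Y).
  by move=> c g h; exact: ip_linear.
have Zo f : (size f <= N)%N -> ip w (Y - t) f = 0.
  by move=> sf; rewrite ipBl tP // subrr.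
exists (Y - t); split=> //; split; first by rewrite subKr.
apply: le_trans (jacobi_energy_ge hal hbe Zo) _.
have sT : (size (jacobi_op al be t) <= N)%N.
  apply/leq_sizeP => j lj; rewrite jacobi_op_coef ?nth_default ?mulr0 //.
    exact: leq_trans lj.
  exact: leqW (leq_trans st lj).
rewrite -!ip_jacobi_op //.
have YE : Y = 1 *: (Y - t) + t by rewrite scale1r subrK.
set Z := Y - t in YE Zo *; clearbody Z.
have Zt : ip w Z (jacobi_op al be t) = 0 by exact: Zo.
have tZ : ip w t (jacobi_op al be Z) = 0 by rewrite jacobi_op_sym // ipC.
have tt : 0 <= ip w t (jacobi_op al be t).
  by rewrite ip_jacobi_op //; apply: ip_ge0; exact: jweight_ge0.
rewrite YE jacobi_op_linear !scale1r !ipDl !ipDr Zt tZ; lra.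
Qed.
End JacobiTail.

(** The quarter is what allows two such terms to be absorbed into [A]. *)
Lemma sqr_sum_le (R : realFieldType) (x A C : R) : 0 <= A -> 0 <= C ->
  x ^+ 2 <= A * C -> x <= A / 4 + C.
Proof.
move=> A0 C0 H; have [x0|x0] := leP x 0; first lra.
rewrite -(ler_pXn2r (n := 2)) ?nnegrE //; [|lra|lra].
have := sqr_ge0 (A / 4 - C); lra.
Qed.

Lemma le_mul_of_eps (R : realFieldType) (a b C : R) : 0 <= C ->
  (forall e, 0 < e -> e <= 1 -> a <= b + e * C) -> a <= b.
Proof.
move=> C0 H; rewrite leNgt; apply/negP => ba.
have C1 : 0 < C + 1 by lra.
pose e := Num.min 1 ((a - b) / 2 / (C + 1)).
have e0 : 0 < e by rewrite lt_min ltr01 !divr_gt0 // subr_gt0.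
have e1 : e <= 1 by rewrite ge_min lexx.
have e2 : e * (C + 1) <= (a - b) / 2.
  by rewrite -ler_pdivlMr // ge_min lexx orbT.
have := H e e0 e1; lra.
Qed.

Lemma jweight_dvd (R : rcfType) (al be : nat) (f : {poly R}) :
  (al <= 1)%N -> (be <= 1)%N -> (al = 1%N -> f.[1] = 0) -> (be = 1%N -> f.[-1] = 0) ->
  exists g, f = jweight R al be * g.
Proof.
have fac (c : R) (h : {poly R}) : h.[c] = 0 -> exists g, h = ('X - c%:P) * g.
  by move=> /rootP /factor_theorem[g ->]; exists g; rewrite mulrC.
have eR : 1 - 'X = - ('X - 1%:P) :> {poly R} by rewrite opprB polyC1.
have eL : 1 + 'X = 'X - (-1)%:P :> {poly R} by rewrite polyCN opprK addrC polyC1.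
rewrite jweightE eR eL => hal hbe.
case: al hal => [|[]] // _; case: be hbe => [|[]] // _ f1 f2.
- by exists f; rewrite !expr0 !mul1r.
- by have [g ->] := fac _ _ (f2 erefl); exists g; rewrite expr0 expr1 mul1r.
- by have [g ->] := fac _ _ (f1 erefl); exists (- g); rewrite expr0 expr1 mulr1 mulrNN.
- have [g fE] := fac _ _ (f1 erefl).
  have [|h gE] := fac (-1) g.
    have := f2 erefl; rewrite fE !polyE => /eqP; rewrite mulf_eq0 => /orP[/eqP|/eqP//]; lra.
  by exists (- h); rewrite fE gE !expr1; ring.
Qed.

(** * Piecewise polynomials on the cells *)

Section Cells.
Variables (R : realType) (N : nat).
Hypothesis N0 : (0 < N)%N.
Local Notation x := (gl_point R N).

Definition cell i (f : {poly R}) : R := pint (x i) (x i.+1) f.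

Lemma cellD i f g : cell i (f + g) = cell i f + cell i g.
Proof. exact: pintD. Qed.

Lemma cellB i f g : cell i (f - g) = cell i f - cell i g.
Proof. exact: pintB. Qed.

Lemma cellZ i c f : cell i (c *: f) = c * cell i f.
Proof. exact: pintZ. Qed.

Lemma sum_diff (v : nat -> R) : \sum_(i < N) (v i.+1 - v i) = v N - v 0.
Proof. by rewrite -(big_mkord xpredT (fun i => v i.+1 - v i)) telescope_sumr. Qed.

Lemma sum_cell f : \sum_(i < N) cell i f = pint (-1) 1 f.
Proof. by rewrite (sum_diff (fun i => (primitive f).[x i])) gl_last // gl_first. Qed.

Lemma cell_len (i : 'I_N) : x i < x i.+1.
Proof. exact: gl_lt. Qed.

Lemma cell_itv (i : 'I_N) t : x i <= t -> t <= x i.+1 -> -1 <= t /\ t <= 1.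
Proof.
move=> xt tx; split.
  by apply: le_trans xt; rewrite gl_geN1 // ltnW.
by apply: le_trans tx _; rewrite gl_le1.
Qed.

Lemma cell_ge0 (i : 'I_N) f : (forall t, x i < t -> t < x i.+1 -> 0 <= f.[t]) -> 0 <= cell i f.
Proof. by move=> f0; apply: pint_ge0_oo => //; apply/ltW/cell_len. Qed.

Variables (al be : nat).
Local Notation w := (jweight R al be).

(** The [L^2(w)] product of the functions equal to [F i] and [G i] on cell [i]; constant families
    stand for genuine polynomials. *)
Definition pwip (F G : nat -> {poly R}) : R := \sum_(i < N) cell i (w * (F i * G i)).

Lemma pwip_ge0 F : 0 <= pwip F F.
Proof.
apply: sumr_ge0 => i _; apply: cell_ge0 => t /ltW xt /ltW tx.
have [t0 t1] := cell_itv xt tx.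
by rewrite !hornerM -expr2 mulr_ge0 ?sqr_ge0 // jweight_ge0.
Qed.

Lemma pwip_CS F G : pwip F G ^+ 2 <= pwip F F * pwip G G.
Proof.
apply: discr_le => t; have := pwip_ge0 (fun i => F i + t *: G i).
rewrite /pwip; congr (_ <= _).
rewrite !mulr_sumr -!big_split /=; apply: eq_bigr => i _.
by rewrite -!cellZ -!cellD; congr cell; rewrite -!mul_polyC !rmorphM /= rmorph_nat; ring.
Qed.

Lemma pwip_const f g : pwip (fun=> f) (fun=> g) = ip w f g.
Proof. exact: sum_cell. Qed.

End Cells.

(** * Dual norm of the residual *)

Section Residual.
Variables (R : realType) (N al be : nat).
Hypotheses (N0 : (0 < N)%N) (hal : (al <= 1)%N) (hbe : (be <= 1)%N).
Local Notation x := (gl_point R N).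
Local Notation cell := (@cell R N).
Local Notation w := (jweight R al be).
Local Notation ws := (jweight R (1 - al) (1 - be)).
(** In the application [g i] is [u - V] on cell [i] and [z] lists its nodal values. *)
Variables (g : nat -> {poly R}) (z : nat -> R).
Hypothesis gl : forall i, (i < N)%N -> (g i).[x i] = z i.
Hypothesis gr : forall i, (i < N)%N -> (g i).[x i.+1] = z i.+1.
Hypothesis g_orth : forall f : {poly R}, (size f <= N)%N ->
  pwip N al be (fun i => (g i)^`()) (fun=> f) = 0.
Hypothesis z_left : be = 0%N -> z 0 = 0.
Hypothesis z_right : al = 0%N -> z N = 0.
Hypothesis g_mean : al = 1%N -> be = 1%N -> \sum_(i < N) cell i (g i) = 0.
Local Notation E := (pwip N al be (fun i => (g i)^`()) (fun i => (g i)^`())).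

(** Writing [y = - (w * Y)^'], integration by parts moves the derivative to [g]; orthogonality
    replaces [Y] by its tail, whose norm gains [1 / N]. The constant [c] makes the primitive vanish
    where [w] does; if [w] vanishes at both ends, this requires [y] to have mean zero. *)
Let dual_bound_mean (y : {poly R}) :
  (al = 1%N -> be = 1%N -> pint (-1) 1 y = 0) ->
  (N ^ 2)%:R * (\sum_(i < N) cell i (g i * y)) ^+ 2 <= E * ip ws y y.
Proof.
move=> ym.
have [c [c1 c2]] : exists c, (al = 1%N -> (primitive y).[1] = c) /\
    (be = 1%N -> (primitive y).[-1] = c).
  case: al hal ym => [|[]] // _ ym.
    by exists (primitive y).[-1].
  exists (primitive y).[1]; split=> // b1; apply/esym/eqP; rewrite -subr_eq0.
  by rewrite -/(pint _ _ _) ym.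
have [||Y YE] := @jweight_dvd R al be (c%:P - primitive y) hal hbe.
- by move=> a1; rewrite !polyE c1 // subrr.
- by move=> b1; rewrite !polyE c2 // subrr.
have dY : (w * Y)^`() = - y by rewrite -YE derivB derivC sub0r deriv_primitive.
have sumE : \sum_(i < N) cell i (g i * y) = pwip N al be (fun i => (g i)^`()) (fun=> Y).
  transitivity (\sum_(i < N) (cell i (w * ((g i)^`() * Y)) -
      (z i.+1 * (w * Y).[x i.+1] - z i * (w * Y).[x i]))).
    apply: eq_bigr => i _; rewrite /cell.
    have -> : g i * y = - ((w * Y)^`() * g i) by rewrite dY; ring.
    rewrite pintN pint_by_parts gl // gr //.
    have -> : w * Y * (g i)^`() = w * ((g i)^`() * Y) by ring.
    ring.
  rewrite sumrB (sum_diff _ (fun i => z i * (w * Y).[x i])) gl_last // gl_first //.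
  (* At each end either [w] vanishes or [z] does. *)
  suff [-> ->] : z N * (w * Y).[1] = 0 /\ z 0 * (w * Y).[-1] = 0 by rewrite !subr0.
  split.
    case: al hal z_right c1 YE => [|[]] // _ zr c1' <-; first by rewrite zr ?mul0r.
    by rewrite !polyE c1' // subrr mulr0.
  case: be hbe z_left c2 YE => [|[]] // _ zl c2' <-; first by rewrite zl ?mul0r.
  by rewrite !polyE c2' // subrr mulr0.
have [Z [_ [sZ ZE]]] := jacobi_tail hal hbe N Y.
rewrite sumE.
have -> : pwip N al be (fun i => (g i)^`()) (fun=> Y) = pwip N al be (fun i => (g i)^`()) (fun=> Z).
  apply/eqP; rewrite -subr_eq0 -(g_orth sZ) /pwip -sumrB; apply/eqP.
  by apply: eq_bigr => i _; rewrite /= -cellB; congr cell; ring.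
have := pwip_CS N0 al be (fun i => (g i)^`()) (fun=> Z); rewrite (pwip_const N0) => CS.
have n2 : (0 : R) <= (N ^ 2)%:R by rewrite ler0n.
apply: le_trans (ler_wpM2l n2 CS) _.
rewrite mulrCA ler_wpM2l //; first exact: pwip_ge0.
apply: le_trans ZE _; rewrite dY /ip mulrNN //.
Qed.

(** If [al = be = 1], then [ws = 1] and [g] has mean zero: removing the mean of [y] leaves the
    pairing unchanged and does not increase the norm. *)
Lemma dual_bound (y : {poly R}) :
  (N ^ 2)%:R * (\sum_(i < N) cell i (g i * y)) ^+ 2 <= E * ip ws y y.
Proof.
have [/andP[/eqP a1 /eqP b1]|nab] := boolP ((al == 1%N) && (be == 1%N)); last first.
  by apply: dual_bound_mean => a1 b1; rewrite a1 b1 in nab.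
pose m := pint (-1) 1 y / 2.
have := @dual_bound_mean (y - m%:P) _.
have -> : \sum_(i < N) cell i (g i * (y - m%:P)) = \sum_(i < N) cell i (g i * y).
  transitivity (\sum_(i < N) (cell i (g i * y) - m * cell i (g i))).
    by apply: eq_bigr => i _; rewrite -cellZ -cellB; congr cell; rewrite -mul_polyC; ring.
  by rewrite sumrB -mulr_sumr g_mean // mulr0 subr0.
move=> H; apply: le_trans (H _) _.
  by move=> _ _; rewrite pintB pint_const /m; field.
rewrite ler_wpM2l ?pwip_ge0 // a1 b1 subnn jweight00 /ip !mul1r.
have -> : (y - m%:P) * (y - m%:P) = y * y - (2 * m) *: y + (m ^+ 2)%:P.
  by rewrite -mul_polyC; ring.
rewrite pintD pintB pintZ pint_const.
have -> : pint (-1) 1 y = 2 * m by rewrite /m; field.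
have := sqr_ge0 m; lra.
Qed.

Let K := E / (N ^ 2)%:R.

Let NN_gt0 : (0 : R) < (N ^ 2)%:R.
Proof. by rewrite ltr0n expn_gt0 N0. Qed.

Let K_ge0 : 0 <= K.
Proof. by rewrite divr_ge0 // pwip_ge0. Qed.

Lemma ws_le4 t : -1 <= t -> t <= 1 -> ws.[t] <= 4.
Proof.
move=> t0 t1; rewrite horner_jweight.
case: al hal => [|[]] // _; case: be hbe => [|[]] // _;
  rewrite /= ?expr1 ?expr0; nra.
Qed.

(* Passing to the limit in [dual_bound] along polynomials converging uniformly to
   the function equal to [q j] on [[s j, x j.+1]] and to [0] on [[x j, s j]]. *)
Lemma dual_bound_pw (s : nat -> R) (q : nat -> {poly R}) :
  (forall j, (j < N)%N -> x j <= s j /\ s j <= x j.+1) ->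
  (forall e, 0 < e -> exists Y : {poly R}, forall j, (j < N)%N ->
     (forall t, x j <= t -> t <= s j -> `|Y.[t]| <= e) /\
     (forall t, s j <= t -> t <= x j.+1 -> `|Y.[t] - (q j).[t]| <= e)) ->
  (\sum_(j < N) pint (s j) (x j.+1) (g j * q j)) ^+ 2 <=
  K * \sum_(j < N) pint (s j) (x j.+1) (ws * (q j * q j)).
Proof.
move=> sP apx.
have [B [B0 gB]] : exists B, 0 <= B /\ forall (j : 'I_N) t, -1 <= t -> t <= 1 ->
    `|(g j).[t]| <= B /\ `|(q j).[t]| <= B.
  pose bd (f : {poly R}) := `|projT1 (poly_itv_bound f (-1) 1)|.
  have bdP f t : -1 <= t -> t <= 1 -> `|f.[t]| <= bd f.
    move=> t0 t1; rewrite /bd; case: poly_itv_bound => M /= /(_ t); rewrite t0 t1 => /(_ isT) H.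
    exact: le_trans H (ler_norm _).
  exists (\sum_(j < N) (bd (g j) + bd (q j))); split.
    by apply: sumr_ge0 => j _; rewrite addr_ge0 ?normr_ge0.
  move=> j t t0 t1; rewrite (bigD1 j) //=.
  have r0 : 0 <= \sum_(i < N | i != j) (bd (g i) + bd (q i)).
    by apply: sumr_ge0 => i _; rewrite addr_ge0 ?normr_ge0.
  have b1 := bdP (g j) t t0 t1; have b2 := bdP (q j) t t0 t1.
  have n1 : 0 <= bd (g j) by exact: normr_ge0.
  have n2 : 0 <= bd (q j) by exact: normr_ge0.
  by split; lra.
set Sq := \sum_(j < N) _; set Eq := \sum_(j < N) _.
have lenE : \sum_(j < N) (x j.+1 - x j) = 2.
  by rewrite (sum_diff _ x) gl_last // gl_first //; ring.
(* Passing to [Y] costs at most [2 B e] in the pairing and, as [ws <= 4] on an interval of length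
   [2], [8 (2 B + 1) e] in the norm; the constant collects both after squaring. *)
apply: (@le_mul_of_eps _ _ _ (K * (8 * (2 * B + 1)) + (4 * B * (`|Sq| + 2 * B) + 4 * B ^+ 2))).
  have h1 : 0 <= K * (8 * (2 * B + 1)) by rewrite mulr_ge0 ?K_ge0 //; lra.
  have h2 : 0 <= B * `|Sq| by rewrite mulr_ge0.
  have := sqr_ge0 B; lra.
move=> e e0 e1; have [Y YP] := apx e e0.
have := dual_bound Y; rewrite /ip -(sum_cell N0).
set S := \sum_(i < N) cell i (g i * Y); set EY := \sum_(i < N) cell i _ => H.
have {}H : S ^+ 2 <= K * EY.
  by rewrite /K mulrAC ler_pdivlMr // mulrC.
have hS : `|S - Sq| <= e * (2 * B).
  have -> : e * (2 * B) = \sum_(j < N) (e * B * (x j.+1 - x j)).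
    by rewrite -mulr_sumr lenE; ring.
  rewrite /S /Sq -sumrB; apply: (le_trans (ler_norm_sum _ _ _)); apply: ler_sum => j _.
  have [xs sx] := sP j (ltn_ord j); have [Y0 Y1] := YP j (ltn_ord j).
  rewrite /cell (pint_split (s j)) -addrA -pintB -mulrBr.
  have -> : x j.+1 - x j = (s j - x j) + (x j.+1 - s j) by ring.
  rewrite (mulrDr (e * B)) (le_trans (ler_normD _ _)) // lerD //;
    apply: ler_norm_pint => // t at_ tb; rewrite hornerM normrM mulrC.
    have [t0 t1] := cell_itv N0 at_ (le_trans tb sx).
    by apply: ler_pM; rewrite ?normr_ge0 ?Y0 //; case: (gB j t t0 t1).
  have [t0 t1] := cell_itv N0 (le_trans xs at_) tb.
  by apply: ler_pM; rewrite ?normr_ge0 ?hornerD ?hornerN ?Y1 //; case: (gB j t t0 t1).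
have hE : EY <= Eq + e * (8 * (2 * B + 1)).
  have -> : e * (8 * (2 * B + 1)) = \sum_(j < N) (e * (4 * (2 * B + 1)) * (x j.+1 - x j)).
    by rewrite -mulr_sumr lenE; ring.
  rewrite /EY /Eq -big_split; apply: ler_sum => j _ /=.
  have [xs sx] := sP j (ltn_ord j); have [Y0 Y1] := YP j (ltn_ord j).
  rewrite /cell (pint_split (s j)) -lerBlDl -addrA -pintB.
  have -> : x j.+1 - x j = (s j - x j) + (x j.+1 - s j) by ring.
  rewrite (mulrDr (e * (4 * (2 * B + 1)))) lerD // -pint_const; apply: ler_pint => // t at_ tb;
    rewrite hornerC.
    have [t0 t1] := cell_itv N0 at_ (le_trans tb sx).
    have := Y0 t at_ tb; rewrite !hornerM => Yt.
    have w4 := ws_le4 t0 t1; have w0 := jweight_ge0 (1 - al) (1 - be) t0 t1.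
    have e2 : e * e <= e by rewrite ler_piMr // ltW.
    have y2 : Y.[t] * Y.[t] <= e.
      apply: le_trans e2; rewrite -!expr2 -[Y.[t] ^+ 2]real_normK ?num_real //.
      by rewrite ler_pXn2r ?nnegrE // ltW.
    have yy : 0 <= Y.[t] * Y.[t] by rewrite -expr2 sqr_ge0.
    have : ws.[t] * (Y.[t] * Y.[t]) <= 4 * e by rewrite ler_pM.
    have : 0 <= e * B by rewrite mulr_ge0 // ltW.
    lra.
  have [t0 t1] := cell_itv N0 (le_trans xs at_) tb.
  have [_ qB] := gB j t t0 t1; have := Y1 t at_ tb.
  have w4 := ws_le4 t0 t1; have w0 := jweight_ge0 (1 - al) (1 - be) t0 t1.
  rewrite hornerD hornerN !hornerM -mulrBr => Yq.
  have -> : Y.[t] * Y.[t] - (q j).[t] * (q j).[t] =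
    (Y.[t] - (q j).[t]) * ((Y.[t] - (q j).[t]) + 2 * (q j).[t]) by ring.
  apply: (le_trans (ler_norm _)); rewrite 2!normrM (ger0_norm w0) mulrCA.
  apply: ler_pM => //; first by rewrite mulr_ge0.
  apply: ler_pM => //; apply: (le_trans (ler_normD _ _)).
  rewrite normrM (ger0_norm (ler0n _ 2)); lra.
have b0 := K_ge0.
have S1 : `|S| <= `|Sq| + e * (2 * B).
  by have := ler_normD (S - Sq) Sq; rewrite subrK; lra.
have eB : e * (2 * B) <= 2 * B by rewrite ler_piMl //; lra.
have eB0 : 0 <= e * (2 * B) by rewrite mulr_ge0 //; lra.
have Sq1 : `|Sq| <= `|S| + e * (2 * B).
  by have := ler_normB S (S - Sq); rewrite opprB addrCA subrr addr0; lra.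
have sq2 : Sq ^+ 2 <= (`|S| + e * (2 * B)) ^+ 2.
  by rewrite -[Sq ^+ 2]real_normK ?num_real // ler_pXn2r ?nnegrE ?addr_ge0.
have S2 : `|S| ^+ 2 = S ^+ 2 by rewrite real_normK ?num_real.
have KE : K * EY <= K * Eq + K * (e * (8 * (2 * B + 1))).
  by rewrite -mulrDr ler_wpM2l.
have h1 : `|S| * (e * (2 * B)) <= (`|Sq| + 2 * B) * (e * (2 * B)).
  by rewrite ler_wpM2r //; lra.
have h2 : (e * (2 * B)) * (e * (2 * B)) <= (2 * B) * (e * (2 * B)).
  by rewrite ler_wpM2r.
lra.
Qed.
End Residual.

(** * Testing the residual with bumps *)

Section InteriorEstimate.
Variables (R : realType) (N al be : nat).
Hypotheses (N0 : (0 < N)%N) (hal : (al <= 1)%N) (hbe : (be <= 1)%N).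
Local Notation x := (gl_point R N).
Local Notation om := (gl_weight R N).
Local Notation cell := (@cell R N).
Local Notation w := (jweight R al be).
Local Notation ws := (jweight R (1 - al) (1 - be)).
Local Notation lam := ((N * N.+1)%:R : R).

(** Cell [j] serves its right node [x j.+1]; by [gl_gap_ge] a hundredth of the weight of that node
    fits into the cell. In the last cell the node is the endpoint [1] and the width is [0]; the bump
    is then zero because [6 / 0 = 0]. *)
Definition bump_width j : R := if (j.+1 < N)%N then om j.+1 / 100 else 0.
Local Notation de := bump_width.

Definition bump_left j : R := x j.+1 - de j.
Local Notation s := bump_left.

(** The factor [6] makes the integral over the support equal to the width. *)
Definition bump j : {poly R} :=
  (6 / de j ^+ 2) *: (('X - (s j)%:P) * ((x j.+1)%:P - 'X)).
Local Notation b := bump.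

Lemma bump_width_ge0 j : 0 <= de j.
Proof.
rewrite /de; case: ifP => // jN; rewrite divr_ge0 // ltW //.
by rewrite gl_weight_gt0 // ltnW.
Qed.

Lemma bump_left_bounds j : (j < N)%N -> x j <= s j /\ s j <= x j.+1.
Proof.
move=> jN; split; last by rewrite gerBl bump_width_ge0.
rewrite /s /de; case: ifP => [j1|_]; last by rewrite subr0 gl_le.
by have := gl_gap_ge R N0 j1; lra.
Qed.

Lemma bump_width_le j : (j < N)%N -> 100 * de j <= 32 * (1 - x j.+1 ^+ 2).
Proof.
move=> jN; have x0 := gl_geN1 R N0 jN; have x1 := gl_le1 R N0 jN.
rewrite /de; case: ifP => [j1|_]; last by rewrite mulr0 mulr_ge0 //; nra.
by have := gl_weight_le R N0 (ltn0Sn j) j1; lra.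
Qed.

Lemma bump_width_sqr j : (j < N)%N ->
  lam * (100 * de j) ^+ 2 <= 512 * (1 - x j.+1 ^+ 2).
Proof.
move=> jN; have x0 := gl_geN1 R N0 jN; have x1 := gl_le1 R N0 jN.
rewrite /de; case: ifP => [j1|_].
  by rewrite (mulrC 100) divfK ?gl_weight_sqr ?pnatr_eq0.
rewrite mulr0 expr0n mulr0; have := mulr_ge0 (_ : 0 <= 1 - x j.+1) (_ : 0 <= 1 + x j.+1).
rewrite subr_ge0 x1 -lerBlDl sub0r x0 => /(_ isT isT); lra.
Qed.

Lemma horner_bump j t : (b j).[t] = 6 / de j ^+ 2 * ((t - s j) * (x j.+1 - t)).
Proof. by rewrite /b !polyE. Qed.

Lemma bump_le0 j t : (j < N)%N -> t <= s j \/ x j.+1 <= t -> (b j).[t] <= 0.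
Proof.
move=> jN ht; have [_ sx] := bump_left_bounds jN.
rewrite horner_bump mulr_ge0_le0 //; first by rewrite divr_ge0 ?sqr_ge0.
case: ht => ht; [rewrite mulr_le0_ge0 | rewrite mulr_ge0_le0]; rewrite ?subr_ge0 ?subr_le0 //.
  exact: le_trans ht sx.
exact: le_trans sx ht.
Qed.

Lemma bump_ge0 j t : s j <= t -> t <= x j.+1 -> 0 <= (b j).[t].
Proof.
move=> st tx; rewrite horner_bump mulr_ge0 //; first by rewrite divr_ge0 ?sqr_ge0.
by rewrite mulr_ge0 ?subr_ge0.
Qed.

Lemma bump_le j t : s j <= t -> t <= x j.+1 -> (b j).[t] <= 3 / 2.
Proof.
move=> st tx; rewrite horner_bump.
have [d0|d0] := eqVneq (de j) 0; first by rewrite d0 expr0n invr0 mulr0 mul0r; lra.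
have d1 : 0 < de j ^+ 2 by rewrite exprn_gt0 // lt_neqAle eq_sym d0 bump_width_ge0.
rewrite mulrAC ler_pdivrMr //.
have sE : s j = x j.+1 - de j by [].
have := sqr_ge0 (2 * t - s j - x j.+1); rewrite sE; lra.
Qed.

Lemma pint_bump j : pint (s j) (x j.+1) (b j) = de j.
Proof.
have [d0|d0] := eqVneq (de j) 0; first by rewrite /s d0 subr0 pint_point.
pose u : {poly R} := 'X - (s j)%:P.
have -> : b j = (de j ^- 2 *: ((3 * de j) *: u ^+ 2 - 2 *: u ^+ 3))^`().
  rewrite derivZ derivB !derivZ !deriv_exp derivB derivX derivC subr0 !mul1r /=.
  have -> : b j = (6 / de j ^+ 2) *: (u * ((de j)%:P - u)).
    rewrite /b /u /s; congr (_ *: (_ * _)); rewrite polyCB; ring.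
  by rewrite -!mul_polyC; ring.
rewrite pint_deriv !polyE subrr !expr0n /= (_ : x j.+1 - s j = de j); last by rewrite /s; ring.
by field.
Qed.

Lemma pint_bump_sqr j : (j < N)%N -> pint (s j) (x j.+1) (b j ^+ 2) <= 3 / 2 * de j.
Proof.
move=> jN; have [_ sx] := bump_left_bounds jN.
rewrite -(pint_bump j) -pintZ; apply: ler_pint => // t st tx.
rewrite hornerZ horner_exp expr2 ler_wpM2r ?bump_ge0 ?bump_le //.
Qed.

(** The width is at most [0.64] times the distance from [x j.+1] to either endpoint, so each factor
    of the weights varies little on the support. *)
Lemma bump_weight j t : (j < N)%N -> s j <= t -> t <= x j.+1 ->
  w.[x j.+1] <= 3 * w.[t] /\ ws.[t] <= 2 * ws.[x j.+1].
Proof.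
move=> jN st tx; have := bump_width_le jN.
have x0 := gl_geN1 R N0 jN; have x1 := gl_le1 R N0 jN.
move: st; rewrite /s !horner_jweight => st h.
have h1 : 1 - x j.+1 ^+ 2 <= 2 * (1 - x j.+1) by nra.
have h2 : 1 - x j.+1 ^+ 2 <= 2 * (1 + x j.+1) by nra.
move: (x j.+1) (de j) x0 x1 st tx h h1 h2 => y e x0 x1 st tx h h1 h2.
case: al hal => [|[]] // _; case: be hbe => [|[]] // _;
  rewrite /= ?expr1 ?expr0 ?mulr1 ?mul1r; split; try lra; nra.
Qed.

(** The positive part of a bump vanishes off its support, so the approximated sum of positive parts
    has a single active term at each point. *)
Lemma bump_sum_approx (c : nat -> R) (e : R) : 0 < e ->
  exists Y : {poly R}, forall j, (j < N)%N ->
     (forall t, x j <= t -> t <= s j -> `|Y.[t]| <= e) /\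
     (forall t, s j <= t -> t <= x j.+1 -> `|Y.[t] - (c j *: b j).[t]| <= e).
Proof.
move=> e0; have [Y YP] := sum_pos_part_approx N c b e0.
have b0 (k : 'I_N) j t : (j < N)%N -> k != j :> nat -> x j <= t -> t <= x j.+1 ->
    Num.max 0 (b k).[t] = 0.
  move=> jN kj xt tx; apply/max_idPl; apply: bump_le0 => //.
  have [sk _] := bump_left_bounds (ltn_ord k).
  case: (ltngtP k j) kj => // lt _; [right | left].
    by apply: le_trans xt; rewrite gl_le // ltnW.
  apply: le_trans tx (le_trans _ sk); rewrite gl_le // ltnW //.
exists Y => j jN; have [xs sx] := bump_left_bounds jN; split=> t h1 h2.
  have [t0 t1] := cell_itv N0 (i := Ordinal jN) h1 (le_trans h2 sx).
  have := YP t t0 t1; rewrite big1 ?subr0 // => k _.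
  have [kj|kj] := eqVneq (k : nat) j.
    by rewrite kj (max_idPl _) ?mulr0 //; apply: bump_le0 => //; left.
  by rewrite (b0 k j t) ?mulr0 // (le_trans h2 sx).
have [t0 t1] := cell_itv N0 (i := Ordinal jN) (le_trans xs h1) h2.
have := YP t t0 t1; rewrite (bigD1 (Ordinal jN)) //= big1 => [|k kj].
  have -> : Num.max 0 (b j).[t] = (b j).[t] by apply/max_idPr; exact: bump_ge0.
  by rewrite addr0 (hornerZ (c j)).
by rewrite (b0 k j t) ?mulr0 // (le_trans xs h1).
Qed.

Variables (g : nat -> {poly R}) (z d : nat -> R).
Hypothesis gl : forall i, (i < N)%N -> (g i).[x i] = z i.
Hypothesis gr : forall i, (i < N)%N -> (g i).[x i.+1] = z i.+1.
Hypothesis g_orth : forall f : {poly R}, (size f <= N)%N ->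
  pwip N al be (fun i => (g i)^`()) (fun=> f) = 0.
Hypothesis z_left : be = 0%N -> z 0 = 0.
Hypothesis z_right : al = 0%N -> z N = 0.
Hypothesis g_mean : al = 1%N -> be = 1%N -> \sum_(i < N) cell i (g i) = 0.
Hypothesis zd : forall i, (i <= N)%N -> z i = ws.[x i] * d i.
Local Notation E := (pwip N al be (fun i => (g i)^`()) (fun i => (g i)^`())).

Let ws_ge0 j : (j < N)%N -> 0 <= ws.[x j.+1].
Proof. by move=> jN; rewrite jweight_ge0 ?gl_geN1 ?gl_le1. Qed.

(** The error made in the test with bump [j] by replacing [g j] with its value at the right node. *)
Let dev j : R := 100 * pint (s j) (x j.+1) (((z j.+1)%:P - g j) * b j).

Let dev_sqr j : (j < N)%N ->
  dev j ^+ 2 <= (100 * de j * ws.[x j.+1]) * (24 / lam * cell j (w * ((g j)^`() * (g j)^`()))).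
Proof.
move=> jN; have [xs sx] := bump_left_bounds jN; have d0 := bump_width_ge0 j.
have l0 := lam_gt0 R N0.
set G := (g j)^`(); set y := x j.+1.
have xt0 := gl_geN1 R N0 jN; have xt1 := gl_le1 R N0 jN.
have wint : 0 <= pint (s j) y (w * (G * G)).
  apply: pint_ge0 => // t st tx.
  have [t0 t1] := cell_itv N0 (i := Ordinal jN) (le_trans xs st) tx.
  by rewrite !hornerM -expr2 mulr_ge0 ?sqr_ge0 ?jweight_ge0.
have sub : pint (s j) y (w * (G * G)) <= cell j (w * (G * G)).
  rewrite /cell (pint_split (s j) (x j)) lerDr; apply: pint_ge0 => // t xt ts.
  have [t0 t1] := cell_itv N0 (i := Ordinal jN) xt (le_trans ts sx).
  by rewrite !hornerM -expr2 mulr_ge0 ?sqr_ge0 ?jweight_ge0.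
have CS (u v : R) (p q : {poly R}) : u <= v ->
    pint u v (p * q) ^+ 2 <= pint u v (p ^+ 2) * pint u v (q ^+ 2).
  move=> uv; apply: discr_le => t; rewrite -!pintZ -!pintD.
  have -> : p ^+ 2 + (2 * t) *: (p * q) + t ^+ 2 *: q ^+ 2 = (p + t *: q) ^+ 2.
    by rewrite -!mul_polyC; ring.
  by apply: pint_ge0 => // r _ _; rewrite horner_exp sqr_ge0.
have G2 : 0 <= pint (s j) y (G ^+ 2).
  by apply: pint_ge0 => // t _ _; rewrite horner_exp sqr_ge0.
(* Cauchy-Schwarz for [g j] between [t] and the node bounds the difference pointwise, then over a
   support of length [de j]. *)
have h2 : pint (s j) y (((z j.+1)%:P - g j) ^+ 2) <= de j ^+ 2 * pint (s j) y (G ^+ 2).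
  have -> : de j ^+ 2 * pint (s j) y (G ^+ 2) = pint (s j) y (de j * pint (s j) y (G ^+ 2))%:P.
    by rewrite pint_const /y /s; ring.
  apply: ler_pint => // t st tx; rewrite hornerC horner_exp hornerD hornerN hornerC -gr //.
  have := CS t y 1 G tx; rewrite mul1r pint_deriv expr1n -polyC1 pint_const mul1r => H.
  apply: le_trans H _; apply: ler_pM => //.
  - by rewrite subr_ge0.
  - by apply: pint_ge0 => // r _ _; rewrite horner_exp sqr_ge0.
  - by move: st; rewrite /s -/y; lra.
  - rewrite (pint_split t (s j)) lerDr; apply: pint_ge0 => // r _ _.
    by rewrite horner_exp sqr_ge0.
have h3 : w.[y] * pint (s j) y (G ^+ 2) <= 3 * pint (s j) y (w * (G * G)).
  rewrite -!pintZ; apply: ler_pint => // t st tx.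
  have [wt _] := bump_weight jN st tx.
  by rewrite !hornerZ !hornerM -expr2 [X in _ <= X]mulrA ler_wpM2r ?sqr_ge0.
have wws : w.[y] * ws.[y] = 1 - y ^+ 2.
  by rewrite -hornerM jweight_dual // !polyE.
have dsq := bump_width_sqr jN; rewrite -/y -wws in dsq.
have w0 := ws_ge0 jN; rewrite -/y in w0.
rewrite /dev exprMn -/y.
have h4 : pint (s j) y (((z j.+1)%:P - g j) * b j) ^+ 2 <=
    de j ^+ 2 * pint (s j) y (G ^+ 2) * (3 / 2 * de j).
  apply: le_trans (CS _ _ _ _ sx) _; apply: ler_pM => //; last exact: pint_bump_sqr.
  + by apply: pint_ge0 => // t _ _; rewrite horner_exp sqr_ge0.
  + by apply: pint_ge0 => // t _ _; rewrite horner_exp sqr_ge0.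
apply: le_trans (ler_wpM2l (sqr_ge0 _) h4) _.
move: wint sub G2 h3; set IG := pint _ _ (G ^+ 2); set IW := pint _ _ (w * _).
set C := cell _ _ => wint sub G2 h3.
rewrite -(ler_pM2l l0).
have h5 : lam * (100 * de j) ^+ 2 * (de j * IG) <= 512 * (w.[y] * ws.[y]) * (de j * IG).
  by rewrite ler_wpM2r // mulr_ge0.
have h6 : w.[y] * IG * (ws.[y] * de j) <= 3 * IW * (ws.[y] * de j).
  by rewrite ler_wpM2r // mulr_ge0.
have h7 : IW * (ws.[y] * de j) <= C * (ws.[y] * de j).
  by rewrite ler_wpM2r // mulr_ge0.
have -> : lam * (100 * de j * ws.[y] * (24 / lam * C)) = 2400 * (C * (ws.[y] * de j)).
  by have := lt0r_neq0 l0; move: ((N * N.+1)%:R : R) => l l1; field.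
have := mulr_ge0 wint (mulr_ge0 w0 d0).
move: (de j) (lam) w.[y] ws.[y] h5 h6 h7 => e l u v; lra.
Qed.

(** Twice [300 + 24]: [300] from the norm of the combined bumps, [24] from the deviations, doubled
    by absorbing [A / 2]. *)
Definition interior_const : R := 18 * 36.

(** At interior nodes [100 * de j] is the quadrature weight, so [A] is the interior part of the
    quadrature sum. Testing with the bumps scaled by [100 * d j.+1] recovers [A] up to the
    deviations; each of the two contributions is at most [A / 4] plus a multiple of [E]. *)
Lemma interior_estimate :
  \sum_(j < N) 100 * de j * ws.[x j.+1] * d j.+1 ^+ 2 <=
  interior_const / (N ^ 2)%:R * E.
Proof.
set A := \sum_(j < N) _.
pose q j := (100 * d j.+1) *: b j.
have := dual_bound_pw N0 hal hbe gl gr g_orth z_left z_right g_mean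
  bump_left_bounds (bump_sum_approx (fun j => 100 * d j.+1)).
set Sq := \sum_(j < N) pint _ _ _; set Eq := \sum_(j < N) pint _ _ _; set K := E / _ => H.
have E0 : 0 <= E by exact: pwip_ge0.
have NN : (0 : R) < (N ^ 2)%:R by rewrite ltr0n expn_gt0 N0.
have K0 : 0 <= K by rewrite divr_ge0 // ltW.
have A0 : 0 <= A.
  apply: sumr_ge0 => j _; rewrite mulr_ge0 ?sqr_ge0 // mulr_ge0 ?ws_ge0 //.
  by rewrite mulr_ge0 // bump_width_ge0.
have EqA : Eq <= 300 * A.
  rewrite /Eq /A mulr_sumr; apply: ler_sum => j _.
  have [_ sx] := bump_left_bounds (ltn_ord j).
  have -> : ws * ((100 * d j.+1) *: b j * ((100 * d j.+1) *: b j)) =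
    ((100 * d j.+1) ^+ 2) *: (ws * b j ^+ 2) by rewrite -!mul_polyC; ring.
  rewrite pintZ.
  have : pint (s j) (x j.+1) (ws * b j ^+ 2) <= 2 * ws.[x j.+1] * pint (s j) (x j.+1) (b j ^+ 2).
    rewrite -pintZ; apply: ler_pint => // t st tx.
    have [_ wt] := bump_weight (ltn_ord j) st tx.
    by rewrite hornerM hornerZ ler_wpM2r // horner_exp sqr_ge0.
  have := ler_wpM2l (_ : 0 <= 2 * ws.[x j.+1]) (pint_bump_sqr (ltn_ord j)).
  rewrite mulr_ge0 ?ws_ge0 // => /(_ isT) h1 h2; have {h1 h2}h := le_trans h2 h1.
  have -> : 300 * (100 * de j * ws.[x j.+1] * d j.+1 ^+ 2) =
    (100 * d j.+1) ^+ 2 * (2 * ws.[x j.+1] * (3 / 2 * de j)) by field.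
  by rewrite ler_wpM2l ?sqr_ge0.
have Sq1 : Sq <= A / 4 + 300 * K.
  apply: sqr_sum_le => //; first by rewrite mulr_ge0.
  by apply: le_trans H _; have := ler_wpM2l K0 EqA; move: (K) (A) => k a; lra.
have AE : A = Sq + \sum_(j < N) d j.+1 * dev j.
  rewrite /A /Sq -big_split; apply: eq_bigr => j _ /=.
  rewrite -{1}(pint_bump j) /dev.
  have -> : ((z j.+1)%:P - g j) * b j = z j.+1 *: b j - g j * b j.
    by rewrite -mul_polyC; ring.
  rewrite -(scalerAr (100 * d j.+1)) (pintZ _ _ (100 * d j.+1)) pintB.
  by rewrite (pintZ _ _ (z j.+1)) zd //; ring.
have dev_le : \sum_(j < N) d j.+1 * dev j <= A / 4 + 24 / (N ^ 2)%:R * E.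
  have l0 := lam_gt0 R N0.
  apply: (@le_trans _ _ (A / 4 + 24 / lam * E)); last first.
    rewrite lerD2l ler_wpM2r // ler_pM2l // lef_pV2 ?posrE // ler_nat -mulnn leq_pmul2l //.
  rewrite /A mulr_suml /pwip mulr_sumr -big_split; apply: ler_sum => j _ /=.
  have := dev_sqr (ltn_ord j); set B := 100 * _ * _; set C := _ * cell _ _ => hd.
  have B0 : 0 <= B by rewrite !mulr_ge0 ?ws_ge0 ?bump_width_ge0.
  have C0 : 0 <= C.
    rewrite mulr_ge0 ?divr_ge0 ?(ltW l0) //; apply: cell_ge0 => // t xt tx.
    have [t0 t1] := cell_itv N0 (ltW xt) (ltW tx).
    by rewrite !hornerM -expr2 mulr_ge0 ?sqr_ge0 ?jweight_ge0.
  apply: sqr_sum_le => //; first by rewrite mulr_ge0 ?sqr_ge0.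
  have := ler_wpM2l (sqr_ge0 (d j.+1)) hd; rewrite [(_ * dev j) ^+ 2]exprMn.
  by rewrite (_ : B * d j.+1 ^+ 2 * C = d j.+1 ^+ 2 * (B * C)); last by ring.
have : A <= A / 2 + (300 * K + 24 / (N ^ 2)%:R * E) by rewrite {1}AE; lra.
by rewrite /K /interior_const; move: E0 => _; lra.
Qed.

End InteriorEstimate.

(** * The two energy inequalities *)

Section Traces.
Variables (R : realType) (N al be : nat).
Hypotheses (N1 : (1 < N)%N) (hal : (al <= 1)%N) (hbe : (be <= 1)%N).
Implicit Types (V f : {poly R}).
Local Notation x := (gl_point R N).
Local Notation w := (jweight R al be).
Local Notation lam := ((N * N.+1)%:R : R).

Let N0 : (0 < N)%N. Proof. exact: ltnW. Qed.

(** [72] bounds [lam] times the end gap, [73 = 146 / 2] comes from comparing [2] with the distance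
    to the opposite endpoint, and the leading [2] from [1 - x^2 <= 2 w]. *)
Definition trace_const : R := 2 * (72 * 73) ^+ 2.

Lemma weight11_le f :
  pint (-1) 1 ((1 - 'X^2) * f ^+ 2) <= 2 * ip w f f.
Proof.
rewrite /ip -pintZ; apply: ler_pint => [|t t0 t1]; first lra.
rewrite -expr2 hornerM hornerZ (hornerM w) horner_exp [X in _ <= X]mulrA.
rewrite ler_wpM2r ?sqr_ge0 // horner_jweight !polyE.
by case: al hal => [|[]] // _; case: be hbe => [|[]] // _;
  rewrite /= ?expr1 ?expr0; nra.
Qed.

Let trace_aux (V : {poly R}) (a : R) : (size V <= N.+1)%N -> -1 < a -> a < 1 ->
  lam * (1 - a) <= 72 -> 2 <= 146 * (1 + a) ->
  (V.[1] - V.[a]) ^+ 2 <= (72 * 73) ^+ 2 * pint (-1) 1 ((1 - 'X^2) * V^`() ^+ 2).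
Proof.
move=> sV a0 a1 h1 h2; have l0 := lam_gt0 R N0.
have := endpoint_trace a0 a1 sV.
set I := pint _ _ _; set c := (1 - a) / (1 + a) => H.
have I0 : 0 <= I.
  apply: pint_ge0 => [|t t0 t1]; first lra.
  rewrite hornerM mulr_ge0 ?horner_exp ?sqr_ge0 // !polyE; nra.
have c0 : 0 <= c by rewrite divr_ge0; lra.
have lc : lam * c <= 72 * 73.
  rewrite mulrA ler_pdivrMr; last lra.
  apply: le_trans h1 _; rewrite -mulrA ler_peMr //; lra.
have lc2 : (lam * c) ^+ 2 <= (72 * 73) ^+ 2.
  have lc0 : 0 <= lam * c by exact: mulr_ge0.
  rewrite ler_pXn2r ?nnegrE //; lra.
have nn : (N * N.+1 ^ 2 * N.+2)%:R <= 4 * lam ^+ 2 :> R.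
  have h : (N.+2 <= 4 * N)%N by lia.
  have := leq_mul (leqnn (N * N.+1 ^ 2)) h; rewrite -(ler_nat R) => /le_trans; apply.
  by rewrite !natrM ?natrX le_eqVlt; apply/orP; left; apply/eqP; ring.
have lc3 : (N * N.+1 ^ 2 * N.+2)%:R * c ^+ 2 <= 4 * (72 * 73) ^+ 2.
  apply: le_trans (ler_wpM2r (sqr_ge0 c) nn) _.
  by rewrite -mulrA -exprMn ler_wpM2l.
have := le_trans H (ler_wpM2r I0 lc3).
by rewrite -mulrA ler_pM2l.
Qed.

Lemma trace_right V : (size V <= N.+1)%N ->
  (V.[1] - V.[x N.-1]) ^+ 2 <= trace_const * ip w V^`() V^`().
Proof.
move=> sV; have M0 : (0 < N.-1)%N by rewrite -subn1 subn_gt0.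
have MN : (N.-1 < N)%N by rewrite prednK.
have H := trace_aux sV (gl_gtN1 R N0 M0 (ltnW MN)) (gl_lt1 R N0 MN) (gl_last_gap R N0) _.
have := gl_comp_left R N0 M0 MN; rewrite prednK // gl_last // => h.
apply: le_trans (H _) _; first lra.
apply: le_trans (ler_wpM2l (sqr_ge0 _) (weight11_le V^`())) _.
by rewrite /trace_const mulrA (mulrC (_ ^+ 2) 2).
Qed.

Lemma trace_left V : (size V <= N.+1)%N ->
  (V.[x 1] - V.[-1]) ^+ 2 <= trace_const * ip w V^`() V^`().
Proof.
move=> sV; have x1 := gl_gtN1 R N0 (ltn0Sn 0) N0; have x2 := gl_lt1 R N0 N1.
have sV' : (size (V \Po - 'X)%R <= N.+1)%N.
  rewrite (leq_trans (size_comp_poly_leq _ _)) // size_polyN size_polyX muln1.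
  by case: (size V) sV.
have := @trace_aux (V \Po - 'X) (- x 1) sV' _ _ _ _.
rewrite !horner_comp !hornerN !hornerX opprK => H.
have := gl_comp_right R N0 N1; rewrite gl_first // => h.
have {}H := H _ _ _ _.
rewrite -sqrrN opprB; apply: le_trans (H _ _ _ _) _; try lra.
  by have := gl_first_gap R N0; lra.
have -> : (1 - 'X^2) * (V \Po - 'X)^`() ^+ 2 = ((1 - 'X^2) * V^`() ^+ 2) \Po - 'X.
  rewrite deriv_comp derivN derivX mulrN1 sqrrN rmorphM rmorphB !rmorphXn /= comp_polyX.
  by rewrite rmorph1 sqrrN.
rewrite pint_comp_opp opprK.
apply: le_trans (ler_wpM2l (sqr_ge0 _) (weight11_le V^`())) _.
by rewrite /trace_const mulrA (mulrC (_ ^+ 2) 2).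
Qed.

Let pint_1subX (a : R) : 2 * pint a 1 (1 - 'X) = (1 - a) ^+ 2.
Proof.
rewrite -pintZ (_ : 2 *: (1 - 'X) = (- (1 - 'X) ^+ 2)^`()); last first.
  by rewrite derivN deriv_exp derivB -polyC1 derivC derivX -mul_polyC; ring.
by rewrite pint_deriv !polyE; ring.
Qed.

Let pint_1addX (a : R) : 2 * pint (-1) a (1 + 'X) = (1 + a) ^+ 2.
Proof.
rewrite -pintZ (_ : 2 *: (1 + 'X) = ((1 + 'X) ^+ 2)^`()); last first.
  by rewrite deriv_exp derivD -polyC1 derivC derivX -mul_polyC; ring.
by rewrite pint_deriv !polyE; ring.
Qed.

(** Here [w] vanishes at [1] to first order, and its other factor stays between constants on the
    last cell. *)
Lemma cell_weight_last : al = 1%N ->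
  (1 - x N.-1) ^+ 2 <= 146 * cell N N.-1 w /\ cell N N.-1 w <= (1 - x N.-1) ^+ 2.
Proof.
move=> a1; have M0 : (0 < N.-1)%N by rewrite -subn1 subn_gt0.
have MN : (N.-1 < N)%N by rewrite prednK.
rewrite /cell prednK // gl_last //.
have x0 := gl_gtN1 R N0 M0 (ltnW MN); have xl := gl_lt1 R N0 MN.
have := gl_comp_left R N0 M0 MN; rewrite prednK // gl_last // => h.
rewrite -pint_1subX -!pintZ; split; apply: ler_pint; try exact: ltW;
  move=> t t0 t1; rewrite ?hornerZ horner_jweight a1 !polyE;
  case: be hbe => [|[]] // _; rewrite /= ?expr1 ?expr0; nra.
Qed.

Lemma cell_weight_first : be = 1%N ->
  (1 + x 1) ^+ 2 <= 146 * cell N 0 w /\ cell N 0 w <= (1 + x 1) ^+ 2.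
Proof.
move=> b1; rewrite /cell gl_first //.
have x0 := gl_gtN1 R N0 (ltn0Sn 0) N0; have xl := gl_lt1 R N0 N1.
have := gl_comp_right R N0 N1; rewrite gl_first // => h.
rewrite -pint_1addX -!pintZ; split; apply: ler_pint; try exact: ltW;
  move=> t t0 t1; rewrite ?hornerZ horner_jweight b1 !polyE;
  case: al hal => [|[]] // _; rewrite /= ?expr1 ?expr0; nra.
Qed.

(** On these cells each vanishing factor of the weight varies by at most [146], so [w] may be
    replaced by its majorant [W]; an unweighted Cauchy-Schwarz inequality then suffices. *)
Lemma cell_lower i (a : R) (q : {poly R}) : (i < N)%N ->
  (al = 1%N -> (i.+1 < N)%N) -> (be = 1%N -> (0 < i)%N) ->
  cell N i q = a * (x i.+1 - x i) ->
  a ^+ 2 * cell N i w <= 146 ^+ 2 * cell N i (w * (q * q)).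
Proof.
move=> iN ha hb qE; have ab := gl_lt R N0 (ltnSn i) iN.
have xa := gl_geN1 R N0 (ltnW iN); have xb := gl_le1 R N0 iN.
pose W := (1 - x i) ^+ al * (1 + x i.+1) ^+ be.
have c1 : al = 1%N -> 1 - x i <= 146 * (1 - x i.+1) by move=> /ha; exact: gl_comp_right.
have c2 : be = 1%N -> 1 + x i.+1 <= 146 * (1 + x i) by move=> /hb b0; exact: gl_comp_left.
have wle t : x i <= t -> t <= x i.+1 -> w.[t] <= W /\ W <= 146 ^+ 2 * w.[t].
  rewrite horner_jweight /W; move: (x i) (x i.+1) xa xb c1 c2 => u v xa xb c1 c2 ut tv.
  case: al hal c1 => [|[]] // _ c1; case: be hbe c2 => [|[]] // _ c2;
    rewrite /= ?expr1 ?expr0 ?mul1r ?mulr1.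
  - by lra.
  - by have := c2 erefl; lra.
  - by have := c1 erefl; lra.
  - have := c1 erefl; have := c2 erefl => k2 k1; split; first by apply: ler_pM; lra.
    apply: (@le_trans _ _ ((146 * (1 - t)) * (146 * (1 + t)))); last lra.
    by apply: ler_pM; lra.
have W0 : 0 <= W by rewrite mulr_ge0 // exprn_ge0 //; lra.
have h1 : cell N i w <= W * (x i.+1 - x i).
  rewrite -pint_const; apply: ler_pint => [|t t0 t1]; first exact: ltW.
  by rewrite hornerC; case: (wle t t0 t1).
have h2 : (cell N i q) ^+ 2 <= (x i.+1 - x i) * cell N i (q * q).
  have <- : cell N i 1 = x i.+1 - x i by rewrite /cell -polyC1 pint_const mul1r.
  apply: discr_le => t; rewrite -!cellZ -!cellD.
  have -> : 1 + (2 * t) *: q + t ^+ 2 *: (q * q) = (1 + t *: q) ^+ 2.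
    by rewrite -!mul_polyC; ring.
  apply: pint_ge0 => [|u _ _]; first exact: ltW.
  by rewrite horner_exp sqr_ge0.
have h3 : W * cell N i (q * q) <= 146 ^+ 2 * cell N i (w * (q * q)).
  rewrite -!cellZ; apply: ler_pint => [|t t0 t1]; first exact: ltW.
  rewrite !hornerZ (hornerM w) hornerM -expr2 [X in _ <= X]mulrA ler_wpM2r ?sqr_ge0 //.
  by case: (wle t t0 t1).
apply: le_trans h3.
have L0 : 0 < x i.+1 - x i by rewrite subr_gt0.
rewrite qE in h2; move: (x i.+1 - x i) (cell N i w) (cell N i (q * q)) L0 h1 h2 => L cw cq L0 h1 h2.
apply: le_trans (ler_wpM2l (sqr_ge0 a) h1) _; rewrite mulrCA ler_wpM2l //.
by rewrite -(ler_pM2l L0); apply: le_trans h2; rewrite exprMn; lra.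
Qed.

(* Only the cells touching an endpoint where the weight vanishes need
   [endpoint_trace]; elsewhere the weight is comparable to a constant. *)
Lemma lower_bound (a : nat -> R) (p : {poly R}) : (size p <= N.+1)%N ->
  (forall i, (i < N)%N -> p.[x i.+1] - p.[x i] = a i * (x i.+1 - x i)) ->
  \sum_(i < N) a i ^+ 2 * cell N i w <=
  (146 ^+ 2 + 2 * trace_const) * ip w p^`() p^`().
Proof.
move=> sp pa; set E := ip w _ _.
have E0 : 0 <= E by apply: ip_ge0; exact: jweight_ge0.
have T0 : 0 <= trace_const by rewrite mulr_ge0 ?sqr_ge0.
pose r (i : 'I_N) : R := (if i == 0%N :> nat then trace_const * E else 0) +
  (if i == N.-1 :> nat then trace_const * E else 0).
have r0 (i : 'I_N) : 0 <= r i by rewrite addr_ge0 //; case: ifP => //; rewrite mulr_ge0.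
have rE : \sum_(i < N) r i = 2 * trace_const * E.
  rewrite big_split /= -!big_mkcond /= (big_pred1 (Ordinal N0))
    ?(big_pred1 (Ordinal (_ : N.-1 < N)%N)).
  - by rewrite prednK.
  - ring.
  - by [].
  - by [].
have cp i : (i < N)%N -> cell N i p^`() = a i * (x i.+1 - x i).
  by move=> iN; rewrite /cell pint_deriv pa.
apply: (@le_trans _ _ (\sum_(i < N) (146 ^+ 2 * cell N i (w * (p^`() * p^`())) + r i))); last first.
  by rewrite big_split /= -mulr_sumr (sum_cell N0) rE -/(ip w _ _) -/E (mulrDl (146 ^+ 2)).
apply: ler_sum => i _.
have cw0 : 0 <= 146 ^+ 2 * cell N i (w * (p^`() * p^`())).
  rewrite mulr_ge0 ?sqr_ge0 // cell_ge0 // => t /ltW xt /ltW tx.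
  have [t0 t1] := cell_itv N0 xt tx.
  by rewrite (hornerM w) hornerM -expr2 mulr_ge0 ?sqr_ge0 ?jweight_ge0.
have [/andP[/eqP a1 /eqP iN]|nright] := boolP ((al == 1%N) && (i == N.-1 :> nat)).
  rewrite -[X in X <= _]add0r lerD // /r iN eqxx.
  have [_ hw] := cell_weight_last a1.
  have tr := trace_right sp.
  have := pa N.-1; rewrite prednK // => /(_ (leqnn _)); rewrite gl_last // => pE.
  rewrite pE exprMn in tr; have := ler_wpM2l (sqr_ge0 (a N.-1)) hw => h.
  apply: le_trans (le_trans h tr) _; rewrite lerDr; case: ifP => // _; exact: mulr_ge0.
have [/andP[/eqP b1 /eqP iN]|nleft] := boolP ((be == 1%N) && (i == 0%N :> nat)).
  rewrite -[X in X <= _]add0r lerD // /r iN eqxx.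
  have [_ hw] := cell_weight_first b1.
  have tr := trace_left sp.
  have := pa 0%N N0; rewrite gl_first // opprK => pE.
  rewrite pE exprMn [x 1 + 1]addrC in tr; have := ler_wpM2l (sqr_ge0 (a 0)) hw => h.
  apply: le_trans (le_trans h tr) _; rewrite lerDl; case: ifP => // _; exact: mulr_ge0.
rewrite -[X in X <= _]addr0 lerD // cell_lower ?cp //.
- move=> a1; move: nright; rewrite a1 /= => ni.
  by have := ltn_ord i; move: (nat_of_ord i) ni => k ni; lia.
- move=> b1; move: nleft; rewrite b1 /= => ni; by rewrite lt0n.
Qed.

Local Notation ws := (jweight R (1 - al) (1 - be)).

End Traces.

Lemma coef_sqr_ge0 (R : realDomainType) (f : {poly R}) n :
  (size f <= n.+1)%N -> 0 <= (f ^+ 2)`_(2 * n).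
Proof.
rewrite leq_eqVlt => /predU1P[sf|]; last first.
  rewrite ltnS => sf; rewrite nth_default // expr2.
  apply: leq_trans (size_polyMleq _ _) _.
  by move: (size f) sf => m; lia.
have f0 : f != 0 by rewrite -size_poly_gt0 sf.
have -> : (f ^+ 2)`_(2 * n) = lead_coef (f ^+ 2).
  by rewrite lead_coefE expr2 size_mul // sf; congr _`_(_); lia.
by rewrite expr2 lead_coefM -expr2 sqr_ge0.
Qed.

Lemma size_jweight (R : rcfType) (al be : nat) : (al <= 1)%N -> (be <= 1)%N ->
  size (jweight R al be) = (al + be).+1.
Proof.
have s1 : size (1 - 'X : {poly R}) = 2%N by rewrite -opprB size_polyN -polyC1 size_XsubC.
have s2 : size (1 + 'X : {poly R}) = 2%N.
  by rewrite -[1]opprK addrC -polyC1 -polyCN size_XsubC.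
move=> hal hbe; rewrite jweightE.
case: al hal => [|[]] // _; case: be hbe => [|[]] // _;
  rewrite ?expr0 ?expr1 ?mul1r ?mulr1 ?s1 ?s2 ?size_poly1 //.
by rewrite size_mul -?size_poly_gt0 ?s1 ?s2.
Qed.

(** * Energy of the interpolant *)

Section UpperBound.
Variables (R : realType) (N al be : nat).
Hypotheses (N1 : (1 < N)%N) (hal : (al <= 1)%N) (hbe : (be <= 1)%N).
Local Notation x := (gl_point R N).
Local Notation om := (gl_weight R N).
Local Notation w := (jweight R al be).
Local Notation ws := (jweight R (1 - al) (1 - be)).
Local Notation lam := ((N * N.+1)%:R : R).
Local Notation tc := (trace_const R).
Local Notation ic := (interior_const R).

Let N0 : (0 < N)%N. Proof. exact: ltnW. Qed.

(** Integration by parts gives [E = - ip ws zh (w * z')']; Cauchy-Schwarz and the inverse inequality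
    for [z'] yield [E^2 <= ip ws zh zh * lam * E]. Quadrature then bounds the remaining norm from
    above. *)
Lemma quad_energy (zh : {poly R}) : (size (ws * zh)%R <= N.+1)%N ->
  ip w (ws * zh)^`() (ws * zh)^`() <= lam * quad N (ws * zh ^+ 2).
Proof.
move=> sz; set z := ws * zh; set E := ip w _ _.
have l0 := lam_gt0 R N0.
have ha1 : (1 - al <= 1)%N by lia. have hb1 : (1 - be <= 1)%N by lia.
have wge := @jweight_ge0 R al be; have wsge := @jweight_ge0 R (1 - al) (1 - be).
have EE : E = - ip ws zh (w * z^`())^`().
  rewrite /E /ip.
  have -> : w * (z^`() * z^`()) = z^`() * (w * z^`()) by ring.
  have b0 (t : R) : t ^+ 2 = 1 -> z.[t] * (w * z^`()).[t] = 0.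
    move=> t2; rewrite -hornerM /z.
    have -> : ws * zh * (w * (ws * zh)^`()) = (w * ws) * (zh * (ws * zh)^`()) by ring.
    by rewrite jweight_dual // hornerM !polyE t2 subrr mul0r.
  rewrite pint_by_parts !b0 ?sqrrN ?expr1n // subrr sub0r /z.
  by rewrite mulrA.
have sz' : (size z^`() <= N)%N by rewrite size_deriv -subn1 leq_subLR.
have E0 : 0 <= E by exact: ip_ge0.
have CS := ip_CS wsge zh (w * z^`())^`().
have en := jacobi_energy_le hal hbe sz'; rewrite -/E in en.
have zz0 := ip_ge0 wsge zh.
have E2 : E ^+ 2 <= ip ws zh zh * (lam * E).
  rewrite EE sqrrN -EE; apply: le_trans CS _; exact: ler_wpM2l.
apply: (@le_trans _ _ (lam * ip ws zh zh)).
  have [EP|/negbTE] := boolP (0 < E); last first.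
    by move/negbT; rewrite -leNgt => /le_trans; apply; rewrite mulr_ge0 // ltW.
  by rewrite -(ler_pM2r EP) -expr2; apply: le_trans E2 _; rewrite mulrCA mulrA.
rewrite ler_pM2l // /ip -expr2; apply: quad_ge => //.
all: have [->|zh0] := eqVneq zh 0.
- by rewrite expr0n mulr0 size_poly0.
- move: sz; rewrite expr2 !size_mul ?mulf_neq0 ?jweight_neq0 // size_jweight //.
  by move: (size zh) => m; lia.
- by rewrite expr0n mulr0 coef0.
(* Degree [2 N] can only be reached when [ws] is constant, and the coefficient is then that of a
   square. *)
have [ab|ab] := boolP ((al == 1%N) && (be == 1%N)).
  case/andP: ab => /eqP a1 /eqP b1; move: sz; rewrite /z a1 b1 subnn jweight00 !mul1r.
  exact: coef_sqr_ge0.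
rewrite nth_default //; move: sz.
rewrite expr2 !size_mul ?mulf_neq0 ?jweight_neq0 // size_jweight //.
by move: (size zh) ab => m; case: al hal => [|[]] //; case: be hbe => [|[]] //=; lia.
Qed.

Lemma gl_weight_last : om N = 2 / lam.
Proof.
have := gl_weightE R N0 (leqnn N); rewrite gl_last // leg1 expr1n mulr1 => <-.
by rewrite mulfK // gt_eqF // lam_gt0.
Qed.

Lemma gl_weight_first : om 0 = 2 / lam.
Proof.
have := gl_weightE R N0 (leq0n N); rewrite gl_first // legN1_sqr mulr1 => <-.
by rewrite mulfK // gt_eqF // lam_gt0.
Qed.

Lemma gl_weight_min i : (i <= N)%N -> 2 / lam <= om i.
Proof.
move=> iN; rewrite ler_pdivrMr ?lam_gt0 // -(gl_weightE R N0 iN).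
rewrite ler_pM2l ?gl_weight_gt0 // ler_piMr ?leg_sqr_le1 ?gl_geN1 ?gl_le1 //.
Qed.

Lemma sqr_add3_le (u v c : R) : (u + v - c) ^+ 2 <= 3 * (u ^+ 2 + v ^+ 2 + c ^+ 2).
Proof.
have := sqr_ge0 (u - v); have := sqr_ge0 (u + c); have := sqr_ge0 (v + c).
by lra.
Qed.

Let interior_term (A : R) (d : nat -> R) i :
  A = \sum_(j < N) 100 * bump_width R N j * ws.[x j.+1] * d j.+1 ^+ 2 ->
  (0 < i)%N -> (i < N)%N -> om i * (ws.[x i] * d i ^+ 2) <= A.
Proof.
move=> -> i0 iN; have i1 : (i.-1 < N)%N by lia.
rewrite (bigD1 (Ordinal i1)) //= prednK // /bump_width prednK // iN.
rewrite (mulrC 100) divfK ?pnatr_eq0 // mulrA lerDl; apply: sumr_ge0 => j _.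
rewrite mulr_ge0 ?sqr_ge0 // mulr_ge0 //; last by rewrite jweight_ge0 ?gl_geN1 ?gl_le1.
by rewrite mulr_ge0 // bump_width_ge0.
Qed.

Lemma quad_split (zh : {poly R}) :
  quad N (ws * zh ^+ 2) =
  om 0 * (ws.[-1] * zh.[-1] ^+ 2) + om N * (ws.[1] * zh.[1] ^+ 2) +
  \sum_(j < N) 100 * bump_width R N j * ws.[x j.+1] * zh.[x j.+1] ^+ 2.
Proof.
rewrite /quad big_ord_recl /= gl_first // (hornerM ws) horner_exp -addrA; congr (_ + _).
have [M NE] : exists M, N = M.+1 by exists N.-1; rewrite prednK.
have wid (j : nat) : (j.+1 < N)%N -> 100 * bump_width R N j = om j.+1.
  by move=> jN; rewrite /bump_width jN (mulrC 100) divfK ?pnatr_eq0.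
have wid0 : bump_width R N N.-1 = 0 by rewrite /bump_width prednK // ltnn.
have xN := gl_last R N0.
move: wid wid0 xN; rewrite NE => wid wid0 xN.
rewrite !big_ord_recr /= wid0 mulr0 !mul0r addr0 addrC /bump /= xN (hornerM ws) horner_exp.
congr (_ + _); apply: eq_bigr => j _.
by rewrite wid ?ltnS // (hornerM ws) horner_exp mulrA.
Qed.

(** An endpoint value of [z = u - V] is reached from the next interior node: the three terms are the
    value there, the increment of the piecewise linear function and that of [V]. *)
Lemma end_bound (o m A S u v c : R) : 0 <= o -> o <= m -> o * u ^+ 2 <= 2 * A ->
  v ^+ 2 <= 146 * S -> c ^+ 2 <= tc * S -> 0 <= S ->
  o * (u + v - c) ^+ 2 <= 3 * (2 * A + m * ((146 + tc) * S)).
Proof.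
move=> o0 om_ hu hv hc S0.
have T0 : 0 <= tc by rewrite mulr_ge0 ?sqr_ge0.
apply: le_trans (ler_wpM2l o0 (sqr_add3_le u v c)) _.
have h1 : o * (v ^+ 2 + c ^+ 2) <= m * ((146 + tc) * S).
  apply: ler_pM => //; first by rewrite addr_ge0 ?sqr_ge0.
  by rewrite mulrDl lerD.
by lra.
Qed.

Lemma ic_ge0 : 0 <= ic.
Proof. by rewrite mulr_ge0. Qed.

Lemma collect (l n A S t0 t1 e : R) : 0 <= l -> l <= 2 * n -> 0 < n -> 0 <= S ->
  t0 <= 3 * (2 * A + 2 / n * ((146 + tc) * S)) ->
  t1 <= 3 * (2 * A + 2 / n * ((146 + tc) * S)) ->
  A <= ic / n * S -> e <= l * (t0 + t1 + A) ->
  e <= 2 * (13 * ic + 12 * (146 + tc)) * S.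
Proof.
have T0 : 0 <= tc by rewrite mulr_ge0 ?sqr_ge0.
have I0 := ic_ge0; move: tc ic T0 I0 => T I T0 I0 l0 ln n0 S0 h0 h1 hA he.
set c := 13 * I + _.
have h : t0 + t1 + A <= c * S / n by rewrite /c; lra.
have cS : 0 <= c * S by rewrite mulr_ge0 // /c; lra.
apply: le_trans he _; apply: le_trans (ler_wpM2l l0 h) _.
have cn : 0 <= c * S / n by rewrite divr_ge0 // ltW.
apply: le_trans (ler_wpM2r cn ln) _.
clearbody c; rewrite (_ : 2 * n * (c * S / n) = 2 * c * S) //; field.
by rewrite gt_eqF.
Qed.

(** The outer [2] splits [p' = r + z'], the [1] bounds [r], and the rest is the bound on [z'] given
    by [collect]. *)
Definition upper_const : R := 2 * (1 + 2 * (13 * ic + 12 * (146 + tc))).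

Lemma upper_bound (a b : nat -> R) (p : {poly R}) : (size p <= N.+1)%N ->
  (forall i, (i < N)%N -> p.[x i] = a i * x i + b i) ->
  (forall i, (i < N)%N -> p.[x i.+1] = a i * x i.+1 + b i) ->
  ip w p^`() p^`() <= upper_const * \sum_(i < N) a i ^+ 2 * cell N i w.
Proof.
move=> sp pl pr; set S := \sum_(i < N) _.
pose F i : {poly R} := (a i)%:P.
have SE : S = pwip N al be F F.
  by apply: eq_bigr => i _; rewrite -cellZ /F -mul_polyC; congr cell; ring.
have S0 : 0 <= S by rewrite SE pwip_ge0.
have wge := @jweight_ge0 R al be.
have [|r sr rP] := @riesz R w (jweight_neq0 R al be) wge N (fun f => pwip N al be F (fun=> f)).
  move=> c f h; rewrite /pwip mulr_sumr -big_split; apply: eq_bigr => i _ /=.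
  by rewrite -cellZ -cellD; congr cell; rewrite -!mul_polyC; ring.
have rr := rP r sr.
have rr0 := ip_ge0 wge r.
have rS : ip w r r <= S.
  have := pwip_CS N0 al be F (fun=> r); rewrite (pwip_const N0) -rr -SE.
  have [rp|] := ltP 0 (ip w r r); last by move=> /le_trans H _; exact: H.
  by rewrite expr2 ler_pM2r.
pose V0 := primitive r.
have sV0 : (size V0 <= N.+1)%N by rewrite (leq_trans (size_poly _ _)).
pose g0 i : {poly R} := a i *: 'X + (b i)%:P - V0.
(* [k] is the integration constant of [V]. If [w = 1] it must serve both ends, which is possible
   because [u' - r] is orthogonal to constants. If [w] vanishes at both ends it fixes the mean
   instead. *)
have [k [kl kr kb]] : exists k : R, [/\ be = 0%N -> (p - V0).[-1] = k,
    al = 0%N -> (p - V0).[1] = k &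
    al = 1%N -> be = 1%N -> \sum_(i < N) cell N i (g0 i - k%:P) = 0].
  have diff : al = 0%N -> be = 0%N -> (p - V0).[1] = (p - V0).[-1].
    move=> a0 b0; apply/eqP; rewrite -subr_eq0; apply/eqP.
    rewrite -{1}(gl_last R N0) -(gl_first R N0) -(sum_diff N (fun i => (p - V0).[x i])).
    have s1 : (size (1%R : {poly R}) <= N)%N by rewrite size_poly1.
    have := rP _ s1; rewrite -(pwip_const N0) => /eqP; rewrite eq_sym -subr_eq0 => /eqP H.
    rewrite -[RHS]H /pwip -sumrB; apply: eq_bigr => i _.
    rewrite -cellB a0 b0 jweight00 !mul1r !mulr1 /F /cell -{1}[r]deriv_primitive -/V0.
    have -> : (a i)%:P - V0^`() = (a i *: 'X - V0)^`().
      by rewrite derivB derivZ derivX -mul_polyC mulr1.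
    rewrite pint_deriv !hornerD !hornerN (pr i) // (pl i) // !hornerZ !hornerX; ring.
  have [b0|b1] := eqVneq be 0%N.
    exists (p - V0).[-1]; split=> //; last by rewrite b0.
    by move=> a0; exact: diff.
  have [a0|a1] := eqVneq al 0%N.
    exists (p - V0).[1]; split=> //; last by rewrite a0.
    by move=> b0; rewrite b0 in b1.
  pose G := \sum_(i < N) cell N i (g0 i).
  exists (G / 2); split; [by move=> b0; rewrite b0 in b1 | by move=> a0; rewrite a0 in a1 |].
  move=> _ _; transitivity (\sum_(i < N) (cell N i (g0 i) - cell N i (G / 2)%:P)).
    by apply: eq_bigr => i _; rewrite cellB.
  by rewrite sumrB (sum_cell N0) pint_const -/G; field.
pose V := V0 + k%:P; pose z := p - V; pose g i := g0 i - k%:P.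
have sV : (size V <= N.+1)%N.
  rewrite (leq_trans (size_polyD _ _)) // geq_max sV0 /=.
  exact: leq_trans (size_polyC_leq1 _) _.
have dV : V^`() = r by rewrite /V derivD derivC addr0 deriv_primitive.
have zE t : z.[t] = (p - V0).[t] - k by rewrite /z /V !polyE; ring.
have dg i : (g i)^`() = F i - r.
  by rewrite /g /g0 !derivB derivD derivZ derivX !derivC deriv_primitive
    -mul_polyC mulr1 addr0 subr0.
have gl i : (i < N)%N -> (g i).[x i] = z.[x i].
  by move=> iN; rewrite /g /g0 zE !polyE (pl i) //; ring.
have gr i : (i < N)%N -> (g i).[x i.+1] = z.[x i.+1].
  by move=> iN; rewrite /g /g0 zE !polyE (pr i) //; ring.
have pwB G : pwip N al be (fun i => (g i)^`()) (fun=> G) = pwip N al be F (fun=> G) - ip w r G.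
  rewrite -(pwip_const N0) /pwip -sumrB; apply: eq_bigr => i _.
  by rewrite -cellB dg; congr cell; ring.
have g_orth (f : {poly R}) : (size f <= N)%N -> pwip N al be (fun i => (g i)^`()) (fun=> f) = 0.
  by move=> sf; rewrite pwB rP // subrr.
have ES : pwip N al be (fun i => (g i)^`()) (fun i => (g i)^`()) <= S.
  have -> : pwip N al be (fun i => (g i)^`()) (fun i => (g i)^`()) =
      S - 2 * pwip N al be F (fun=> r) + ip w r r.
    rewrite SE -(pwip_const N0) /pwip mulr_sumr -sumrB -big_split; apply: eq_bigr => i _ /=.
    by rewrite -cellZ -cellB -cellD dg; congr cell; rewrite -mul_polyC; ring.
  by rewrite -rr; lra.
have zl : be = 0%N -> z.[x 0] = 0 by move=> b0; rewrite gl_first // zE kl // subrr.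
have zr : al = 0%N -> z.[x N] = 0 by move=> a0; rewrite gl_last // zE kr // subrr.
have ha1 : (1 - al <= 1)%N by lia. have hb1 : (1 - be <= 1)%N by lia.
have [||zh zhE] := @jweight_dvd R (1 - al) (1 - be) z ha1 hb1.
- by move=> a1; rewrite -(gl_last R N0) zr //; lia.
- by move=> b1; rewrite -(gl_first R N0) zl //; lia.
have zd i : (i <= N)%N -> z.[x i] = ws.[x i] * zh.[x i] by rewrite zhE hornerM.
have A1 := interior_estimate N0 hal hbe gl gr g_orth zl zr kb zd.
set A := \sum_(j < N) _ in A1.
have sz : (size (ws * zh)%R <= N.+1)%N.
  by rewrite -zhE (leq_trans (size_polyD _ _)) // geq_max sp size_polyN sV.
have Ez := quad_energy sz; rewrite -zhE quad_split -/A in Ez.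
have l0 := lam_gt0 R N0.
have n0 : (0 : R) < (N ^ 2)%:R by rewrite ltr0n expn_gt0 N0.
have ln : 2 / lam <= 2 / (N ^ 2)%:R.
  by rewrite ler_pM2l // lef_pV2 ?posrE // ler_nat -mulnn leq_pmul2l //.
have lo0 : 0 <= 2 / lam by rewrite divr_ge0 // ltW.
have T0 : 0 <= tc by rewrite mulr_ge0 ?sqr_ge0.
have A0 : 0 <= A.
  apply: sumr_ge0 => j _; rewrite mulr_ge0 ?sqr_ge0 // mulr_ge0 //.
    by rewrite mulr_ge0 // bump_width_ge0.
  by rewrite jweight_ge0 ?gl_geN1 ?gl_le1.
have cw (i : 'I_N) : 0 <= cell N i w.
  by apply: cell_ge0 => // t /ltW xt /ltW tx; have [t0 t1] := cell_itv N0 xt tx; exact: jweight_ge0.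
have single i : (i < N)%N -> a i ^+ 2 * cell N i w <= S.
  move=> iN; rewrite /S (bigD1 (Ordinal iN)) //= lerDl; apply: sumr_ge0 => j _.
  by rewrite mulr_ge0 ?sqr_ge0.
set B := 3 * (2 * A + 2 / (N ^ 2)%:R * ((146 + tc) * S)).
have zV t : z.[t] = p.[t] - V.[t] by rewrite /z hornerD hornerN.
have B0 : 0 <= B.
  have m0 : 0 <= 2 / (N ^ 2)%:R :> R by rewrite divr_ge0 // ltW.
  have mS : 0 <= (146 + tc) * S by rewrite mulr_ge0 // addr_ge0.
  rewrite mulr_ge0 // addr_ge0 //; first by rewrite mulr_ge0.
  exact: mulr_ge0 m0 mS.
have term_le (c : R) : 1 <= ws.[c] -> ws.[c] * zh.[c] ^+ 2 <= z.[c] ^+ 2.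
  move=> wc; rewrite zhE hornerM exprMn ler_wpM2r ?sqr_ge0 //.
  by rewrite expr2 ler_peMl // (le_trans ler01).
(* The end weights [2 / lam] are the smallest, so they can be traded for the weight of the
   neighbouring node. *)
have node_le i : (0 < i)%N -> (i < N)%N -> ws.[x i] <= 2 -> 2 / lam * z.[x i] ^+ 2 <= 2 * A.
  move=> i0 iN w2; have iN' := ltnW iN.
  have w0 : 0 <= ws.[x i] by rewrite jweight_ge0 ?gl_geN1 ?gl_le1.
  apply: (@le_trans _ _ (om i * z.[x i] ^+ 2)).
    by rewrite ler_wpM2r ?sqr_ge0 ?gl_weight_min.
  have := interior_term (d := fun i => zh.[x i]) erefl i0 iN; rewrite -/A => h.
  have : ws.[x i] * (om i * (ws.[x i] * zh.[x i] ^+ 2)) <= 2 * A.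
    apply: ler_pM => //; rewrite mulr_ge0 //; first by rewrite ltW // gl_weight_gt0.
    by rewrite mulr_ge0 ?sqr_ge0.
  by congr (_ <= _); rewrite zhE hornerM; ring.
have TN : om N * (ws.[1] * zh.[1] ^+ 2) <= B.
  rewrite gl_weight_last; have [a0|a1] := eqVneq al 0%N.
    by rewrite horner_jweight a0 subn0 expr1 subrr !mul0r mulr0.
  have {}a1 : al = 1%N by case: al hal a1 => [|[]].
  have M0 : (0 < N.-1)%N by rewrite -subn1 subn_gt0.
  have MN : (N.-1 < N)%N by rewrite prednK.
  have w1 : 1 <= ws.[1].
    rewrite horner_jweight a1 subnn expr0 mul1r.
    by case: be hbe => [|[]] // _; rewrite ?expr1 ?expr0; lra.
  apply: le_trans (ler_wpM2l lo0 (term_le _ w1)) _.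
  have -> : z.[1] = z.[x N.-1] + a N.-1 * (1 - x N.-1) - (V.[1] - V.[x N.-1]).
    have := pl _ MN; have := pr _ MN; rewrite prednK // gl_last // !zV => -> ->.
    by ring.
  apply: end_bound => //.
  - apply: node_le => //; rewrite horner_jweight a1 subnn expr0 mul1r.
    have := gl_le1 R N0 (ltnW MN).
    by case: be hbe => [|[]] // _; rewrite ?expr1 ?expr0; lra.
  - have [hw _] := cell_weight_last R N1 hbe a1; rewrite exprMn.
    have := ler_wpM2l (sqr_ge0 (a N.-1)) hw; have := single _ MN; lra.
  - have := trace_right N1 hal hbe sV; rewrite dV => /le_trans; apply.
    exact: ler_wpM2l.
have TO : om 0 * (ws.[-1] * zh.[-1] ^+ 2) <= B.
  rewrite gl_weight_first; have [b0|b1] := eqVneq be 0%N.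
    by rewrite horner_jweight b0 subn0 expr1 subrr !(mulr0, mul0r).
  have {}b1 : be = 1%N by case: be hbe b1 => [|[]].
  have w1 : 1 <= ws.[-1].
    rewrite horner_jweight b1 subnn expr0 mulr1 opprK.
    by case: al hal => [|[]] // _; rewrite ?expr1 ?expr0; lra.
  apply: le_trans (ler_wpM2l lo0 (term_le _ w1)) _.
  have -> : z.[-1] ^+ 2 = (z.[x 1] + - (a 0 * (1 + x 1)) - (V.[-1] - V.[x 1])) ^+ 2.
    congr (_ ^+ 2).
    have := pl _ N0; have := pr _ N0; rewrite gl_first // !zV => -> ->.
    by ring.
  apply: end_bound => //.
  - apply: node_le => //; rewrite horner_jweight b1 subnn expr0 mulr1.
    have := gl_geN1 R N0 N0.
    by case: al hal => [|[]] // _; rewrite ?expr1 ?expr0; lra.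
  - have [hw _] := cell_weight_first R N1 hal b1; rewrite sqrrN exprMn.
    have := ler_wpM2l (sqr_ge0 (a 0)) hw; have := single _ N0; lra.
  - rewrite -sqrrN opprB; have := trace_left N1 hal hbe sV; rewrite dV => /le_trans; apply.
    exact: ler_wpM2l.
have AS : A <= ic / (N ^ 2)%:R * S.
  by apply: le_trans A1 _; rewrite ler_wpM2l // divr_ge0 ?ic_ge0 // ltW.
have lam2 : lam <= 2 * (N ^ 2)%:R.
  by rewrite -natrM ler_nat -mulnn mulnCA leq_pmul2l // mul2n -addnn -addn1 leq_add2l.
have Ez1 : ip w z^`() z^`() <= 2 * (13 * ic + 12 * (146 + tc)) * S.
  exact: (collect (ltW l0) lam2 n0 S0 TO TN AS Ez).
have -> : p^`() = r + z^`() by rewrite /z derivB dV addrCA subrr addr0.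
(* The square of [r - z'] bounds the cross term of [r + z']. *)
have := ip_ge0 wge (r + (-1) *: z^`()).
rewrite !(ipDl, ipDr, ipZl, ipZr) (ipC w z^`() r) /upper_const.
move: (ip w r r) (ip w r _) (ip w z^`() _) rS Ez1 => R1 R2 R3 rS Ez1; lra.
Qed.

End UpperBound.

Local Open Scope classical_set_scope.
Local Open Scope ring_scope.

(** * Lebesgue integrals of piecewise polynomials *)

Section Lebesgue.
Variable R : realType.
Local Notation mu := (@lebesgue_measure R).
Implicit Types f : {poly R}.

Lemma integral_horner f a b : a < b ->
  (\int[mu]_(x in `[a, b]) (f.[x])%:E)%E = (pint a b f)%:E.
Proof.
move=> ab; rewrite (@continuous_FTC2 _ (horner f) (horner (primitive f))) //.
- exact/continuous_subspaceT/continuous_horner.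
- split.
  + by move=> x _; exact: derivable_horner.
  + by apply: cvg_at_right_filter; exact: continuous_horner.
  + by apply: cvg_at_left_filter; exact: continuous_horner.
- by move=> x _; rewrite -derivE deriv_primitive.
Qed.

Lemma measurable_horner f (D : set R) : measurable D -> measurable_fun D (horner f).
Proof.
move=> mD; apply: (measurable_funS measurableT) => //.
by apply: continuous_measurable_fun; exact: continuous_horner.
Qed.

(** Agreement is asked on open cells only: at a node [u] may have a kink, where its derivative
    carries no information, and nodes form a null set. *)
Lemma integral_piecewise_horner (n : nat) (t : nat -> R) (f : nat -> {poly R})
    (h : R -> R) :
  (0 < n)%N -> (forall i, (i < n)%N -> t i < t i.+1) ->
  (forall i, (i < n)%N -> {in `]t i, t i.+1[%R, h =1 horner (f i)}) ->
  measurable_fun `[t 0%N, t n] h /\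
  (\int[mu]_(x in `[t 0%N, t n]) (h x)%:E)%E
    = (\sum_(i < n) pint (t i) (t i.+1) (f i))%:E.
Proof.
elim: n => // n IH _ tlt hf; have Sn i : (i < n)%N -> (i < n.+1)%N by move/ltnW.
have mh : measurable_fun `]t n, t n.+1[ h.
  apply: (eq_measurable_fun (horner (f n))); last exact: measurable_horner.
  by move=> x; rewrite inE /= => xi; rewrite (hf n).
have ih b : (\int[mu]_(x in [set` Interval (BSide b (t n)) (BRight (t n.+1))]) (h x)%:E)%E =
    (pint (t n) (t n.+1) (f n))%:E.
  rewrite -integral_horner ?tlt // integral_itv_bndoo; last exact/measurable_EFinP.
  rewrite [RHS]integral_itv_bndoo; last by apply/measurable_EFinP; exact: measurable_horner.
  by apply: eq_integral => x; rewrite inE /= => xi; rewrite (hf n) ?inE /=.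
have {}mh b : measurable_fun [set` Interval (BSide b (t n)) (BRight (t n.+1))] h.
  apply/measurable_fun_itv_bndo_bndcP.
  by case: b; [apply/measurable_fun_itv_obnd_cbndP|].
case: n => [|n] in IH Sn tlt hf mh ih *; first by rewrite big_ord1; split=> //; apply: mh.
have [mIH iIH] := IH isT (fun i ii => tlt i (Sn i ii)) (fun i ii => hf i (Sn i ii)).
have t0 k : (k <= n.+1)%N -> t 0%N <= t k.
  elim: k => // k IHk kn.
  by apply: le_trans (IHk (ltnW kn)) (ltW (tlt _ (leqW kn))).
have t0n := t0 _ (leqnn _).
have E : `[t 0%N, t n.+2]%classic = `[t 0%N, t n.+1] `|` `]t n.+1, t n.+2].
  by rewrite (itv_bndbnd_setU (x := BRight (t n.+1))) // bnd_simp ltW ?tlt.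
have mU : measurable_fun `[t 0%N, t n.+2] h.
  by rewrite E; apply/measurable_funU => //; split => //; exact: (mh false).
split=> //; rewrite E integral_setU //.
- by rewrite iIH (ih false) [in RHS]big_ord_recr.
- by rewrite -E; exact/measurable_EFinP.
- by apply/disj_setPS => y []/=; rewrite !in_itv /= => /andP[_ yt] /andP[/lt_geF]; rewrite yt.
Qed.

End Lebesgue.

(** * From energies to norms *)

Section Main.
Variables (R : realType) (al be : nat).
Local Notation w := (jweight R al be).

Lemma jacobi_norm_horner (p : {poly R}) :
  jacobi_norm al be (horner p) = Num.sqrt (ip w p p).
Proof.
congr Num.sqrt; rewrite /Rintegral /ip.
have -> : pint (-1) 1 (w * (p * p)) = fine (pint (-1) 1 (w * (p * p)))%:E by [].
rewrite -integral_horner; last lra.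
congr fine; apply: eq_integral => x _; congr (_%:E).
by rewrite !hornerM horner_jweight; ring.
Qed.

Lemma derive1_piecewise_affine (N i : nat) (u : R -> R) (a b y : R) :
  (forall x, x \in `[gl_point R N i, gl_point R N i.+1]%R -> u x = a * x + b) ->
  y \in `]gl_point R N i, gl_point R N i.+1[%R -> u^`()%classic y = a.
Proof.
move=> ue yi; rewrite derive1E.
rewrite (@near_eq_derive _ _ _ _ (horner (a *: 'X + b%:P)) _ 1).
  have := is_derive_horner (a *: 'X + b%:P) y => /(@derive_val _ _ _ _ _ _ _) ->.
  by rewrite derivD derivZ derivX derivC addr0 hornerZ hornerC mulr1.
near=> x; rewrite ue ?hornerD ?hornerZ ?hornerX ?hornerC //.
apply: subset_itv_oo_cc; near: x; exact: near_in_itvoo.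
Unshelve. all: by end_near.
Qed.

Lemma jacobi_norm_piecewise (N : nat) (u : R -> R) (a b : nat -> R) : (0 < N)%N ->
  (forall i, (i < N)%N -> forall x,
    x \in `[gl_point R N i, gl_point R N i.+1]%R -> u x = a i * x + b i) ->
  jacobi_norm al be u^`()%classic = Num.sqrt (\sum_(i < N) a i ^+ 2 * cell N i w).
Proof.
move=> N0 ue; congr Num.sqrt; rewrite /Rintegral.
have [|i iN y yi|_] := @integral_piecewise_horner R N (gl_point R N)
  (fun i => a i ^+ 2 *: w)
  (fun x => u^`()%classic x ^+ 2 * (1 - x) ^+ al * (1 + x) ^+ be) N0.
- by move=> i iN; apply: gl_lt.
- rewrite (derive1_piecewise_affine (ue i iN) yi) hornerZ horner_jweight; ring.
rewrite gl_first // gl_last // => -> /=.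
by apply: eq_bigr => i _; rewrite -cellZ.
Qed.

End Main.

Lemma upper_const_ge0 (R : realType) : 0 <= upper_const R.
Proof.
rewrite /upper_const; have := ic_ge0 R.
have : 0 <= trace_const R by rewrite mulr_ge0 // sqr_ge0.
by move: (trace_const R) (interior_const R) => t c; lra.
Qed.

Lemma lower_const_ge0 (R : realType) : 0 <= 146 ^+ 2 + 2 * trace_const R :> R.
Proof. by rewrite addr_ge0 ?sqr_ge0 // mulr_ge0 // mulr_ge0 // sqr_ge0. Qed.

(** As [c + 1 >= 1], it is at most its square, so the constant survives the square root
    unchanged. *)
Lemma sqrt_le_scale (R : rcfType) (s t c : R) :
  0 <= t -> 0 <= c -> s <= (c + 1) * t -> Num.sqrt s <= (c + 1) * Num.sqrt t.
Proof.
move=> t0 c0 st; have c1 : 0 <= c + 1 by rewrite addr_ge0.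
rewrite -(ger0_norm c1) -sqrtr_sqr -sqrtrM ?sqr_ge0 // ler_wsqrtr //.
by apply: le_trans st _; rewrite ler_wpM2r // expr2 ler_peMr // lerDr.
Qed.

Theorem theorem5 (R : realType) (alpha beta : nat)
    (halpha : (alpha <= 1)%N) (hbeta : (beta <= 1)%N) :
  exists C : R, 1 <= C /\
    forall N : nat, (1 <= N)%N ->
    forall u : R -> R, gl_piecewise_linear N u ->
    forall p : {poly R}, gl_interpolant N u p ->
      C^-1 * jacobi_norm alpha beta (u^`()%classic)
        <= jacobi_norm alpha beta ((horner p)^`()%classic) /\
      jacobi_norm alpha beta ((horner p)^`()%classic)
        <= C * jacobi_norm alpha beta (u^`()%classic).
Proof.
have := @lower_bound R; have := @upper_bound R.
move: (lower_const_ge0 R) (upper_const_ge0 R).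
move: (146 ^+ 2 + _) (upper_const R) => L U L0 U0 upper lower.
exists (U + L + 1); have C1 : 1 <= U + L + 1 by lra.
split=> // N N0 u [_ upl] p [sp pu].
have C0 : 0 < U + L + 1 by lra.
have [ab abP] : {ab : nat -> R * R & forall i, (i < N)%N -> forall x,
    x \in `[gl_point R N i, gl_point R N i.+1]%R -> u x = (ab i).1 * x + (ab i).2}.
  apply: (@choice _ _ (fun i (ab : R * R) => (i < N)%N -> forall x,
    x \in `[gl_point R N i, gl_point R N i.+1]%R -> u x = ab.1 * x + ab.2)) => i.
  have [iN|_] := boolP (i < N)%N; last by exists (0, 0).
  by have [a [b h]] := upl _ iN; exists (a, b).
pose a i := (ab i).1; pose b i := (ab i).2.
have xle i : (i < N)%N -> gl_point R N i <= gl_point R N i.+1 by move=> iN; rewrite ltW // gl_lt.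
have pl i : (i < N)%N -> p.[gl_point R N i] = a i * gl_point R N i + b i.
  by move=> iN; rewrite (pu _ (ltnW iN)) (abP i iN) // bound_itvE xle.
have pr i : (i < N)%N -> p.[gl_point R N i.+1] = a i * gl_point R N i.+1 + b i.
  by move=> iN; rewrite (pu _ iN) (abP i iN) // bound_itvE xle.
set w := jweight R alpha beta.
have En0 : 0 <= ip w p^`() p^`() by apply: ip_ge0 => y; exact: jweight_ge0.
have Sn0 : 0 <= \sum_(i < N) a i ^+ 2 * cell N i w.
  apply: sumr_ge0 => i _; rewrite mulr_ge0 ?sqr_ge0 // cell_ge0 // => t lt rt.
  by apply: jweight_ge0;
    [have := gl_geN1 R N0 (ltnW (ltn_ord i))|have := gl_le1 R N0 (ltn_ord i)]; lra.
rewrite -derivE (jacobi_norm_piecewise _ _ N0 abP) jacobi_norm_horner -/a.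
have [LB UB] : \sum_(i < N) a i ^+ 2 * cell N i w <= (L + 1) * ip w p^`() p^`() /\
    ip w p^`() p^`() <= (U + 1) * \sum_(i < N) a i ^+ 2 * cell N i w.
  (* For [N = 1] there is no interior node, but [p] and [u] are the same affine function and the
     energies coincide. *)
  move: N0; rewrite leq_eqVlt => /predU1P[N1|N1].
    have dE : p^`() = (a 0%N)%:P.
      have sd : (size p^`() <= 1)%N.
        have [->|p0] := eqVneq p 0; first by rewrite deriv0 size_poly0.
        by rewrite -ltnS (leq_trans (lt_size_deriv p0)) // N1.
      have := pint_deriv (-1) 1 p; have := pl 0%N; have := pr 0%N.
      rewrite (size1_polyC sd) -N1 gl_first // (gl_last R (N := 1)) // pint_const.
      move=> /(_ isT) -> /(_ isT) -> e; congr (_%:P); lra.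
    have -> : ip w p^`() p^`() = \sum_(i < N) a i ^+ 2 * cell N i w.
      rewrite -N1 big_ord1 -cellZ /ip /cell gl_first // (gl_last R (N := 1)) // dE.
      by rewrite -polyCM mulrC mul_polyC expr2.
    by rewrite !mulrDl mul1r !lerDr !mulr_ge0.
  have Sle := lower _ _ _ N1 halpha hbeta a _ sp.
  have Ele := upper _ _ _ N1 halpha hbeta _ _ _ sp pl pr.
  split.
    apply: le_trans (Sle _) _; last by rewrite ler_wpM2r // lerDl.
    by move=> i iN; rewrite pr // pl //; ring.
  by apply: le_trans Ele _; rewrite ler_wpM2r // lerDl.
split.
  rewrite ler_pdivrMl //; apply: le_trans (sqrt_le_scale En0 L0 LB) _.
  by rewrite ler_wpM2r ?sqrtr_ge0 //; lra.
apply: le_trans (sqrt_le_scale Sn0 U0 UB) _.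
by rewrite ler_wpM2r ?sqrtr_ge0 //; lra.
Qed.
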